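(* Let $q\geq 2$ and $n\geq 1$. Then there is a homeomorphism \[\mathrm{Hom}(F_n/\Gamma^{q+1}_n,U(2))\cong \mathrm{Hom}(\mathbb{Z}^n,U(2))\sqcup \bigsqcup_{M(n)}(S^1)^n\times_{(\mathbb{Z}/2)^2} PU(2)\sqcup \bigsqcup_{M(n,q)}(S^1)^n\times_{\mathbb{Z}/2} PU(2),\] with $M(n)$ summands of the first kind and $M(n,q)$ summands of the second kind, where \[M(n)=\frac{(2^n-1)(2^{n-1}-1)}{3}\quad\text{and}\quad M(n,q)=(2^n-1)\left(2^{(q-2)(n-1)}-1\right)2^{n-2}.\]
   Context: $F_n$ is the free group on $n$ generators; the descending central series of a group $Q$ is $\Gamma^1(Q)=Q$, $\Gamma^{k+1}(Q)=[\Gamma^k(Q),Q]$, and $\Gamma^k_n:=\Gamma^k(F_n)$. For a discrete group $\Gamma$ and a topological group $G$, $\mathrm{Hom}(\Gamma,G)$ is the set of homomorphisms topologized as a subspace of $G^\Gamma$ with the product topology; for $\Gamma$ generated by $n$ elements this agrees with its topology as a subspace of $G^n$. $PU(2)=SU(2)/\{\pm I\}$. The group $(\mathbb{Z}/2)^n=\{\pm1\}^n$ acts on $(S^1)^n$ and on $\mathrm{Hom}(F_n/\Gamma^{q+1}_n,SU(2))\subset SU(2)^n$ by coordinatewise multiplication by signs. Each connected component $K$ of $\mathrm{Hom}(F_n/\Gamma^{q+1}_n,SU(2))$ consisting of tuples that generate a non-abelian subgroup is the conjugation orbit of a tuple $(x_1,\dots,x_n)$ and is identified with $PU(2)$ via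 $g\mapsto (gx_1g^{-1},\dots,gx_ng^{-1})$. In a summand $(S^1)^n\times_{H}PU(2)$, with $H\cong(\mathbb{Z}/2)^2$ or $H\cong\mathbb{Z}/2$, the group $H$ is the subgroup of $(\mathbb{Z}/2)^n$ preserving such a component $K\cong PU(2)$, and $(S^1)^n\times_H PU(2)$ is the quotient of $(S^1)^n\times PU(2)$ by the diagonal action of $H$ (signs on $(S^1)^n$ and the restricted sign action on $K\cong PU(2)$). *)

(* Defs.v *)
From HB Require Import structures.
From mathcomp Require Import all_boot all_order all_algebra all_fingroup.
From mathcomp Require Import all_classical all_reals all_analysis complex.
From mathcomp Require Import zify.

Set Implicit Arguments.
Unset Strict Implicit.
Unset Printing Implicit Defensive.

Import Order.TTheory GRing.Theory Num.Theory.
Import numFieldNormedType.Exports.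

Local Open Scope classical_set_scope.
Local Open Scope ring_scope.

Section Subgroups.
Variable G : groupType.
Implicit Types A B : set G.

Definition is_subgroup A :=
  [/\ A 1%g, forall x y, A x -> A y -> A (x * y)%g
    & forall x, A x -> A (x^-1)%g].

Definition generated A : set G := smallest is_subgroup A.

Definition commutator_subgroup A B : set G :=
  generated [set z | exists2 x, A x & exists2 y, B y & z = [~ x, y]%g].

Definition is_abelian A := forall x y, A x -> A y -> (x * y = y * x)%g.

(* The series is indexed from 1; the index 0 is a junk value. *)
Fixpoint central_series (k : nat) : set G :=
  if k is k'.+1 then
    if k' is 0 then setT else commutator_subgroup (central_series k') setT
  else setT.

Record normal_subgroup := NormalSubgroup {
  normal_set :> set G;
  normal_is_subgroup : is_subgroup normal_set;
  normal_conj : forall x y, normal_set x -> normal_set (x ^ y)%g }.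

Lemma generated_subgroup A : is_subgroup (generated A).
Proof.
split=> [B [[]]//|x y Ax Ay B BP|x Ax B BP].
  by have [[_ BM _] _] := BP; apply: BM; [exact: Ax|exact: Ay].
by have [[_ _ BV] _] := BP; apply: BV; exact: Ax.
Qed.

Lemma generated_conj A : (forall x y, A x -> A (x ^ y)%g) ->
  forall x y, generated A x -> generated A (x ^ y)%g.
Proof.
move=> AJ x y Ax; have [g1 gM gV] := generated_subgroup A.
apply: (Ax [set z | generated A (z ^ y)%g]); split; last first.
  by move=> z Az; apply: sub_gen_smallest; exact: AJ.
split=> /= [|u v gu gv|u gu]; first by rewrite conj1g.
  by rewrite conjMg; exact: gM.
by rewrite conjVg; exact: gV.
Qed.

Lemma central_series_subgroup k : is_subgroup (central_series k).
Proof. by case: k => [|[|k]]; [..|exact: generated_subgroup]. Qed.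

Lemma central_series_conj k x y :
  central_series k x -> central_series k (x ^ y)%g.
Proof.
elim: k x y => [|[|k] IHk] x y //; apply: generated_conj => {}x {}y.
case=> a Aa [b _ ->]; exists (a ^ y)%g; first exact: IHk.
by exists (b ^ y)%g; rewrite // conjRg.
Qed.

Definition central_subgroup k : normal_subgroup :=
  NormalSubgroup (central_series_subgroup k) (@central_series_conj k).

End Subgroups.

Section QuotientGroup.
Variables (G : groupType) (N : normal_subgroup G).
Local Open Scope quotient_scope.
Local Open Scope group_scope.

Definition coset_rel : rel G := fun x y => `[< normal_set N (x^-1 * y) >].

Lemma coset_rel_equiv : equiv_class_of coset_rel.
Proof.
have [N1 NM NV] := normal_is_subgroup N.
split=> [x|x y|y x z]; first by apply/asboolP; rewrite mulVg.
  by apply/asboolP/asboolP => /NV; rewrite invgM invgK.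
by move=> /asboolP Nxy /asboolP Nyz; apply/asboolP; have := NM _ _ Nxy Nyz;
  rewrite mulgA mulgK.
Qed.

Canonical coset_equiv := EquivRelPack coset_rel_equiv.

Definition quotient_group : Type := {eq_quot coset_equiv}.
HB.instance Definition _ := Choice.on quotient_group.
HB.instance Definition _ := EqQuotient.on quotient_group.

Definition qclass (x : G) : quotient_group := \pi_{eq_quot coset_equiv} x.

Lemma qclass_eq x y : qclass x = qclass y <-> normal_set N (x^-1 * y).
Proof. by split=> [/eqmodP/asboolP//|Nxy]; apply/eqmodP/asboolP. Qed.

Lemma qclass_repr (x : quotient_group) : qclass (generic_quotient.repr x) = x.
Proof. exact: reprK. Qed.

Lemma qclass_mulP x y x' y' :
  qclass x = qclass x' -> qclass y = qclass y' -> qclass (x * y) = qclass (x' * y').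
Proof.
have [N1 NM NV] := normal_is_subgroup N.
move=> /qclass_eq Nx /qclass_eq Ny; apply/qclass_eq.
have -> : (x * y)^-1 * (x' * y') = (x^-1 * x') ^ y * (y^-1 * y').
  by rewrite conjgE invgM !mulgA mulgK.
by apply: NM => //; exact: normal_conj.
Qed.

Lemma qclass_invP x x' : qclass x = qclass x' -> qclass x^-1 = qclass x'^-1.
Proof.
have [N1 NM NV] := normal_is_subgroup N.
move=> /qclass_eq /NV Nx; apply/qclass_eq; rewrite invgK.
have -> : x * x'^-1 = (x^-1 * x')^-1 ^ x^-1.
  by rewrite conjgE invgM !invgK !mulgA mulgK.
exact: normal_conj.
Qed.

Definition quotient_mul (x y : quotient_group) := qclass (generic_quotient.repr x * generic_quotient.repr y).
Definition quotient_one := qclass 1.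
Definition quotient_inv (x : quotient_group) := qclass (generic_quotient.repr x)^-1.

Lemma quotient_mulE x y : quotient_mul (qclass x) (qclass y) = qclass (x * y).
Proof. by apply: qclass_mulP; rewrite qclass_repr. Qed.

Lemma quotient_invE x : quotient_inv (qclass x) = qclass x^-1.
Proof. by apply: qclass_invP; rewrite qclass_repr. Qed.

Lemma quotient_mulA : associative quotient_mul.
Proof.
move=> x y z; rewrite -(qclass_repr x) -(qclass_repr y) -(qclass_repr z).
by rewrite !quotient_mulE mulgA.
Qed.

Lemma quotient_mul1g : left_id quotient_one quotient_mul.
Proof. by move=> x; rewrite -(qclass_repr x) quotient_mulE mul1g. Qed.

Lemma quotient_mulg1 : right_id quotient_one quotient_mul.
Proof. by move=> x; rewrite -(qclass_repr x) quotient_mulE mulg1. Qed.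

Lemma quotient_mulVg : left_inverse quotient_one quotient_inv quotient_mul.
Proof. by move=> x; rewrite -(qclass_repr x) quotient_invE quotient_mulE mulVg. Qed.

Lemma quotient_mulgV : right_inverse quotient_one quotient_inv quotient_mul.
Proof. by move=> x; rewrite -(qclass_repr x) quotient_invE quotient_mulE mulgV. Qed.

HB.instance Definition _ := isGroup.Build quotient_group
  quotient_mulA quotient_mul1g quotient_mulg1 quotient_mulVg quotient_mulgV.

End QuotientGroup.

Section FreeGroup.
Variable n : nat.

(* The letter (i, b) is the i-th generator if b = false, its inverse otherwise;
   elements of the free group are the reduced words in these letters. *)
Definition letter : Type := ('I_n * bool)%type.
Definition flip_letter (l : letter) : letter := (l.1, ~~ l.2).

Fixpoint reduced (w : seq letter) : bool :=
  if w is l :: w' then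
    (if w' is l' :: _ then l' != flip_letter l else true) && reduced w'
  else true.

Definition push_letter (l : letter) (w : seq letter) :=
  if w is l' :: w' then if l' == flip_letter l then w' else l :: w else [:: l].

Definition reduce (w : seq letter) := foldr push_letter [::] w.

Lemma flip_letterK : involutive flip_letter.
Proof. by case=> i b; rewrite /flip_letter /= negbK. Qed.

Lemma reduced_push l w : reduced w -> reduced (push_letter l w).
Proof.
case: w => [|l' w] //= /andP[ll' rw].
by case: ifPn => [_|nl] //=; rewrite nl ll'.
Qed.

Lemma reduced_foldr u w : reduced w -> reduced (foldr push_letter w u).
Proof. by move=> rw; elim: u => //= l u; exact: reduced_push. Qed.

Lemma push_flip l w : reduced w -> push_letter l (push_letter (flip_letter l) w) = w.
Proof.
case: w => [|l' w] /=; first by rewrite eqxx.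
rewrite flip_letterK; case: eqP => [-> /andP[lw rw]|_ _] /=; last by rewrite eqxx.
by case: w lw rw => //= l'' w /negbTE ->.
Qed.

Lemma foldr_push l u w : reduced w ->
  foldr push_letter w (push_letter l u) = push_letter l (foldr push_letter w u).
Proof.
move=> rw; case: u => [|l' u] //=; case: eqP => // ->.
by rewrite push_flip// reduced_foldr.
Qed.

Lemma foldr_reduce u w : reduced w ->
  foldr push_letter w (reduce u) = foldr push_letter w u.
Proof. by move=> rw; elim: u => //= l u IHu; rewrite foldr_push// IHu. Qed.

Lemma reduce_id w : reduced w -> reduce w = w.
Proof.
elim: w => //= l [|l' w] IHw //= /andP[nl rw].
by have /= -> := IHw rw; rewrite /= (negbTE nl).
Qed.

Definition free_group : Type := {w : seq letter | reduced w}.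
HB.instance Definition _ := Choice.on free_group.

Lemma reduced_reduce w : reduced (reduce w).
Proof. exact: reduced_foldr. Qed.

Definition word_class w : free_group := Sub (reduce w) (reduced_reduce w).

Definition inv_word (w : seq letter) := rev (map flip_letter w).

Definition free_one : free_group := word_class [::].
Definition free_mul (u v : free_group) : free_group :=
  word_class (val u ++ val v).
Definition free_inv (u : free_group) : free_group :=
  word_class (inv_word (val u)).

Lemma reduce_cat u v : reduce (u ++ v) = reduce (reduce u ++ reduce v).
Proof.
have E x y : reduce (x ++ y) = foldr push_letter (reduce y) x by exact: foldr_cat.
by rewrite !E (reduce_id (reduced_reduce v)) foldr_reduce// reduced_reduce.
Qed.

Lemma reduce_val (u : free_group) : reduce (val u) = val u.
Proof. exact/reduce_id/(valP u). Qed.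

Lemma word_classE u v :
  free_mul (word_class u) (word_class v) = word_class (u ++ v).
Proof. by apply: val_inj; rewrite /= -reduce_cat. Qed.

Lemma word_class_val (u : free_group) : word_class (val u) = u.
Proof. by apply: val_inj; rewrite /= reduce_val. Qed.

Lemma free_mulA : associative free_mul.
Proof.
move=> u v w; rewrite -(word_class_val u) -(word_class_val v) -(word_class_val w).
by rewrite !word_classE catA.
Qed.

Lemma free_mul1g : left_id free_one free_mul.
Proof. by move=> u; rewrite -(word_class_val u) word_classE. Qed.

Lemma free_mulg1 : right_id free_one free_mul.
Proof. by move=> u; rewrite -(word_class_val u) word_classE cats0. Qed.

Lemma reduce_catV u : reduce (u ++ inv_word u) = [::].
Proof.
elim/last_ind: u => [|u l IHu] //.
rewrite /inv_word map_rcons rev_rcons -/(inv_word u) -cats1 -catA /=.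
rewrite -IHu /reduce !foldr_cat; congr foldr => /=.
by rewrite push_flip// reduced_foldr.
Qed.

Lemma inv_wordK : involutive inv_word.
Proof.
by move=> u; rewrite /inv_word map_rev revK -map_comp map_id_in// => l _; exact: flip_letterK.
Qed.

Lemma free_mulgV : right_inverse free_one free_inv free_mul.
Proof.
move=> u; transitivity (free_mul (word_class (val u)) (free_inv u)).
  by rewrite word_class_val.
by rewrite /free_inv word_classE; apply: val_inj; rewrite /= reduce_catV.
Qed.

Lemma free_mulVg : left_inverse free_one free_inv free_mul.
Proof.
move=> u; transitivity (free_mul (free_inv u) (word_class (val u))).
  by rewrite word_class_val.
rewrite /free_inv word_classE; apply: val_inj => /=.
by rewrite -[in X in _ ++ X](inv_wordK (val u)) reduce_catV.
Qed.

HB.instance Definition _ := isGroup.Build free_group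
  free_mulA free_mul1g free_mulg1 free_mulVg free_mulgV.

Definition free_gen (i : 'I_n) : free_group := word_class [:: (i, false)].

End FreeGroup.

Definition nilpotent_free (n k : nat) : groupType :=
  quotient_group (central_subgroup (free_group n) k).

Definition nilpotent_gen (n k : nat) (i : 'I_n) : nilpotent_free n k :=
  qclass _ (free_gen i).

(* The additive group Z^n, in multiplicative notation. *)
Definition Zpow (n : nat) : Type := 'rV[int]_n.
HB.instance Definition _ n := Choice.on (Zpow n).
HB.instance Definition _ n := isGroup.Build (Zpow n)
  (@addrA 'rV[int]_n) (@add0r 'rV[int]_n) (@addr0 'rV[int]_n)
  (@addNr 'rV[int]_n) (@addrN 'rV[int]_n).

(* A type with both structures; the library has no multiplicative topological
   groups, and continuity of the operations is not needed below. *)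
#[short(type="groupTopologicalType")]
HB.structure Definition GroupTopological := {G of monoid.Group G & Topological G}.

Definition hom_space (Gamma : groupType) (G : groupTopologicalType) :
    topologicalType :=
  [set f : {ptws Gamma -> G} | {morph f : x y / (x * y)%g}].

Definition homeomorphic (X Y : topologicalType) : Prop :=
  exists f : X -> Y, exists g : Y -> X,
    [/\ continuous f, continuous g, cancel f g & cancel g f].

Section SumTopology.
Variables X Y : topologicalType.

Definition sum_open (U : set (X + Y)) := open (inl @^-1` U) /\ open (inr @^-1` U).

Lemma sum_openT : sum_open setT.
Proof. by split; rewrite preimage_setT; exact: openT. Qed.

Lemma sum_openI : setI_closed sum_open.
Proof.
by move=> U V [Ul Ur] [Vl Vr]; split; rewrite preimage_setI; exact: openI.
Qed.

Lemma sum_open_bigU (I : Type) (F : I -> set (X + Y)) :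
  (forall i, sum_open (F i)) -> sum_open (\bigcup_i F i).
Proof.
by move=> oF; split; rewrite preimage_bigcup; apply: bigcup_open => i _;
  have [] := oF i.
Qed.

HB.instance Definition _ := isOpenTopological.Build (X + Y)%type
  sum_openT sum_openI sum_open_bigU.

End SumTopology.

Definition to_subset (T : Type) (A : set T) (a : T) (Aa : A a) : set_type A :=
  exist _ a (mem_set Aa).

Section Unitary.
Variable R : realType.

(* R[i] itself carries no topology; its numClosedFieldType structure does. *)
Definition cplx : numClosedFieldType := R[i].

Section Groups.
Variable m : nat.
Local Open Scope group_scope.

Definition unitary_set : set 'M[cplx]_m := [set A | A \is unitarymx].
Definition unitary : Type := unitary_set.
HB.instance Definition _ := Topological.on unitary.

Lemma unitaryP (A : unitary) : \val A \is unitarymx.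
Proof. exact: set_mem (valP A). Qed.

Lemma unitary_one_subproof : 1%:M%R \is @unitarymx cplx m m.
Proof. by apply/unitarymxP; rewrite trmx1 map_mx1 mulmx1. Qed.

Lemma unitary_inv_subproof (A : 'M[cplx]_m) :
  A \is unitarymx -> invmx A \is unitarymx.
Proof. by move=> Au; rewrite invmx_unitary// trmxC_unitary. Qed.

Definition unitary_one : unitary := @to_subset _ unitary_set 1%:M%R unitary_one_subproof.
Definition unitary_mul (A B : unitary) : unitary :=
  @to_subset _ unitary_set (\val A *m \val B) (mul_unitarymx (unitaryP A) (unitaryP B)).
Definition unitary_inv (A : unitary) : unitary :=
  @to_subset _ unitary_set (invmx (\val A)) (unitary_inv_subproof (unitaryP A)).

Lemma unitary_mulA : associative unitary_mul.
Proof. by move=> A B D; apply: val_inj; exact: mulmxA. Qed.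
Lemma unitary_mul1g : left_id unitary_one unitary_mul.
Proof. by move=> A; apply: val_inj; exact: mul1mx. Qed.
Lemma unitary_mulg1 : right_id unitary_one unitary_mul.
Proof. by move=> A; apply: val_inj; exact: mulmx1. Qed.
Lemma unitary_mulVg : left_inverse unitary_one unitary_inv unitary_mul.
Proof.
by move=> A; apply: val_inj; apply: mulVmx; exact: unitarymx_unit (unitaryP A).
Qed.
Lemma unitary_mulgV : right_inverse unitary_one unitary_inv unitary_mul.
Proof.
by move=> A; apply: val_inj; apply: mulmxV; exact: unitarymx_unit (unitaryP A).
Qed.

HB.instance Definition _ := isGroup.Build unitary
  unitary_mulA unitary_mul1g unitary_mulg1 unitary_mulVg unitary_mulgV.

Definition special_unitary_set : set 'M[cplx]_m :=
  [set A | A \is unitarymx /\ \det A = 1%R].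
Definition special_unitary : Type := special_unitary_set.
HB.instance Definition _ := Topological.on special_unitary.

Lemma special_unitaryP (A : special_unitary) :
  \val A \is unitarymx /\ \det (\val A) = 1%R.
Proof. exact: set_mem (valP A). Qed.

Lemma special_one_subproof : 1%:M%R \is @unitarymx cplx m m /\
  \det (1%:M : 'M[cplx]_m) = 1%R.
Proof. by split; [exact: unitary_one_subproof|exact: det1]. Qed.

Lemma special_mul_subproof (A B : special_unitary) :
  \val A *m \val B \is unitarymx /\ \det (\val A *m \val B) = 1%R.
Proof.
have [Au A1] := special_unitaryP A; have [Bu B1] := special_unitaryP B.
by split; [exact: mul_unitarymx|rewrite det_mulmx A1 B1 mulr1].
Qed.

Lemma special_inv_subproof (A : special_unitary) :
  invmx (\val A) \is unitarymx /\ \det (invmx (\val A)) = 1%R.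
Proof.
have [Au A1] := special_unitaryP A.
by split; [exact: unitary_inv_subproof|rewrite det_inv A1 invr1].
Qed.

Definition special_one : special_unitary :=
  @to_subset _ special_unitary_set 1%:M%R special_one_subproof.
Definition special_mul (A B : special_unitary) : special_unitary :=
  @to_subset _ special_unitary_set (\val A *m \val B) (special_mul_subproof A B).
Definition special_inv (A : special_unitary) : special_unitary :=
  @to_subset _ special_unitary_set (invmx (\val A)) (special_inv_subproof A).

Lemma special_mulA : associative special_mul.
Proof. by move=> A B D; apply: val_inj; exact: mulmxA. Qed.
Lemma special_mul1g : left_id special_one special_mul.
Proof. by move=> A; apply: val_inj; exact: mul1mx. Qed.
Lemma special_mulg1 : right_id special_one special_mul.
Proof. by move=> A; apply: val_inj; exact: mulmx1. Qed.
Lemma special_mulVg : left_inverse special_one special_inv special_mul.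
Proof.
move=> A; apply: val_inj; apply: mulVmx.
by have [/unitarymx_unit] := special_unitaryP A.
Qed.
Lemma special_mulgV : right_inverse special_one special_inv special_mul.
Proof.
move=> A; apply: val_inj; apply: mulmxV.
by have [/unitarymx_unit] := special_unitaryP A.
Qed.

HB.instance Definition _ := isGroup.Build special_unitary
  special_mulA special_mul1g special_mulg1 special_mulVg special_mulgV.

End Groups.

Local Notation SU2 := (special_unitary 2).

Definition pm_one_set : set SU2 :=
  [set A | \val A = 1%:M \/ \val A = - 1%:M].

Lemma pm_one_subgroup : is_subgroup pm_one_set.
Proof.
split=> [|A B|A]; first by left.
  move=> [A1|A1] [B1|B1]; [left|right|right|left]; rewrite /= A1 B1.
  - by rewrite mul1mx.
  - by rewrite mul1mx.
  - by rewrite mulmx1.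
  - by rewrite mulNmx mul1mx opprK.
move=> [A1|A1]; [left|right]; rewrite /= A1; first by rewrite invmx1.
have -> : - 1%:M = (-1)%:M :> 'M[cplx]_2 by rewrite raddfN.
by rewrite invmx_scalar invrN1.
Qed.

Lemma pm_one_conj (A B : SU2) : pm_one_set A -> pm_one_set (A ^ B)%g.
Proof.
have Bu : \val B \in unitmx by have [/unitarymx_unit] := special_unitaryP B.
move=> [A1|A1]; [left|right]; rewrite /= A1; first by rewrite mul1mx mulVmx.
by rewrite mulNmx mul1mx mulmxN mulVmx.
Qed.

Definition pm_one : normal_subgroup SU2 :=
  NormalSubgroup pm_one_subgroup pm_one_conj.

Definition PU2 : topologicalType := quotient_topology (quotient_group pm_one).

Definition circle_set : set cplx := [set z | `|z| = 1].
Definition circle : Type := circle_set.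
HB.instance Definition _ := Topological.on circle.

Section Signs.
Variable n : nat.
Implicit Types (e : 'rV['Z_2]_n) (x : {ptws 'I_n -> SU2}).

(* (Z/2)^n is 'rV['Z_2]_n with its additive group structure; e stands for the
   tuple of signs ((-1)^e_1, ..., (-1)^e_n). *)
Definition sign_of e (i : 'I_n) : cplx := (-1) ^+ (e 0 i : nat).

Lemma sign_ofM e f i : sign_of (e * f)%g i = sign_of e i * sign_of f i.
Proof.
rewrite /sign_of mxE -exprD -signr_odd -[RHS]signr_odd; congr (_ ^+ nat_of_bool _).
by case: (e 0 i) (f 0 i) => [[|[|?]] ?] [[|[|?]] ?].
Qed.

Lemma sign_of1 i : sign_of 1%g i = 1.
Proof. by rewrite /sign_of mxE expr0. Qed.

Lemma sign_circle_subproof e i (z : circle) : `|sign_of e i * \val z| = 1.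
Proof. rewrite normrM normr_sign mul1r; exact: (set_mem (valP z)). Qed.

Lemma sign_special_subproof e i (A : SU2) :
  sign_of e i *: \val A \is unitarymx /\ \det (sign_of e i *: \val A) = 1.
Proof.
have [/unitarymxP Au A1] := special_unitaryP A.
split; last by rewrite detZ A1 mulr1 sqrr_sign.
apply/unitarymxP; rewrite linearZ /= map_mxZ -scalemxAl -scalemxAr Au scalerA.
by rewrite rmorph_sign -expr2 sqrr_sign scale1r.
Qed.

Definition sign_circle e (z : {ptws 'I_n -> circle}) : {ptws 'I_n -> circle} :=
  fun i => @to_subset _ circle_set (sign_of e i * \val (z i))
    (sign_circle_subproof e i (z i)).

Definition sign_tuple e x : {ptws 'I_n -> SU2} :=
  fun i => @to_subset _ (@special_unitary_set 2) (sign_of e i *: \val (x i))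
    (sign_special_subproof e i (x i)).

Lemma sign_circleM e f z :
  sign_circle (e * f)%g z = sign_circle e (sign_circle f z).
Proof. by apply/funext => i; apply: val_inj; rewrite /= sign_ofM mulrA. Qed.

Lemma sign_tupleM e f x : sign_tuple (e * f)%g x = sign_tuple e (sign_tuple f x).
Proof. by apply/funext => i; apply: val_inj; rewrite /= sign_ofM scalerA. Qed.

Lemma sign_circle1 z : sign_circle 1%g z = z.
Proof. by apply/funext => i; apply: val_inj; rewrite /= sign_of1 mul1r. Qed.

Lemma sign_tuple1 x : sign_tuple 1%g x = x.
Proof. by apply/funext => i; apply: val_inj; rewrite /= sign_of1 scale1r. Qed.

(* Independent of the representative h of g, since -1 is central. *)
Definition conj_tuple x (g : PU2) : {ptws 'I_n -> SU2} :=
  let h : SU2 := generic_quotient.repr (g : quotient_group pm_one) in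
  fun i => (h * x i * h^-1)%g.

(* Hom(F_n/Gamma^k_n, SU(2)) as a subspace of SU(2)^n. *)
Definition HomSU2 (k : nat) : set {ptws 'I_n -> SU2} :=
  [set x | exists f : hom_space (nilpotent_free n k) SU2,
    forall i, x i = \val f (nilpotent_gen k i)].

Definition generates_nonabelian x :=
  ~ is_abelian (generated [set a | exists i, a = x i]).

Definition component (k : nat) x := connected_component (HomSU2 k) x.

Definition preserves (k : nat) e x : Prop :=
  sign_tuple e @` component k x = component k x.

Definition sign_stab (k : nat) x : {set 'rV['Z_2]_n} :=
  [set e | `[< preserves k e x >]]%SET.

Lemma sign_stabP k x e : reflect (preserves k e x) (e \in sign_stab k x).
Proof. by rewrite inE; exact: asboolP. Qed.

Lemma sign_stab_group_set k x : group_set (sign_stab k x).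
Proof.
have actM e f : sign_tuple (e * f)%g = sign_tuple e \o sign_tuple f.
  by apply/funext => y; exact: sign_tupleM.
have act1 : sign_tuple 1%g = id by apply/funext => y; exact: sign_tuple1.
apply/group_setP; split=> [|e f /sign_stabP eK /sign_stabP fK]; apply/sign_stabP.
  by rewrite /preserves act1 classical_sets.image_id.
by rewrite /preserves actM -image_comp fK eK.
Qed.
Canonical sign_stab_group k x := Group (sign_stab_group_set k x).

Section Balanced.
Local Open Scope quotient_scope.
Variables (H : {group 'rV['Z_2]_n}) (x : {ptws 'I_n -> SU2}).

(* When x generates a nonabelian subgroup, conj_tuple x identifies PU(2) with
   the component of x, and e in H sends g in PU(2) to the unique g' such that
   conj_tuple x g' = sign_tuple e (conj_tuple x g). The relation below is the
   orbit relation of the diagonal action of H on (S^1)^n x PU(2). *)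
Definition balanced_rel : rel ({ptws 'I_n -> circle} * PU2) := fun p p' =>
  `[< exists2 e, e \in H &
      p'.1 = sign_circle e p.1 /\
      conj_tuple x p'.2 = sign_tuple e (conj_tuple x p.2) >].

Lemma balanced_rel_equiv : equiv_class_of balanced_rel.
Proof.
have sym p p' : balanced_rel p p' -> balanced_rel p' p.
  move=> /asboolP[e eH [p1 p2]]; apply/asboolP; exists (e^-1)%g.
    by rewrite groupV.
  by rewrite p1 p2 -sign_circleM -sign_tupleM mulVg sign_circle1 sign_tuple1.
split=> [p|p p'|p' p p'' /asboolP[e eH [p1 p2]] /asboolP[f fH [p'1 p'2]]].
- apply/asboolP; exists 1%g => //.
  by rewrite sign_circle1 sign_tuple1.
- by apply/idP/idP; exact: sym.
- apply/asboolP; exists (f * e)%g; first exact: groupM.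
  by rewrite p'1 p'2 p1 p2 sign_circleM sign_tupleM.
Qed.
Canonical balanced_equiv := EquivRelPack balanced_rel_equiv.

Definition balanced_product : topologicalType :=
  quotient_topology {eq_quot balanced_equiv}.

End Balanced.

(* The first conjunct matters: the component of a point outside HomSU2 is
   empty. *)
Definition nonabelian_component (k : nat) x :=
  HomSU2 k x /\ forall y, component k x y -> generates_nonabelian y.

End Signs.
End Unitary.

(* Neither the division by 3 nor the truncated subtraction n - 2 loses anything:
   see num_kleinE and num_dihedralE. *)
Definition num_klein (n : nat) : nat :=
  (((2 ^ n - 1) * (2 ^ (n - 1) - 1)) %/ 3)%N.

Definition num_dihedral (n q : nat) : nat :=
  ((2 ^ n - 1) * (2 ^ ((q - 2) * (n - 1)) - 1) * 2 ^ (n - 2))%N.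

Lemma pow2B1 k : (2 ^ k - 1)%N%:R = 2 ^+ k - 1 :> rat.
Proof. by rewrite natrB ?expn_gt0// natrX. Qed.

Lemma num_klein_dvd n : (3 %| (2 ^ n - 1) * (2 ^ (n - 1) - 1))%N.
Proof.
case: n => // n; rewrite subSS subn0; elim: n => // n IHn.
have [k kE] : exists k, (2 ^ n = k.+1)%N.
  by exists (2 ^ n).-1; rewrite prednK// expn_gt0.
move: IHn; rewrite !expnS kE => /dvdnP[c cE].
by apply/dvdnP; exists (4 * c + (2 * k + 1))%N; nia.
Qed.

Lemma num_kleinE n :
  (num_klein n)%:R = (2 ^+ n - 1) * (2 ^+ (n - 1) - 1) / 3 :> rat.
Proof.
rewrite -!pow2B1 -natrM -[in RHS](divnK (num_klein_dvd n)) natrM.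
by rewrite mulfK.
Qed.

Lemma num_dihedralE n q : (1 <= n)%N ->
  (num_dihedral n q)%:R =
  (2 ^+ n - 1) * (2 ^+ ((q - 2) * (n - 1)) - 1) * 2 ^ (n%:Z - 2) :> rat.
Proof.
rewrite /num_dihedral; case: n => [|[|n]] // _.
  by rewrite subnn muln0 expn0 subnn muln0 mul0n expr0 subrr mulr0 mul0r.
have -> : n.+2%:Z - 2 = n%:Z by rewrite -addn2 PoszD addrK.
by rewrite !natrM !pow2B1 natrX; congr (_ * _); rewrite !subSS subn0.
Qed.

(* Main.v *)
(* Write a tuple of U(2) as a tuple of scalars times a tuple of SU(2),
   uniquely up to signs: scalars do not affect commutators, so only tuples of
   SU(2) generating a non-abelian group of class at most q matter. If G is
   such a group, the last nontrivial term of its central series consists of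
   +1 and -1, and some commutator [a, b] with a in the preceding term is -1.
   Diagonalizing a puts all of G in the normalizer of the torus, and the
   relation [d, b] = d^(-2) for diagonal d shows that the diagonal elements
   of G are 2^q-th roots of unity. So up to conjugation and signs every tuple
   has entries z^m or z^m j, with z a root of unity of order 2^q. The tuples
   whose entries commute up to sign reduce to words in 1, i, j, k, counted by
   M(n); the others have a unique normal form, counted by M(n,q), because an
   element conjugating a generic rotation to another rotation normalizes the
   torus. In both cases the signs preserving a conjugation orbit form the
   centralizer of the image of the tuple in PU(2).

   There are finitely many conjugation orbits of non-commuting tuples up to
   signs and each of them is compact and connected, so these orbits are the
   components. The map from the right hand side to the left hand side is a
   continuous bijection from a compact space to a Hausdorff space, so its
   inverse is continuous. *)
Require Import Defs.
From mathcomp Require Import all_boot all_order all_algebra all_fingroup.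
From mathcomp Require Import all_classical all_reals all_analysis complex.
From mathcomp Require Import abelian zify ring lra.

Set Implicit Arguments.
Unset Strict Implicit.
Unset Printing Implicit Defensive.

Import Defs Order.TTheory GRing.Theory Num.Theory.
Import numFieldNormedType.Exports.

Local Open Scope classical_set_scope.
Local Open Scope ring_scope.

(** * Central series and evaluation of words *)

(** The images in PU(2) explain the two families. A non-commuting tuple that commutes up to sign
    generates a Klein four-group there, the others generate dihedral groups; the centralizers have
    orders 4 and 2. The families need separate arguments: the Klein group is symmetric in i, j, k,
    so its tuples are told apart by the pattern of equal letters, whereas a rotation of order
    greater than 2 determines the torus. Constants: an m-fold commutator with b raises a diagonal d
    to the power (-2)^m, whence the order 2^q; modulo signs the exponents live in Z/N with N =
    2^(q-1). Among the 4^n words in 1, i, j, k there are (2^n - 1)(2^n - 2) with two different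
    letters other than 1, and the six permutations of i, j, k act freely on them, which gives 6
    M(n). In the dihedral case the antidiagonal positions form one of 2^n - 1 nonempty sets; one
    exponent is normalized to 0, the 2^(n-1) functions with values in 0 and N/2 are excluded, and
    negation pairs off the others, leaving (N^(n-1) - 2^(n-1)) / 2. *)

Section GroupMorphisms.
Local Open Scope group_scope.
Variables (G H : groupType) (f : G -> H).
Hypothesis fM : {morph f : x y / x * y}.

Lemma morph_one : f 1 = 1.
Proof. by apply: (mulgI (f 1)); rewrite -fM !mulg1. Qed.

Lemma morph_inv x : f x^-1 = (f x)^-1.
Proof. by apply: (mulgI (f x)); rewrite -fM !mulgV morph_one. Qed.

Lemma morph_commg x y : f [~ x, y] = [~ f x, f y].
Proof. by rewrite !commgEl !conjgE !fM !morph_inv. Qed.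

Lemma subgroup_preimage (A : set H) : is_subgroup A -> is_subgroup (f @^-1` A).
Proof.
case=> A1 AM AV; split=> /= [|x y|x]; first by rewrite morph_one.
  by rewrite fM; exact: AM.
by rewrite morph_inv; exact: AV.
Qed.

End GroupMorphisms.

Section CentralSeries.
Local Open Scope group_scope.

Lemma generated_min (G : groupType) (A B : set G) :
  is_subgroup B -> A `<=` B -> generated A `<=` B.
Proof. by move=> sB AB; exact: smallest_sub. Qed.

Lemma generated_sub (G : groupType) (A : set G) : A `<=` generated A.
Proof. exact: sub_gen_smallest. Qed.

Lemma subgroup1 (G : groupType) : is_subgroup [set 1 : G].
Proof.
split=> //= [x y -> ->|x ->]; first by rewrite mulg1.
by rewrite invg1.
Qed.

Lemma central_seriesS (G : groupType) k :
  @central_series G k.+2 =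
  generated [set z | exists2 x, @central_series G k.+1 x &
                     exists2 y, setT y & z = [~ x, y]].
Proof. by []. Qed.

Lemma central_series_commg (G : groupType) k (x y : G) :
  @central_series G k.+1 x -> @central_series G k.+2 [~ x, y].
Proof.
by move=> Gx; rewrite central_seriesS; apply: generated_sub; exists x => //; exists y.
Qed.

Lemma central_series_sub (G : groupType) k : @central_series G k.+1 `<=` @central_series G k.
Proof.
case: k => [|k] //; rewrite central_seriesS; apply: generated_min.
  exact: central_series_subgroup.
have [_ GM GV] := central_series_subgroup G k.+1.
move=> _ [x Gx [y _ ->]]; rewrite commgEl; apply: GM; first exact: GV.
exact: central_series_conj.
Qed.

Lemma central_series_anti (G : groupType) k m : (k <= m)%N ->
  @central_series G m `<=` @central_series G k.
Proof.
elim: m => [|m IHm]; first by rewrite leqn0 => /eqP ->.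
by rewrite leq_eqVlt => /predU1P[-> //|/IHm km] x /central_series_sub /km.
Qed.

(* Central factors disappear in commutators. *)
Lemma central_series_twist (F G : groupType) (f g : F -> G) :
  {morph f : x y / x * y} -> {morph g : x y / x * y} ->
  (forall x, exists2 c, (forall y, commute c y) & f x = c * g x) ->
  forall k x, (2 <= k)%N -> @central_series F k x -> f x = g x.
Proof.
move=> fM gM fg k x k2 /(central_series_anti k2); rewrite central_seriesS.
move: x; apply: generated_min.
  split=> [|x y fgx fgy|x fgx] /=; first by rewrite (morph_one fM) (morph_one gM).
    by rewrite fM gM fgx fgy.
  by rewrite (morph_inv fM) (morph_inv gM) fgx.
move=> _ [x _ [y _ ->]] /=; rewrite (morph_commg fM) (morph_commg gM).
have [c cC ->] := fg x; have [d dC ->] := fg y.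
have RC : forall (a b c : G), (forall y, commute c y) -> [~ c * a, b] = [~ a, b].
  move=> a b e eC; rewrite !commgEl !conjgE invgM -!mulgA; congr (_ * _).
  rewrite (mulgA b^-1) -(eC b^-1) -mulgA; exact: mulKg.
rewrite RC// -invgR RC// invgR//.
Qed.

End CentralSeries.

Section FreeEvaluation.
Local Open Scope group_scope.
Variables (n : nat) (G : groupType).
Implicit Types A : 'I_n -> G.

Definition eval_letter A (l : letter n) : G := if l.2 then (A l.1)^-1 else A l.1.

Definition eval_word A (w : seq (letter n)) : G :=
  foldr (fun l g => eval_letter A l * g) 1 w.

Definition free_eval A (w : free_group n) : G := eval_word A (val w).

Lemma eval_word_cat A u v : eval_word A (u ++ v) = eval_word A u * eval_word A v.
Proof. by elim: u => [|l u IHu] /=; rewrite ?mul1g// IHu mulgA. Qed.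

Lemma eval_push A l w : eval_word A (push_letter l w) = eval_letter A l * eval_word A w.
Proof.
case: w => [|l' w] //=; case: eqP => // -> /=.
by case: l => i []; rewrite /eval_letter /= ?mulKg ?mulVKg.
Qed.

Lemma eval_reduce A w : eval_word A (reduce w) = eval_word A w.
Proof. by elim: w => //= l w IHw; rewrite eval_push IHw. Qed.

Lemma free_evalM A : {morph free_eval A : u v / u * v}.
Proof. by move=> u v; rewrite /free_eval /= eval_reduce eval_word_cat. Qed.

Lemma free_eval_gen A i : free_eval A (free_gen i) = A i.
Proof. by rewrite /free_eval /= mulg1. Qed.

Lemma free_gen_inv (i : 'I_n) : (free_gen i)^-1 = word_class [:: (i, true)].
Proof. by apply: val_inj. Qed.

(** Uniqueness in the universal property of the free group. *)
Lemma free_eval_morph (f : free_group n -> G) :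
  {morph f : u v / u * v} -> f =1 free_eval (f \o @free_gen n).
Proof.
move=> fM w; rewrite -(word_class_val w) /free_eval /= eval_reduce.
elim: (val w) => {w}[|[i b] w IHw]; first exact: (morph_one fM).
rewrite -cat1s -word_classE -[LHS]/(f (word_class [:: (i, b)] * word_class w)).
rewrite fM IHw /=; congr (_ * _).
case: b; last by [].
by rewrite /eval_letter /= -(morph_inv fM) free_gen_inv.
Qed.

(** The points of Hom(F_n/Gamma^k, G) read in G^n: evaluation at such a tuple factors through the
    quotient. The arguments about SU(2) work with these tuples instead of homomorphisms. *)
Definition nil_tuple (k : nat) A :=
  forall w, @central_series (free_group n) k w -> free_eval A w = 1.

(** Evaluation at a chosen representative, hence defined for every tuple; it is independent of the
    representative, and a morphism, when [nil_tuple k A] holds. *)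
Definition nil_eval (k : nat) A (u : nilpotent_free n k) : G :=
  free_eval A (generic_quotient.repr u).

Lemma nil_eval_qclass k A w : nil_tuple k A ->
  nil_eval A (qclass (central_subgroup (free_group n) k) w) = free_eval A w.
Proof.
move=> An; apply: (mulgI (free_eval A w)^-1); rewrite mulVg.
rewrite -(morph_inv (free_evalM A)) -free_evalM; apply: An.
by apply/(@qclass_eq _ (central_subgroup (free_group n) k)); rewrite qclass_repr.
Qed.

Lemma nil_evalM k A : nil_tuple k A ->
  {morph (@nil_eval k A) : u v / u * v}.
Proof.
move=> An u v; rewrite -(qclass_repr u) -(qclass_repr v).
rewrite -[qclass _ _ * qclass _ _]/(quotient_mul _ _) quotient_mulE.
by rewrite !nil_eval_qclass// free_evalM.
Qed.

Lemma nil_eval_gen k A i : nil_tuple k A -> nil_eval A (@nilpotent_gen n k i) = A i.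
Proof. by move=> An; rewrite nil_eval_qclass// free_eval_gen. Qed.

Lemma qclassM (F : groupType) (N : normal_subgroup F) : {morph qclass N : u v / u * v}.
Proof. by move=> u v; rewrite -[RHS]/(quotient_mul _ _) quotient_mulE. Qed.

Lemma qclass1 (F : groupType) (N : normal_subgroup F) (w : F) :
  normal_set N w -> qclass N w = 1.
Proof. by move=> Nw; apply/esym/qclass_eq; rewrite invg1 mul1g. Qed.

Lemma nil_morph_eval k (f : nilpotent_free n k -> G) : {morph f : u v / u * v} ->
  forall w, f (qclass _ w) = free_eval (f \o @nilpotent_gen n k) w.
Proof.
move=> fM w; rewrite -[LHS]/((f \o qclass _) w).
by rewrite free_eval_morph// => u v /=; rewrite qclassM fM.
Qed.

Lemma nil_morph_tuple k (f : nilpotent_free n k -> G) : {morph f : u v / u * v} ->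
  nil_tuple k (f \o @nilpotent_gen n k).
Proof.
by move=> fM w kw; rewrite -nil_morph_eval// qclass1// (morph_one fM).
Qed.

Lemma nil_morph_inj k (f g : nilpotent_free n k -> G) :
  {morph f : u v / u * v} -> {morph g : u v / u * v} ->
  f \o @nilpotent_gen n k = g \o @nilpotent_gen n k -> f =1 g.
Proof. by move=> fM gM fg u; rewrite -(qclass_repr u) !nil_morph_eval// fg. Qed.

(** All commutators of words evaluate to 1, so the second term of the series is killed, and with it
    every later one. *)
Lemma comm_nil_tuple k A : (2 <= k)%N -> (forall i j, commute (A i) (A j)) ->
  nil_tuple k A.
Proof.
move=> k2 AC w /(central_series_anti k2); rewrite central_seriesS.
have cA B u : (forall i, commute B (A i)) -> commute B (free_eval A u).
  move=> BC; rewrite /free_eval; elim: (val u) => [|[i b] v IHv] /=; first exact: commute1.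
  apply: commuteM => //; case: b => //=; rewrite /eval_letter /=; last exact: BC.
  exact/commuteV/BC.
move: w; apply: (@generated_min _ _ (free_eval A @^-1` [set 1])).
  by apply: (subgroup_preimage (free_evalM A)); exact: subgroup1.
move=> _ [x _ [y _ ->]] /=; rewrite (morph_commg (free_evalM A)).
by apply/eqP/commgP/cA => i; apply/commute_sym/cA.
Qed.

End FreeEvaluation.

Section EvaluationTransport.
Local Open Scope group_scope.
Variable n : nat.

Lemma free_eval_comp (G H : groupType) (f : G -> H) (A : 'I_n -> G) w :
  {morph f : x y / x * y} -> f (free_eval A w) = free_eval (f \o A) w.
Proof.
move=> fM; rewrite -[LHS]/((f \o free_eval A) w) free_eval_morph => [|u v /=].
  by congr (free_eval _ w); apply/funext => i /=; rewrite free_eval_gen.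
by rewrite free_evalM fM.
Qed.

Lemma free_eval_conj (G : groupType) (A : 'I_n -> G) g w :
  free_eval (fun i => A i ^ g) w = free_eval A w ^ g.
Proof.
by rewrite (@free_eval_comp _ _ (conjg^~ g))// => x y; rewrite conjMg.
Qed.

Lemma nil_tuple_conj (G : groupType) k (A : 'I_n -> G) g :
  nil_tuple k A -> nil_tuple k (fun i => A i ^ g).
Proof. by move=> An w kw; rewrite free_eval_conj An// conj1g. Qed.

(** Applied to the inclusion of SU(2) in U(2), in both directions. *)
Lemma nil_tuple_comp (G H : groupType) (f : G -> H) k (A : 'I_n -> G) :
  {morph f : x y / x * y} -> injective f -> nil_tuple k (f \o A) <-> nil_tuple k A.
Proof.
move=> fM fI; split=> An w kw; have := An w kw; rewrite -free_eval_comp//.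
  by rewrite -(morph_one fM) => /fI.
by move=> ->; rewrite (morph_one fM).
Qed.

(** The value of each word is multiplied by a central element, which drops out of commutators. This
    is how scalars are moved in and out of tuples of U(2). *)
Lemma nil_tuple_twist (G : groupType) k (A : 'I_n -> G) (c : 'I_n -> G) :
  (2 <= k)%N -> (forall i x, commute (c i) x) ->
  nil_tuple k A -> nil_tuple k (fun i => c i * A i).
Proof.
move=> k2 cC An w kw; rewrite -(An w kw).
apply: (central_series_twist (free_evalM _) (free_evalM A) _ k2 kw) => {w kw} u.
rewrite /free_eval; elim: (val u) => [|[i b] v [d dC IHv]] /=.
  by exists 1; rewrite ?mulg1// => y; apply/commute_sym/commute1.
have [e eC ->] : exists2 e, (forall y, commute e y) &
    eval_letter (fun i => c i * A i) (i, b) = e * eval_letter A (i, b).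
  case: b; rewrite /eval_letter /=; last by exists (c i).
  exists (c i)^-1; first by move=> y; exact/commute_sym/commuteV/commute_sym/cC.
  by rewrite cC invgM.
exists (e * d) => [y|]; last by rewrite IHv -mulgA (mulgA _ d) -(dC (eval_letter _ _)) !mulgA.
by apply/commute_sym/commuteM; exact: commute_sym.
Qed.

End EvaluationTransport.

(** * Homomorphisms from Z^n *)

Section AbelianEvaluation.
Local Open Scope group_scope.
Variables (n : nat) (G : groupType).

Definition expz (x : G) (m : int) : G :=
  match m with Posz k => x ^+ k | Negz k => x ^- k.+1 end.

Lemma expzB x (a b : nat) : expz x (a%:Z - b%:Z)%R = x ^+ a * x ^- b.
Proof.
have [ba|ab] := leqP b a.
  by rewrite subzn//= expgnFr.
have -> : (a%:Z - b%:Z = - (b - a)%N%:Z)%R by rewrite -subzn ?(ltnW ab)// opprB.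
case E: (b - a)%N => [|c]; first by lia.
rewrite -NegzE /= -E expgnFr ?(ltnW ab)// invgF//.
Qed.

(** In this form the addition law of [expz] needs no case analysis on the signs of the two
    exponents. *)
Lemma intB (m : int) : exists a b : nat, m = (a%:Z - b%:Z)%R.
Proof.
case: m => k; first by exists k, 0%N; rewrite subr0.
by exists 0%N, k.+1; rewrite NegzE sub0r.
Qed.

Lemma expzD x (l m : int) : expz x (l + m)%R = expz x l * expz x m.
Proof.
have [a [b ->]] := intB l; have [c [d ->]] := intB m.
have -> : (a%:Z - b%:Z + (c%:Z - d%:Z) = (a + c)%N%:Z - (b + d)%N%:Z)%R.
  by rewrite !PoszD; ring.
rewrite !expzB !expgnDr invgM -!mulgA; congr (_ * _).
have C i j : commute (x ^+ i) (x ^+ j) by apply: commuteX2.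
have CV i j : commute (x ^+ i)^-1 (x ^+ j) by apply/commute_sym/commuteV.
by rewrite [RHS]mulgA (CV b c) -!mulgA; congr (_ * _); rewrite -!invgM C.
Qed.

Lemma expz_commute x y (l m : int) : commute x y -> commute (expz x l) (expz y m).
Proof.
have expc z w (k : int) : commute z w -> commute z (expz w k).
  case: k => k zw /=; first exact: commuteX.
  exact/commuteV/commuteX.
by move=> xy; apply/expc/commute_sym/expc/commute_sym.
Qed.

(** The product is taken in the order of the indices; it becomes a morphism when the entries
    commute. *)
Definition Zpow_eval (A : 'I_n -> G) (v : Zpow n) : G :=
  \prod_(i < n) expz (A i) ((v : 'rV[int]_n) ord0 i).

Definition Zpow_gen (i : 'I_n) : Zpow n := (delta_mx ord0 i : 'rV[int]_n).

Lemma Zpow_evalM A : (forall i j, commute (A i) (A j)) ->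
  {morph Zpow_eval A : u v / u * v}.
Proof.
move=> AC u v; rewrite /Zpow_eval -prodgM_commute.
  by apply: eq_bigr => i _; rewrite -expzD mxE.
by move=> *; apply: expz_commute; exact: AC.
Qed.

Lemma Zpow_eval_gen A i : Zpow_eval A (Zpow_gen i) = A i.
Proof.
rewrite /Zpow_eval; have -> : A i = \prod_(j < n | j == i) A j by rewrite big_pred1_eq.
rewrite [RHS]big_mkcond; apply: eq_bigr => j _; rewrite mxE eqxx /=.
by case: eqP.
Qed.

Lemma Zpow_commute (u v : Zpow n) : commute u v.
Proof. exact: addrC. Qed.

End AbelianEvaluation.

Section ZpowMorphisms.
Local Open Scope group_scope.
Variable n : nat.

(** Lets a morphism out of Z^n be recovered from its values on the standard basis. *)
Lemma Zpow_prod_gen (v : Zpow n) :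
  v = \prod_(i < n) expz (Zpow_gen i : Zpow n) ((v : 'rV[int]_n) ord0 i).
Proof.
apply/(@rowP _ n) => j.
have coordM : {morph (fun u : Zpow n => (u : 'rV[int]_n) ord0 j) : u w / u * w >-> (u + w)%R}.
  by move=> u w; rewrite mxE.
rewrite (big_morph (fun u : Zpow n => (u : 'rV[int]_n) ord0 j) coordM (id1 := 0%R)) ?mxE//.
have coordZ (u : Zpow n) m : (expz u m : 'rV[int]_n) ord0 j = ((u : 'rV[int]_n) ord0 j * m)%R.
  have coordX k : (u ^+ k : 'rV[int]_n) ord0 j = ((u : 'rV[int]_n) ord0 j * k%:Z)%R.
    elim: k => [|k IHk]; first by rewrite expg0 mxE mulr0.
    by rewrite expgS coordM IHk (PoszD 1%N k) mulrDr mulr1.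
  by case: m => k //=; rewrite /expz NegzE mulrN -coordX mxE.
under eq_bigr do rewrite coordZ mxE eqxx.
rewrite (bigD1 j)//= eqxx mul1r big1 ?addr0// => i /negbTE ij.
by rewrite eq_sym ij mul0r.
Qed.

Lemma Zpow_morph_inj (G : groupType) (f g : Zpow n -> G) :
  {morph f : u v / u * v} -> {morph g : u v / u * v} ->
  f \o @Zpow_gen n = g \o @Zpow_gen n -> f =1 g.
Proof.
move=> fM gM fg v.
have morph_expz (h : Zpow n -> G) : {morph h : u v / u * v} ->
    forall u m, h (expz u m) = expz (h u) m.
  move=> hM u m; have hX k : h (u ^+ k) = h u ^+ k.
    by elim: k => [|k IHk]; rewrite ?(morph_one hM)// !expgS hM IHk.
  by case: m => k; rewrite /expz ?(morph_inv hM) hX.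
rewrite (Zpow_prod_gen v) (big_morph f fM (morph_one fM)) (big_morph g gM (morph_one gM)).
apply: eq_bigr => i _; rewrite !morph_expz//; congr expz.
exact: (congr1 (fun h => h i) fg).
Qed.

End ZpowMorphisms.

(** * Topology *)

Section TopologyComplements.

Lemma continuous_ptws (X Y : topologicalType) (I : eqType) (f : X -> {ptws I -> Y}) :
  (forall i, continuous (fun x => f x i)) -> continuous f.
Proof.
move=> fc x; apply/cvg_sup => i U [V [[W oW <-]] /= Wfx WU].
apply: (@filterS _ _ _ ((fun x => f x i) @^-1` W)); first by move=> y; exact: WU.
by apply: fc; exact: open_nbhs_nbhs.
Qed.

Lemma ptws_continuous (X Y : topologicalType) (I : eqType) (f : X -> {ptws I -> Y}) i :
  continuous f -> continuous (fun x => f x i).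
Proof.
move=> fc x; apply: (@continuous_comp _ _ _ f (fun g : {ptws I -> Y} => g i)); first exact: fc.
exact: (@proj_continuous I (fun=> Y) i).
Qed.

Lemma continuous_subtype (X Y : topologicalType) (A : set Y) (f : X -> A) :
  continuous (fun x => \val (f x)) -> continuous f.
Proof. by move=> fc; exact/continuous_comp_initial. Qed.

Lemma subtype_val_continuous (Y : topologicalType) (A : set Y) :
  continuous (fun y : A => \val y : Y).
Proof. exact: initial_continuous. Qed.

(** A filter on the subtype is pushed forward to T, where it contains A; a cluster point in A is
    also one for the original filter, because the subtype carries the initial topology. *)
Lemma compact_subtype (T : topologicalType) (A : set T) :
  compact A -> compact [set: A].
Proof.
move=> cA F PF _.
have valA (a : A) : A (\val a) := set_mem (valP a).
have FA : F ((\val : A -> T) @^-1` A).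
  by apply: filterS (@filterT _ F _) => a _; exact: (valA a).
have [p [Ap clp]] := cA ((\val : A -> T) @ F) _ FA.
exists (to_subset Ap); split=> // S U FS [V [[W oW <-]] /= Wp WU].
have [] := clp (\val @` S) W.
- have FS' : F ((\val : A -> T) @^-1` (\val @` S)) by apply: filterS FS => a Sa; exists a.
  exact: FS'.
- exact: open_nbhs_nbhs.
- by move=> _ [[a Sa <-] Wa]; exists a; split=> //; exact: WU.
Qed.

Lemma compact_range (X Y : topologicalType) (f : X -> Y) :
  compact [set: X] -> continuous f -> compact (range f).
Proof. by move=> cX cf; apply: continuous_compact => //; exact: continuous_subspaceT. Qed.

Lemma connected_range (X Y : topologicalType) (f : X -> Y) :
  connected [set: X] -> continuous f -> connected (range f).
Proof.
by move=> cX cf; apply: connected_continuous_connected => //; exact: continuous_subspaceT.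
Qed.

Lemma hausdorff_injective (X Y : topologicalType) (f : X -> Y) :
  hausdorff_space Y -> continuous f -> injective f -> hausdorff_space X.
Proof.
move=> hY cf fI x y xy; apply/fI/hY => U V nU nV.
by have [z [Uz Vz]] := xy _ _ (cf x U nU) (cf y V nV); exists (f z).
Qed.

Lemma hausdorff_subtype (T : topologicalType) (A : set T) :
  hausdorff_space T -> hausdorff_space A.
Proof. by move=> hT; exact: hausdorff_injective hT (@subtype_val_continuous _ A) val_inj. Qed.

Lemma hausdorff_ptws (I : eqType) (Y : topologicalType) :
  hausdorff_space Y -> hausdorff_space {ptws I -> Y}.
Proof. by move=> hY; apply: hausdorff_product. Qed.

Lemma compact_hausdorff_homeo (X Y : topologicalType) (f : X -> Y) :
  compact [set: X] -> hausdorff_space Y -> continuous f -> bijective f ->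
  homeomorphic Y X.
Proof.
move=> cX hY cf [g fK gK]; exists g, f; split=> //.
apply/continuous_closedP => C cC; have -> : g @^-1` C = f @` C.
  apply/seteqP; split=> [y Cgy|_ [x Cx <-]] /=; last by rewrite fK.
  by exists (g y).
apply: compact_closed => //; apply: continuous_compact.
  exact: continuous_subspaceT.
by apply: (@subclosed_compact _ _ setT).
Qed.

Lemma compact_sum (X Y : topologicalType) :
  compact [set: X] -> compact [set: Y] -> compact [set: (X + Y)%type].
Proof.
move=> cX cY.
have inlC : continuous (@inl X Y) by apply/continuousP => U [].
have inrC : continuous (@inr X Y) by apply/continuousP => U [].
have -> : [set: (X + Y)%type] = range (@inl X Y) `|` range (@inr X Y).
  by apply/seteqP; split=> // -[x|y] _; [left; exists x|right; exists y].
by apply: compactU; exact: compact_range.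
Qed.

Lemma sum_continuous (X Y Z : topologicalType) (f : X + Y -> Z) :
  continuous (f \o inl) -> continuous (f \o inr) -> continuous f.
Proof.
move=> /continuousP fl /continuousP fr; apply/continuousP => U oU.
by split; [exact: fl|exact: fr].
Qed.

Lemma closed_eq_continuous (X Y : topologicalType) (f g : X -> Y) :
  hausdorff_space Y -> continuous f -> continuous g ->
  closed [set x | f x = g x].
Proof.
move=> hY cf cg x xcl /=; apply: hY => U V nU nV.
have nfU : nbhs x (f @^-1` U) by exact: cf.
have ngV : nbhs x (g @^-1` V) by exact: cg.
have [z [/= fg [Uz Vz]]] := xcl _ (filterI nfU ngV).
by exists (f z); split=> //; rewrite fg.
Qed.

Lemma continuous_mx (X : topologicalType) (K : numFieldType) m n (f : X -> 'M[K]_(m, n)) :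
  (forall i j, continuous (fun x => f x i j)) -> continuous f.
Proof.
move=> fc x U [P nP PU].
have : \forall y \near x, forall k : 'I_m * 'I_n, P k.1 k.2 (f y k.1 k.2).
  by apply: filter_forall => k; apply: fc; exact: nP.
by apply: filterS => y Py; apply: PU => i j; exact: (Py (i, j)).
Qed.

Lemma mx_coord_continuous (X : topologicalType) (K : numFieldType) m n
  (f : X -> 'M[K]_(m, n)) i j : continuous f -> continuous (fun x => f x i j).
Proof.
by move=> fc x; apply: (@continuous_comp _ _ _ f (fun M : 'M[K]_(m, n) => M i j));
  [exact: fc|exact: coord_continuous].
Qed.

Lemma continuous_mul (X : topologicalType) (K : numFieldType) (f g : X -> K) :
  continuous f -> continuous g -> continuous (fun x => f x * g x).
Proof. by move=> fc gc x; apply: cvgM; [exact: fc|exact: gc]. Qed.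

Lemma continuous_add (X : topologicalType) (K : numFieldType) (f g : X -> K) :
  continuous f -> continuous g -> continuous (fun x => f x + g x).
Proof. by move=> fc gc x; apply: cvgD; [exact: fc|exact: gc]. Qed.

Lemma continuous_opp (X : topologicalType) (K : numFieldType) (f : X -> K) :
  continuous f -> continuous (fun x => - f x).
Proof. by move=> fc x; apply: cvgN; exact: fc. Qed.

Lemma continuous_sum (X : topologicalType) (K : numFieldType) (I : finType) (f : I -> X -> K) :
  (forall i, continuous (f i)) -> continuous (fun x => \sum_i f i x).
Proof.
move=> fc; elim: (index_enum I) => [|i r IHr].
  by under eq_fun do rewrite big_nil; move=> x; exact: cvg_cst.
by under eq_fun do rewrite big_cons; move=> x; apply: cvgD; [exact: fc|exact: IHr].
Qed.

Lemma mulmx_continuous (X : topologicalType) (K : numFieldType) m n p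
  (f : X -> 'M[K]_(m, n)) (g : X -> 'M[K]_(n, p)) :
  continuous f -> continuous g -> continuous (fun x => f x *m g x).
Proof.
move=> fc gc; apply: continuous_mx => i j.
have -> : (fun x => (f x *m g x) i j) = (fun x => \sum_k f x i k * g x k j).
  by apply/funext => x; rewrite mxE.
by apply: continuous_sum => k x; apply: cvgM; exact: mx_coord_continuous.
Qed.

Lemma mx_hausdorff (K : numFieldType) m n : hausdorff_space 'M[K]_(m, n).
Proof.
move=> A B AB; apply/matrixP => i j; apply: (@norm_hausdorff K K^o) => U V nU nV.
have [M [UM VM]] := AB _ _ (coord_continuous nU) (coord_continuous nV).
by exists (M i j).
Qed.

(** Tychonoff's theorem for functions on pairs of indices, carried over by the continuous map that
    forms the matrix of a function. *)
Lemma mx_compact (K : numFieldType) m n (A : set K) :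
  compact A -> compact [set M : 'M[K]_(m, n) | forall i j, A (M i j)].
Proof.
move=> cA.
pose f (g : {ptws ('I_m * 'I_n)%type -> K}) : 'M[K]_(m, n) := \matrix_(i, j) g (i, j).
have -> : [set M : 'M[K]_(m, n) | forall i j, A (M i j)] =
    f @` [set g : {ptws ('I_m * 'I_n)%type -> K} | forall k, A (g k)].
  apply/seteqP; split=> [M AM|_ [g Ag <-] i j]; last by rewrite mxE.
  by exists (fun k => M k.1 k.2) => [k|]; [exact: AM|apply/matrixP => i j; rewrite mxE].
apply: continuous_compact; last exact: (@tychonoff _ (fun=> K) (fun=> A) (fun=> cA)).
apply/continuous_subspaceT/continuous_mx => i j.
have -> : (fun g => f g i j) = (fun g => g (i, j)) by apply/funext => g; rewrite mxE.
exact: (@proj_continuous _ (fun=> K) (i, j)).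
Qed.

End TopologyComplements.

(** * Coordinates on SU(2) *)

Section Conjugation.
Variable C : numClosedFieldType.
Implicit Types x y : C.

Lemma conjcD x y : (x + y)^* = x^* + y^*. Proof. exact: rmorphD. Qed.
Lemma conjcM x y : (x * y)^* = x^* * y^*. Proof. exact: rmorphM. Qed.
Lemma conjcN x : (- x)^* = - x^*. Proof. exact: rmorphN. Qed.
Lemma conjcV x : (x^-1)^* = (x^* )^-1. Proof. exact: fmorphV. Qed.
Lemma conjc0 : 0^* = 0 :> C. Proof. exact: rmorph0. Qed.
Lemma conjc1 : 1^* = 1 :> C. Proof. exact: rmorph1. Qed.

Definition conjE := (conjcD, conjcM, conjcN, conjcV, conjc0, conjc1, @conjCK C).

End Conjugation.

Section SU2Coordinates.
Variable R : realType.
Local Notation K := (cplx R).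
Local Notation SU2 := (special_unitary R 2).
Implicit Types (x y z : SU2) (a b c d : K).

Definition mx22 a b c d : 'M[K]_2 :=
  \matrix_(i, j) if i == 0 then (if j == 0 then a else b)
                 else (if j == 0 then c else d).

Lemma mx22_eta (M : 'M[K]_2) : M = mx22 (M 0 0) (M 0 1) (M 1 0) (M 1 1).
Proof.
by apply/matrixP => i j; rewrite mxE; case: i j => [[|[|//]] ?] [[|[|//]] ?];
  congr (M _ _); exact/val_inj.
Qed.

Lemma eq_mx22 a b c d a' b' c' d' : mx22 a b c d = mx22 a' b' c' d' ->
  [/\ a = a', b = b', c = c' & d = d'].
Proof.
move=> /matrixP E.
by have := (E 0 0, E 0 1, E 1 0, E 1 1); rewrite !mxE /= => -[[[]]].
Qed.

Lemma mul_mx22 a b c d a' b' c' d' : mx22 a b c d *m mx22 a' b' c' d' =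
  mx22 (a * a' + b * c') (a * b' + b * d') (c * a' + d * c') (c * b' + d * d').
Proof.
apply/matrixP => i j; rewrite !mxE big_ord_recl big_ord1 !mxE /=.
by case: i j => [[|[|//]] ?] [[|[|//]] ?].
Qed.

Lemma scalar_mx22 a : a%:M = mx22 a 0 0 a.
Proof.
by apply/matrixP => i j; rewrite !mxE; case: i j => [[|[|//]] ?] [[|[|//]] ?].
Qed.

Lemma trmxC_mx22 a b c d :
  map_mx Num.conj (mx22 a b c d)^T = mx22 (a^* )%R (c^* )%R (b^* )%R (d^* )%R.
Proof.
by apply/matrixP => i j; rewrite !mxE; case: i j => [[|[|//]] ?] [[|[|//]] ?].
Qed.

Lemma det_mx22 a b c d : \det (mx22 a b c d) = a * d - b * c.
Proof.
rewrite (expand_det_row _ 0) big_ord_recl big_ord1 /cofactor !det_mx11 !mxE /=.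
by rewrite expr0 expr1 mulN1r mul1r mulrN.
Qed.

(* The matrix of x is [[alpha x, beta x], [- (beta x)^*, (alpha x)^*]]. *)
Definition alpha x : K := (\val x : 'M[K]_2) 0 0.
Definition beta x : K := (\val x : 'M[K]_2) 0 1.

(** The matrix of the quaternion a + b j. *)
Definition quat a b : 'M[K]_2 := mx22 a b (- (b^* )%R) (a^* )%R.

Lemma quat_special a b : a * (a^* )%R + b * (b^* )%R = 1 ->
  quat a b \is unitarymx /\ \det (quat a b) = 1.
Proof.
move=> ab1; split; last by rewrite det_mx22 mulrN opprK.
apply/unitarymxP; rewrite trmxC_mx22 mul_mx22 scalar_mx22 !rmorphN /= !conjCK.
by congr mx22; rewrite -?ab1; ring.
Qed.

(** Determinant 1 makes the adjugate an inverse, unitarity makes the conjugate transpose one;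
    comparing their entries gives the lower row. *)
Lemma special_quat x : \val x = quat (alpha x) (beta x).
Proof.
have [/unitarymxP xu x1] := special_unitaryP x.
rewrite /quat /alpha /beta; move: xu x1; move: (\val x : 'M[K]_2) => M Mu M1.
pose adjM := mx22 (M 1 1) (- M 0 1) (- M 1 0) (M 0 0).
have MadjM : M *m adjM = 1%:M.
  rewrite {1}(mx22_eta M) mul_mx22 scalar_mx22.
  move: M1; rewrite {1}(mx22_eta M) det_mx22 => M1.
  by congr mx22; rewrite -?M1; ring.
have /eq_mx22[E00 E01 E10 E11] : adjM = mx22 (M 0 0)^* (M 1 0)^* (M 0 1)^* (M 1 1)^*.
  have <- : map_mx Num.conj M^T = mx22 (M 0 0)^* (M 1 0)^* (M 0 1)^* (M 1 1)^*.
    by rewrite -trmxC_mx22 -mx22_eta.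
  have [Munit _] := mulmx1_unit MadjM.
  by rewrite -(mulKmx Munit adjM) MadjM -Mu mulKmx.
by rewrite {1}(mx22_eta M); congr mx22; rewrite // -[M 1 0]opprK E10.
Qed.

Lemma alpha_betaP x y : alpha x = alpha y -> beta x = beta y -> x = y.
Proof. by move=> xa xb; apply: val_inj; rewrite !special_quat xa xb. Qed.

Lemma alpha_beta_norm x : alpha x * (alpha x)^* + beta x * (beta x)^* = 1.
Proof.
have [_] := special_unitaryP x.
by rewrite special_quat det_mx22 mulrN opprK.
Qed.

Definition mkSU a b (ab1 : a * a^* + b * b^* = 1) : SU2 :=
  @to_subset _ (@special_unitary_set R 2) (quat a b) (quat_special ab1).

Lemma alpha_mkSU a b (ab1 : a * a^* + b * b^* = 1) : alpha (mkSU ab1) = a.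
Proof. by rewrite /alpha /= mxE. Qed.

Lemma beta_mkSU a b (ab1 : a * a^* + b * b^* = 1) : beta (mkSU ab1) = b.
Proof. by rewrite /beta /= mxE. Qed.

Lemma alphaM x y : alpha (x * y)%g = alpha x * alpha y - beta x * (beta y)^*.
Proof.
rewrite {1}/alpha -[\val _]/(\val x *m \val y) !special_quat mul_mx22 mxE /=.
by rewrite mulrN.
Qed.

Lemma betaM x y : beta (x * y)%g = alpha x * beta y + beta x * (alpha y)^*.
Proof. by rewrite {1}/beta -[\val _]/(\val x *m \val y) !special_quat mul_mx22 mxE. Qed.

Lemma alpha1 : alpha 1%g = 1. Proof. by rewrite /alpha /= mxE. Qed.

Lemma beta1 : beta 1%g = 0. Proof. by rewrite /beta /= mxE. Qed.

Lemma conj_norm_subproof x : (alpha x)^* * (alpha x)^*^* + (- beta x) * (- beta x)^* = 1.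
Proof. by rewrite rmorphN mulrNN conjCK [_^* * _]mulrC alpha_beta_norm. Qed.

Lemma special_invE x : (x^-1)%g = mkSU (conj_norm_subproof x).
Proof.
apply: (@mulgI _ x); rewrite mulgV; apply: alpha_betaP.
  by rewrite alpha1 alphaM alpha_mkSU beta_mkSU rmorphN mulrN opprK alpha_beta_norm.
by rewrite beta1 betaM alpha_mkSU beta_mkSU conjCK; ring.
Qed.

Lemma alphaV x : alpha (x^-1)%g = (alpha x)^*.
Proof. by rewrite special_invE alpha_mkSU. Qed.

Lemma betaV x : beta (x^-1)%g = - beta x.
Proof. by rewrite special_invE beta_mkSU. Qed.

End SU2Coordinates.

(** * Compactness and connectedness *)

Section ComplexTopology.
Variable R : realType.
Local Notation K := (cplx R).

Lemma conj_continuous : continuous (Num.conj : K -> K).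
Proof.
move=> z U /nbhs_ballP[e e0 eU]; apply/nbhs_ballP; exists e => // w zw.
by apply: eU; rewrite /ball /= -rmorphB norm_conjC.
Qed.

Lemma conj_comp_continuous (X : topologicalType) (f : X -> K) :
  continuous f -> continuous (fun x => (f x)^*).
Proof. by move=> fc x; apply: continuous_comp; [exact: fc|exact: conj_continuous]. Qed.

Lemma real_complex_continuous : continuous (fun t : R => real_complex R t : K).
Proof.
move=> t U /nbhs_ballP[e /= e0 eU].
(* Radii of balls in [cplx R] are complex numbers, but a positive one is real. *)
have eR : e = real_complex R (complex.Re e) by rewrite RRe_real//; exact: gtr0_real.
have e0' : 0 < complex.Re e by rewrite -ltcR -eR.
apply/nbhs_ballP; exists (complex.Re e) => // s ts; apply: eU.
rewrite /ball /= -rmorphB /= normc_def /= expr0n addr0 sqrtr_sqr eR ltcR.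
exact: ts.
Qed.

(** A compact set containing the unit disk is enough to make its closed subsets compact; D is the
    image of the square [-1, 1]^2. *)
Lemma complex_disk_precompact :
  exists2 D : set K, compact D & forall z, `|z| <= 1 -> D z.
Proof.
pose f (p : R * R) : K := (real_complex R p.1 : K) + (Complex 0 1 : K) * (real_complex R p.2 : K).
have fC : continuous f.
  move=> p; apply: cvgD; first by apply: continuous_comp; [exact: cvg_fst|exact: real_complex_continuous].
  apply: cvgM; first exact: cvg_cst.
  by apply: continuous_comp; [exact: cvg_snd|exact: real_complex_continuous].
exists (f @` (`[-1, 1] `*` `[-1, 1])).
  apply: continuous_compact; first exact: continuous_subspaceT.
  by apply: compact_setX; exact: segment_compact.
move=> z /= z1; exists (complex.Re z, complex.Im z); last by rewrite /f /= -complexE.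
have := z1; rewrite normc_def -[1]/(real_complex R 1) lecR => z1R.
have zz : complex.Re z ^+ 2 + complex.Im z ^+ 2 <= 1.
  by rewrite -[leLHS]sqr_sqrtr ?addr_ge0 ?sqr_ge0// expr_le1// ?sqrtr_ge0.
by split; rewrite /= in_itv /=; nra.
Qed.

Lemma circle_compact : compact [set: circle R].
Proof.
have [D cD DD] := complex_disk_precompact.
apply: compact_subtype; apply: subclosed_compact cD _; last first.
  by move=> z /= z1; apply: DD; rewrite z1.
apply: (@closed_eq_continuous _ K (fun z : K => `|z|) (fun=> 1)).
- exact: (@norm_hausdorff K K^o).
- exact: norm_continuous.
- by move=> z; exact: cst_continuous.
Qed.

(** Each row of a unitary matrix is a unit vector. *)
Lemma unitary_entry_le m (A : 'M[K]_m) i j : A \is unitarymx -> `|A i j| <= 1.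
Proof.
move=> /unitarymxP/matrixP/(_ i i); rewrite !mxE eqxx mulr1n => E.
rewrite -(@expr_le1 _ 2)// -E normCK (bigD1 j)//= !mxE lerDl.
by apply: sumr_ge0 => k _; rewrite !mxE -normCK exprn_ge0.
Qed.

Lemma trmxC_continuous (X : topologicalType) m n (f : X -> 'M[K]_(m, n)) :
  continuous f -> continuous (fun x => map_mx Num.conj (f x)^T).
Proof.
move=> fc; apply: continuous_mx => i j.
have -> : (fun x => map_mx Num.conj (f x)^T i j) = (fun x => (f x j i)^*).
  by apply/funext => x; rewrite !mxE.
by apply: conj_comp_continuous; exact: mx_coord_continuous.
Qed.

Lemma unitary_set_closed m : closed (@unitary_set R m).
Proof.
have -> : @unitary_set R m = [set A | A *m map_mx Num.conj A^T = 1%:M].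
  by apply/seteqP; split=> A /unitarymxP.
apply: closed_eq_continuous; first exact: mx_hausdorff.
- apply: mulmx_continuous; first by move=> A; exact: cvg_id.
  by apply: trmxC_continuous => A; exact: cvg_id.
- by move=> A; exact: cst_continuous.
Qed.

Lemma det2_continuous : continuous (fun A : 'M[K]_2 => \det A).
Proof.
have -> : (fun A : 'M[K]_2 => \det A) = (fun A => A 0 0 * A 1 1 - A 0 1 * A 1 0).
  by apply/funext => A; rewrite {1}(mx22_eta A) det_mx22.
by apply: continuous_add; last apply: continuous_opp; apply: continuous_mul; exact: coord_continuous.
Qed.

Lemma unitary_set_compact m : compact (@unitary_set R m).
Proof.
have [D cD DD] := complex_disk_precompact.
apply: subclosed_compact (@unitary_set_closed m) (mx_compact cD) _.
by move=> A Au i j; apply: DD; exact: unitary_entry_le.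
Qed.

Lemma unitary_compact m : compact [set: unitary R m].
Proof. exact/compact_subtype/unitary_set_compact. Qed.

Lemma unitary_hausdorff m : hausdorff_space (unitary R m).
Proof. exact/hausdorff_subtype/mx_hausdorff. Qed.

Lemma SU2_compact : compact [set: special_unitary R 2].
Proof.
apply: compact_subtype.
apply: (subclosed_compact _ (@unitary_set_compact 2)).
  apply: closedI; first exact: unitary_set_closed.
  apply: closed_eq_continuous; first exact: (@norm_hausdorff K K^o).
    exact: det2_continuous.
  by move=> A; exact: cst_continuous.
by move=> A [].
Qed.

Lemma SU2_hausdorff : hausdorff_space (special_unitary R 2).
Proof. exact/hausdorff_subtype/mx_hausdorff. Qed.

Lemma unitary_continuous (X : topologicalType) m (f : X -> unitary R m) :
  continuous (fun x => \val (f x) : 'M[K]_m) -> continuous f.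
Proof. exact: continuous_subtype. Qed.

Lemma unitary_val_continuous (X : topologicalType) m (f : X -> unitary R m) :
  continuous f -> continuous (fun x => \val (f x) : 'M[K]_m).
Proof.
by move=> fc x; apply: continuous_comp; [exact: fc|exact: subtype_val_continuous].
Qed.

Lemma SU2_continuous (X : topologicalType) (f : X -> special_unitary R 2) :
  continuous (fun x => alpha (f x)) -> continuous (fun x => beta (f x)) ->
  continuous f.
Proof.
move=> fa fb; apply: continuous_subtype.
have -> : (fun x => \val (f x)) = (fun x => quat (alpha (f x)) (beta (f x))).
  by apply/funext => x; exact: special_quat.
apply: continuous_mx => i j; under eq_fun do rewrite mxE.
case: (i == 0); case: (j == 0).
- exact: fa.
- exact: fb.
- by apply: continuous_opp; apply: conj_comp_continuous; exact: fb.
- by apply: conj_comp_continuous; exact: fa.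
Qed.

Lemma alpha_continuous (X : topologicalType) (f : X -> special_unitary R 2) :
  continuous f -> continuous (fun x => alpha (f x)).
Proof.
move=> fc; apply: (@mx_coord_continuous _ _ 2 2 (fun x => \val (f x))) => x.
by apply: continuous_comp; [exact: fc|exact: subtype_val_continuous].
Qed.

Lemma beta_continuous (X : topologicalType) (f : X -> special_unitary R 2) :
  continuous f -> continuous (fun x => beta (f x)).
Proof.
move=> fc; apply: (@mx_coord_continuous _ _ 2 2 (fun x => \val (f x))) => x.
by apply: continuous_comp; [exact: fc|exact: subtype_val_continuous].
Qed.

Lemma SU2_mul_continuous (X : topologicalType) (f g : X -> special_unitary R 2) :
  continuous f -> continuous g -> continuous (fun x => (f x * g x)%g).
Proof.
move=> fc gc; apply: SU2_continuous.
  under eq_fun do rewrite alphaM; apply: continuous_add; last apply: continuous_opp.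
    by apply: continuous_mul; exact: alpha_continuous.
  apply: continuous_mul; first exact: beta_continuous.
  by apply: conj_comp_continuous; exact: beta_continuous.
under eq_fun do rewrite betaM; apply: continuous_add.
  by apply: continuous_mul; [exact: alpha_continuous|exact: beta_continuous].
apply: continuous_mul; first exact: beta_continuous.
by apply: conj_comp_continuous; exact: alpha_continuous.
Qed.

Lemma SU2_inv_continuous (X : topologicalType) (f : X -> special_unitary R 2) :
  continuous f -> continuous (fun x => ((f x)^-1)%g).
Proof.
move=> fc; apply: SU2_continuous.
  by under eq_fun do rewrite alphaV; apply: conj_comp_continuous; exact: alpha_continuous.
by under eq_fun do rewrite betaV; apply: continuous_opp; exact: beta_continuous.
Qed.

Lemma unitary_mul_continuous (X : topologicalType) m (f g : X -> unitary R m) :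
  continuous f -> continuous g -> continuous (fun x => (f x * g x)%g).
Proof.
move=> fc gc; apply: unitary_continuous.
by apply: mulmx_continuous; exact: unitary_val_continuous.
Qed.

Lemma unitary_inv_continuous (X : topologicalType) m (f : X -> unitary R m) :
  continuous f -> continuous (fun x => ((f x)^-1)%g).
Proof.
move=> fc; apply: unitary_continuous.
have -> : (fun x => \val ((f x)^-1)%g) = (fun x => map_mx Num.conj (\val (f x))^T).
  by apply/funext => x; rewrite -invmx_unitary//; exact: unitaryP.
by apply: trmxC_continuous; exact: unitary_val_continuous.
Qed.

End ComplexTopology.

(** * Connectedness of SU(2) through its one-parameter subgroups *)

Section SU2Connected.
Variable R : realType.
Local Notation K := (cplx R).
Local Notation SU2 := (special_unitary R 2).

Definition rc (t : R) : K := real_complex R t.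

Lemma rc_conj t : (rc t)^* = rc t.
Proof. by apply: conj_Creal; rewrite /rc complex_real. Qed.

Lemma rcD s t : rc (s + t) = rc s + rc t. Proof. exact: rmorphD. Qed.
Lemma rcM s t : rc (s * t) = rc s * rc t. Proof. exact: rmorphM. Qed.
Lemma rc1 : rc 1 = 1. Proof. exact: rmorph1. Qed.

Lemma rotation_norm (theta : R) (a b : K) : a^* = - a -> a * a^* + b * b^* = 1 ->
  (rc (cos theta) + rc (sin theta) * a) * (rc (cos theta) + rc (sin theta) * a)^* +
  (rc (sin theta) * b) * (rc (sin theta) * b)^* = 1.
Proof.
move=> aC ab1; rewrite !conjE !rc_conj aC.
rewrite aC in ab1.
have : rc (cos theta) * rc (cos theta) + rc (sin theta) * rc (sin theta) = 1.
  by rewrite -!rcM -rcD -!expr2 cos2Dsin2 rc1.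
move: (rc (cos theta)) (rc (sin theta)) => c s cs1.
rewrite -cs1 -[s * s in RHS]mulr1 -ab1; ring.
Qed.

(** The exponential of theta u for the unit imaginary quaternion u = a + b j; [aC] says that a is
    purely imaginary. *)
Definition rotation (a b : K) (aC : a^* = - a) (ab1 : a * a^* + b * b^* = 1)
  (theta : R) : SU2 := mkSU (rotation_norm theta aC ab1).

Lemma alpha_rotation a b (aC : a^* = - a) (ab1 : a * a^* + b * b^* = 1) theta :
  alpha (rotation aC ab1 theta) = rc (cos theta) + rc (sin theta) * a.
Proof. exact: alpha_mkSU. Qed.

Lemma beta_rotation a b (aC : a^* = - a) (ab1 : a * a^* + b * b^* = 1) theta :
  beta (rotation aC ab1 theta) = rc (sin theta) * b.
Proof. exact: beta_mkSU. Qed.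

Lemma rotation_continuous a b (aC : a^* = - a) (ab1 : a * a^* + b * b^* = 1) :
  continuous (rotation aC ab1).
Proof.
have cc : continuous (fun theta : R => rc (cos theta)).
  by move=> t; apply: continuous_comp; [exact: continuous_cos|exact: real_complex_continuous].
have sc : continuous (fun theta : R => rc (sin theta)).
  by move=> t; apply: continuous_comp; [exact: continuous_sin|exact: real_complex_continuous].
apply: SU2_continuous.
  have -> : (fun theta => alpha (rotation aC ab1 theta)) =
      (fun theta => rc (cos theta) + rc (sin theta) * a).
    by apply/funext => theta; exact: alpha_mkSU.
  apply: continuous_add; first exact: cc.
  by apply: continuous_mul; [exact: sc|exact: cst_continuous].
have -> : (fun theta => beta (rotation aC ab1 theta)) = (fun theta => rc (sin theta) * b).
  by apply/funext => theta; exact: beta_mkSU.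
by apply: continuous_mul; [exact: sc|exact: cst_continuous].
Qed.

Lemma rotation0 a b (aC : a^* = - a) (ab1 : a * a^* + b * b^* = 1) :
  rotation aC ab1 0 = 1%g.
Proof.
apply: alpha_betaP; rewrite ?alpha_rotation ?beta_rotation ?alpha1 ?beta1 ?cos0 sin0 /rc rmorph0.
  by rewrite mul0r addr0 rmorph1.
by rewrite mul0r.
Qed.

(** Polar form of a unit quaternion: theta is the arc cosine of the real part, and the axis is the
    imaginary part divided by sin theta. When sin theta = 0 the imaginary part vanishes, and i
    serves as axis. *)
Lemma rotation_onto (x : SU2) : exists a b (aC : a^* = - a)
  (ab1 : a * a^* + b * b^* = 1), exists theta, x = rotation aC ab1 theta.
Proof.
pose I : K := Complex 0 1.
have II : I * I = -1 by rewrite -expr2; exact: sqr_i.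
have IC : I^* = - I.
  have I1 : I * I^* = 1 by rewrite -normCK expr2 -normrM II normrN1.
  have I0 : I != 0 by apply: contra_eq_neq I1 => ->; rewrite mul0r eq_sym oner_eq0.
  by apply: (mulfI I0); rewrite I1 mulrN II opprK.
have [t [s xa]] : exists t s, alpha x = rc t + I * rc s.
  by exists (complex.Re (alpha x)), (complex.Im (alpha x)); exact: complexE.
have [bt bt0 bb] : exists2 bt : R, 0 <= bt & beta x * (beta x)^* = rc bt.
  rewrite -normCK normc_def; set u := Num.sqrt _.
  by exists (u ^+ 2); [exact: sqr_ge0|rewrite /rc rmorphXn].
have tsb : t * t + s * s + bt = 1.
  apply: (@complexI R); rewrite -/(rc _) -/(rc 1) rc1 -(alpha_beta_norm x) xa bb.
  rewrite !conjE !rc_conj IC !rcD !rcM; congr (_ + _).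
  have -> : (rc t + I * rc s) * (rc t + - I * rc s) = rc t * rc t - I * I * (rc s * rc s) by ring.
  by rewrite II; ring.
pose theta := acos t.
have t1 : -1 <= t <= 1 by apply/andP; split; nra.
have ct : cos theta = t by exact: acosK.
have st : sin theta = Num.sqrt (1 - t ^+ 2) by exact: sin_acos.
have [r0|r0] := eqVneq (sin theta) 0.
  have : 1 - t ^+ 2 <= 0 by rewrite -sqrtr_eq0 -st r0.
  move=> t2.
  have s0 : s = 0 by nra.
  have b0 : beta x = 0.
    have : rc bt = 0 by rewrite (_ : bt = 0) /rc ?rmorph0//; nra.
    by rewrite -bb -normCK => /eqP; rewrite expf_eq0 /= normr_eq0 => /eqP.
  have I1 : I * I^* + 0 * 0^* = 1 by rewrite IC mul0r addr0 mulrN II opprK.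
  exists I, 0, IC, I1, theta; apply: alpha_betaP; rewrite ?alpha_rotation ?beta_rotation ?ct r0.
    by rewrite xa s0 /rc rmorph0; ring.
  by rewrite b0 /rc rmorph0; ring.
have rr : rc (sin theta) * rc (sin theta) = rc (s * s + bt).
  rewrite -rcM -expr2; congr rc; have := cos2Dsin2 theta; rewrite ct; nra.
have r0' : rc (sin theta) != 0 by rewrite /rc fmorph_eq0.
have aC : (I * rc s / rc (sin theta))^* = - (I * rc s / rc (sin theta)).
  by rewrite !conjE !rc_conj IC !mulNr.
have ab1 : (I * rc s / rc (sin theta)) * (I * rc s / rc (sin theta))^* +
   (beta x / rc (sin theta)) * (beta x / rc (sin theta))^* = 1.
  rewrite aC !conjE rc_conj.
  have -> : I * rc s / rc (sin theta) * - (I * rc s / rc (sin theta)) +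
     beta x / rc (sin theta) * ((beta x)^* / rc (sin theta)) =
     (- (I * I) * (rc s * rc s) + beta x * (beta x)^*) / (rc (sin theta) * rc (sin theta)).
    by field.
  rewrite rr II opprK mul1r bb -rcM -rcD divff//.
  by rewrite -rr mulf_neq0.
exists _, _, aC, ab1, theta; apply: alpha_betaP; rewrite ?alpha_rotation ?beta_rotation ?ct.
  by rewrite mulrC divfK.
by rewrite mulrC divfK.
Qed.

(** The one-parameter subgroups are connected, pass through 1 and cover SU(2). *)
Lemma SU2_connected : connected [set: SU2].
Proof.
pose P := {p : K * K | p.1^* = - p.1 /\ p.1 * p.1^* + p.2 * p.2^* = 1}.
pose f (p : P) : R -> SU2 := rotation (proj2_sig p).1 (proj2_sig p).2.
have -> : [set: SU2] = \bigcup_(p in [set: P]) range (f p).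
  apply/seteqP; split=> // x _; have [a [b [aC [ab1 [theta ->]]]]] := rotation_onto x.
  exists (exist _ (a, b) (conj aC ab1)) => //; exists theta => //.
  by apply: alpha_betaP; rewrite /f ?alpha_rotation ?beta_rotation.
apply: bigcup_connected.
  by exists 1%g => p _; exists 0 => //; exact: rotation0.
move=> p _; apply: connected_range; last exact: rotation_continuous.
exact/connected_intervalP.
Qed.

End SU2Connected.

(** * Nilpotent tuples of SU(2) *)

Section SU2Algebra.
Variable R : realType.
Local Notation K := (cplx R).
Local Notation SU2 := (special_unitary R 2).
Implicit Types (x y z g : SU2) (a b c d : K).

Definition abE := (@alphaM R, @betaM R, @alphaV R, @betaV R).

(** Total version of [mkSU], so that elements can be written without a proof argument; off the unit
    sphere the value is the default 1. *)
Definition su a b : SU2 :=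
  if pselect (a * a^* + b * b^* = 1) is left ab1 then mkSU ab1 else 1%g.

Lemma alpha_su a b : a * a^* + b * b^* = 1 -> alpha (su a b) = a.
Proof. by rewrite /su; case: pselect => // ab1 _; rewrite alpha_mkSU. Qed.

Lemma beta_su a b : a * a^* + b * b^* = 1 -> beta (su a b) = b.
Proof. by rewrite /su; case: pselect => // ab1 _; rewrite beta_mkSU. Qed.

Lemma alpha_diag a : a * a^* = 1 -> alpha (su a 0) = a.
Proof. by move=> a1; rewrite alpha_su// mul0r addr0. Qed.

Lemma beta_diag a : a * a^* = 1 -> beta (su a 0) = 0.
Proof. by move=> a1; rewrite beta_su// mul0r addr0. Qed.

Lemma alpha_anti a : a * a^* = 1 -> alpha (su 0 a) = 0.
Proof. by move=> a1; rewrite alpha_su// mul0r add0r. Qed.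

Lemma beta_anti a : a * a^* = 1 -> beta (su 0 a) = a.
Proof. by move=> a1; rewrite beta_su// mul0r add0r. Qed.

Lemma diag_norm x : beta x = 0 -> alpha x * (alpha x)^* = 1.
Proof. by move=> bx; rewrite -[RHS](alpha_beta_norm x) bx mul0r addr0. Qed.

Lemma anti_norm x : alpha x = 0 -> beta x * (beta x)^* = 1.
Proof. by move=> ax; rewrite -[RHS](alpha_beta_norm x) ax mul0r add0r. Qed.

Lemma unit_neq0 a : a * a^* = 1 -> a != 0.
Proof. by move=> a1; apply: contra_eq_neq a1 => ->; rewrite mul0r eq_sym oner_eq0. Qed.

Definition m1 : SU2 := su (-1) 0.

Lemma m1_norm : (-1) * (-1)^* = 1 :> K.
Proof. by rewrite !conjE mulrNN mulr1. Qed.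

Lemma alpha_m1 : alpha m1 = -1. Proof. exact: alpha_diag m1_norm. Qed.

Lemma beta_m1 : beta m1 = 0. Proof. exact: beta_diag m1_norm. Qed.

Lemma alpha_m1M x : alpha (m1 * x)%g = - alpha x.
Proof.
by rewrite alphaM ?alpha_m1 ?beta_m1 mul0r subr0 mulN1r.
Qed.

Lemma beta_m1M x : beta (m1 * x)%g = - beta x.
Proof.
by rewrite betaM ?alpha_m1 ?beta_m1 mul0r addr0 mulN1r.
Qed.

Lemma m1C x : commute m1 x.
Proof.
apply: alpha_betaP; rewrite !abE ?alpha_m1 ?beta_m1 !conjE; ring.
Qed.

Lemma m1M : (m1 * m1 = 1)%g.
Proof.
by apply: alpha_betaP; rewrite ?alpha_m1M ?beta_m1M ?alpha_m1 ?beta_m1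
  ?alpha1 ?beta1 ?oppr0 ?opprK.
Qed.

Lemma m1_neq1 : m1 <> 1%g.
Proof.
move=> /(congr1 (@alpha R)); rewrite alpha_m1 alpha1 => /eqP.
by rewrite eqNr oner_eq0.
Qed.

Lemma m1J x : (m1 ^ x = m1)%g.
Proof. by rewrite conjgE m1C mulKg. Qed.

(** Equality of the images in PU(2). *)
Definition eqpm x y := x = y \/ x = (m1 * y)%g.

Lemma eqpm_refl x : eqpm x x. Proof. by left. Qed.

Lemma eqpm_sym x y : eqpm x y -> eqpm y x.
Proof. by case=> ->; [left|right; rewrite mulgA m1M mul1g]. Qed.

Lemma eqpm_trans y x z : eqpm x y -> eqpm y z -> eqpm x z.
Proof. by case=> -> [] ->; rewrite ?mulgA ?m1M ?mul1g; [left|right|right|left]. Qed.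

Lemma eqpmJ x y g : eqpm x y -> eqpm (x ^ g)%g (y ^ g)%g.
Proof. by case=> ->; [left|right; rewrite conjMg m1J]. Qed.

Lemma eqpmM x x' y y' : eqpm x x' -> eqpm y y' -> eqpm (x * y)%g (x' * y')%g.
Proof.
move=> [] -> [] ->.
- by left.
- by right; rewrite !mulgA m1C.
- by right; rewrite mulgA.
- by left; rewrite -mulgA (mulgA x') -(m1C x') !mulgA m1M mul1g.
Qed.

Lemma eqpmV x y : eqpm x y -> eqpm (x^-1)%g (y^-1)%g.
Proof.
case=> ->; [by left|right]; rewrite invgM.
have -> : (m1^-1 = m1)%g by apply: (@mulgI _ m1); rewrite mulgV m1M.
by rewrite m1C.
Qed.

Lemma eqpm_alpha0 x y : eqpm x y -> alpha x = 0 <-> alpha y = 0.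
Proof.
by case=> -> //; rewrite alpha_m1M; split=> [/eqP|->]; rewrite ?oppr0// oppr_eq0 => /eqP.
Qed.

Lemma eqpm_beta0 x y : eqpm x y -> beta x = 0 <-> beta y = 0.
Proof.
by case=> -> //; rewrite beta_m1M; split=> [/eqP|->]; rewrite ?oppr0// oppr_eq0 => /eqP.
Qed.

Lemma scalarP x : beta x = 0 -> alpha x * alpha x = 1 -> eqpm x 1%g.
Proof.
move=> bx /eqP; rewrite -expr2 sqrf_eq1 => /orP[] /eqP ax; [left|right].
  by apply: alpha_betaP; rewrite ?alpha1 ?beta1.
by rewrite mulg1; apply: alpha_betaP; rewrite ?alpha_diag ?beta_diag ?m1_norm.
Qed.

Lemma conj_diag_alpha x g : beta g = 0 -> alpha (x ^ g)%g = alpha x.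
Proof.
move=> bg; rewrite conjgE !abE bg !conjE.
by rewrite -[RHS]mul1r -(diag_norm bg); ring.
Qed.

Lemma conj_diag_beta x g : beta g = 0 ->
  beta (x ^ g)%g = beta x * ((alpha g)^* * (alpha g)^* ).
Proof. by move=> bg; rewrite conjgE !abE bg !conjE; ring. Qed.

Definition SUj : SU2 := su 0 1.

Lemma one_norm : 1 * 1^* = 1 :> K. Proof. by rewrite conjE mulr1. Qed.

Lemma alpha_j : alpha SUj = 0. Proof. by rewrite alpha_anti// one_norm. Qed.

Lemma beta_j : beta SUj = 1. Proof. by rewrite beta_anti// one_norm. Qed.

Lemma conj_j_alpha x : alpha (x ^ SUj)%g = (alpha x)^*.
Proof. by rewrite conjgE !abE alpha_j beta_j !conjE; ring. Qed.

Lemma conj_j_beta x : beta (x ^ SUj)%g = (beta x)^*.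
Proof. by rewrite conjgE !abE alpha_j beta_j !conjE; ring. Qed.

Lemma diag_commute x y : beta x = 0 -> beta y = 0 -> commute x y.
Proof.
by move=> bx by_; apply: alpha_betaP; rewrite !abE bx by_ ?conjE; ring.
Qed.

(* A unit eigenvector of x, and its image under j, diagonalize x. *)
Lemma diagonalize x : exists g, beta (x ^ g)%g = 0.
Proof.
have [bx|bx] := eqVneq (beta x) 0; first by exists 1%g; rewrite conjg1.
pose a := alpha x; pose b := beta x.
(* Here s is i times the imaginary part of a. The vector (b, v) is an eigenvector when v^2 + 2 s v +
   |b|^2 = 0; r^2 is minus a quarter of the discriminant, and v = i r - s is a root. *)
have [s sC sa] : exists2 s, s^* = - s & a^* - a = - (s + s).
  by exists ((a - a^* ) / 2); [rewrite !conjE; ring|field].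
have [r rC rr] : exists2 r, r^* = r & r * r = b * b^* - s * s.
  exists (sqrtC (b * b^* - s * s)); last by rewrite -expr2 sqrtCK.
  have : 0 <= b * b^* - s * s by rewrite -mulrN -sC -!normCK addr_ge0 ?exprn_ge0.
  by rewrite -sqrtC_ge0 => /ger0_real/conj_Creal.
have [v vs] : exists v, v = 'i * r - s by exists ('i * r - s).
have vC : v^* = - v by rewrite vs !conjE rC sC conjCi; ring.
have vb : b * b^* + (v * v + (s + s) * v) = 0.
  have -> : b * b^* + (v * v + (s + s) * v) = b * b^* - s * s + 'i ^+ 2 * (r * r).
    by rewrite vs; ring.
  by rewrite sqrCi rr mulN1r subrr.
pose N := b * b^* + v * v^*; pose n := sqrtC N.
have N0 : 0 < N.
  by rewrite /N -!normCK ltr_wpDr ?exprn_ge0// exprn_gt0// normr_gt0.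
have nn : n * n = N by rewrite -expr2 sqrtCK.
have n0 : n != 0 by rewrite sqrtC_eq0 gt_eqF.
have nC : n^* = n by move: (ltW N0); rewrite -sqrtC_ge0 => /ger0_real/conj_Creal.
have g1 : (b / n) * (b / n)^* + (v / n) * (v / n)^* = 1.
  rewrite !conjE nC; have -> : b / n * (b^* / n) + v / n * (v^* / n) = N / (n * n).
    by rewrite /N; field.
  by rewrite nn divff// gt_eqF.
exists (su (b / n) (v / n)).
rewrite conjgE !abE alpha_su// beta_su// !conjE nC.
rewrite -/a -/b.
transitivity (b^* / (n * n) * (b * b^* + (v * v - (a^* - a) * v))); first by field.
by rewrite sa mulNr opprK vb mulr0.
Qed.

Lemma diag_scalar x : beta x = 0 -> alpha x = (alpha x)^* -> eqpm x 1%g.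
Proof. by move=> bx ax; apply: scalarP => //; rewrite {2}ax diag_norm. Qed.

(** The off-diagonal entries give ([alpha c] - its conjugate) [beta x] = 0, and a diagonal c with
    real [alpha c] is 1 or -1. *)
Lemma commute_diag (c x : SU2) : beta c = 0 -> ~ eqpm c 1%g -> commute c x -> beta x = 0.
Proof.
move=> bc c1 /(congr1 (@beta R)); rewrite !abE bc => cx.
have /eqP : (alpha c - (alpha c)^* ) * beta x = 0.
  rewrite mulrBl; apply/eqP; rewrite subr_eq0; apply/eqP.
  by move: cx; rewrite mul0r mulr0 addr0 add0r => ->; rewrite mulrC.
rewrite mulf_eq0 => /orP[|/eqP //]; rewrite subr_eq0 => /eqP ac.
by exfalso; apply: c1; exact: diag_scalar.
Qed.

(** Once c is diagonal, the centralizer of a nonscalar c lies in the diagonal torus, which is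
    abelian. *)
Lemma commute_scalar (c x y : SU2) : commute c x -> commute c y -> ~ commute x y ->
  eqpm c 1%g.
Proof.
have [g bg] := diagonalize c; move=> cx cy xy; apply: contrapT => c1; apply: xy.
have cg1 : ~ eqpm (c ^ g)%g 1%g.
  by move=> /(@eqpmJ _ _ (g^-1)%g); rewrite conjgK conj1g => /c1.
have cJ z : commute c z -> commute (c ^ g)%g (z ^ g)%g.
  by move=> cz; rewrite /commute -!conjMg cz.
have := diag_commute (commute_diag bg cg1 (cJ _ cx)) (commute_diag bg cg1 (cJ _ cy)).
by rewrite /commute -!conjMg => /conjg_inj.
Qed.

Definition anticommute x y := (x * y = m1 * (y * x))%g.

Lemma anticommuteJ x y g : anticommute x y -> anticommute (x ^ g)%g (y ^ g)%g.
Proof. by rewrite /anticommute => xy; rewrite -!conjMg xy (conjMg m1) m1J. Qed.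

Lemma anticommute_commg x y : [~ x, y]%g = m1 -> anticommute x y.
Proof. by move=> xy; rewrite /anticommute commgC xy m1C. Qed.

Lemma commute_sym_anti x y : anticommute x y -> anticommute y x.
Proof. by rewrite /anticommute => ->; rewrite mulgA m1M mul1g. Qed.

Lemma anti_diag_anti (a x : SU2) : beta a = 0 -> anticommute a x -> alpha x = 0.
Proof.
move=> ba /(congr1 (@alpha R)); rewrite alpha_m1M !alphaM ba conjE mul0r mulr0 !subr0.
move=> /eqP; rewrite -subr_eq0 opprK [X in _ + X]mulrC -mulr2n -mulr_natr.
rewrite !mulf_eq0 pnatr_eq0 orbF => /orP[] /eqP // aa.
by have := diag_norm ba; rewrite aa mul0r => /eqP; rewrite eq_sym oner_eq0.
Qed.

Lemma anticommute_diag_conj (a x : SU2) : beta a = 0 -> anticommute a x -> (alpha a)^* = - alpha a.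
Proof.
move=> ba ax; have x0 := anti_diag_anti ba ax.
move: ax => /(congr1 (@beta R)); rewrite beta_m1M !betaM ba x0 !(mul0r, addr0, add0r).
have bx := unit_neq0 (anti_norm x0).
rewrite [X in _ = - X]mulrC -mulNr => /(mulIf bx) aa; by rewrite [in RHS]aa opprK.
Qed.

Lemma pm_commute_diag (a x : SU2) : beta a = 0 -> ~ eqpm a 1%g ->
  eqpm (a * x)%g (x * a)%g -> beta x = 0 \/ alpha x = 0.
Proof.
move=> ba a1 [ax|ax]; [left|right]; first exact: commute_diag ax.
exact: anti_diag_anti ax.
Qed.

End SU2Algebra.

(** Picks the last term of the series with a nontrivial value. Its index is at least 2 by the last
    hypothesis; writing it as k + 2 provides the preceding term k + 1. *)
Lemma central_series_last (F G : groupType) (f : F -> G) q :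
  {morph f : x y / (x * y)%g} ->
  (forall w, @central_series F q.+1 w -> f w = 1%g) ->
  (exists2 w, @central_series F 2 w & f w <> 1%g) ->
  exists k, (exists2 w, @central_series F k.+2 w & f w <> 1%g) /\
    forall w, @central_series F k.+3 w -> f w = 1%g.
Proof.
move=> fM; elim: q => [|q IHq] fq f2.
  by have [w _ []] := f2; exact: fq.
have [fq'|] := pselect (forall w, @central_series F q.+1 w -> f w = 1%g).
  exact: IHq.
case: q fq {IHq} => [|q] fq fq'.
  by have [w w2 []] := f2; exact: fq.
exists q; split; last by [].
by move/existsNP: fq' => [w /not_implyP[qw wn]]; exists w.
Qed.

(** Conjugation by an antidiagonal y inverts the torus, so the commutator is x^(-2). *)
Lemma commg_diag_anti (R : realType) (x y : special_unitary R 2) :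
  beta x = 0 -> alpha y = 0 ->
  beta [~ x, y]%g = 0 /\ alpha [~ x, y]%g = (alpha x)^* * (alpha x)^*.
Proof.
move=> x0 y0; rewrite commgEl conjgE !abE x0 y0 !conjE; split; first by ring.
have bb : (beta y)^* * beta y = 1 by rewrite mulrC anti_norm.
by rewrite -[RHS]mul1r -bb; ring.
Qed.

Section NilpotentTuples.
Variables (R : realType) (n q : nat).
Local Notation K := (cplx R).
Local Notation SU2 := (special_unitary R 2).
Variable A : 'I_n -> SU2.
Hypothesis Aq : nil_tuple q.+1 A.
Hypothesis Anc : ~ forall i j, commute (A i) (A j).
Local Notation phi := (free_eval A).

Lemma noncommuting_pair : exists i j, ~ commute (A i) (A j).
Proof. by move/existsNP: Anc => [i /existsNP[j ij]]; exists i, j. Qed.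

Lemma central_value_pm w : (forall u, commute (phi w) (phi u)) -> eqpm (phi w) 1%g.
Proof.
have [i [j ij]] := noncommuting_pair => wC.
by apply: commute_scalar ij; rewrite -free_eval_gen.
Qed.

(** The element a comes one step before the last nontrivial term, so its commutators are central in
    the image. The condition on all w, not only on b, is what later puts the whole image into the
    normalizer of a torus. *)
Lemma anticommuting_generator : exists a b,
  [~ phi a, phi b]%g = m1 R /\ forall w, [~ phi a, phi w]%g = 1%g \/ [~ phi a, phi w]%g = m1 R.
Proof.
have phiM := free_evalM A.
have f2 : exists2 w, @central_series (free_group n) 2 w & phi w <> 1%g.
  have [i [j ij]] := noncommuting_pair; exists [~ free_gen i, free_gen j]%g.
    exact: central_series_commg.
  by rewrite (morph_commg phiM) !free_eval_gen => /eqP/commgP/ij.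
have [k [[c kc c1] k3]] := central_series_last phiM Aq f2.
have pm w : @central_series (free_group n) k.+2 w -> phi w = 1%g \/ phi w = m1 R.
  move=> kw; have : eqpm (phi w) 1%g.
    apply: central_value_pm => u; apply/commgP/eqP; rewrite -(morph_commg phiM).
    by apply: k3; exact: central_series_commg.
  by case=> ->; [left|right; rewrite mulg1].
have [a [ka [b ab]]] : exists a, @central_series (free_group n) k.+1 a /\
    exists b, phi [~ a, b]%g <> 1%g.
  (* The term k + 2 is generated by the commutators with elements a of the term k + 1; if these all
     evaluated to 1, so would c. *)
  apply: contrapT => /forallNP nab; apply: c1; move: c kc.
  rewrite central_seriesS.
  apply: (@generated_min _ _ (phi @^-1` [set 1%g])).
    by apply: (subgroup_preimage phiM); exact: subgroup1.
  move=> _ [a ka [b _ ->]] /=; apply: contrapT => ab.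
  by apply: (nab a); split=> //; exists b.
exists a, b; rewrite -(morph_commg phiM); split.
  by have [] := pm _ (central_series_commg b ka).
by move=> w; rewrite -(morph_commg phiM); apply: pm; exact: central_series_commg.
Qed.

Lemma normalizer_form : exists g : SU2,
  [/\ forall w, beta (phi w ^ g)%g = 0 \/ alpha (phi w ^ g)%g = 0,
      forall w, beta (phi w ^ g)%g = 0 -> alpha (phi w ^ g)%g ^+ (2 ^ q) = 1
    & exists i, alpha (A i ^ g)%g = 0].
Proof.
have phiM := free_evalM A.
have [a [b [ab aw]]] := anticommuting_generator.
have [g ag] := diagonalize (phi a); exists g.
have abg := anticommuteJ g (anticommute_commg ab).
have a1 : ~ eqpm (phi a ^ g)%g 1%g.
  case=> E; have := abg; rewrite E /anticommute ?mulg1 ?mul1g.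
    by rewrite -{1}[(_ ^ _)%g]mul1g => /mulIg/esym/m1_neq1.
  by rewrite -[((phi b ^ g) * _)%g]m1C -{1}[(_ * _)%g]mul1g => /mulIg/esym/m1_neq1.
have form w : beta (phi w ^ g)%g = 0 \/ alpha (phi w ^ g)%g = 0.
  apply: (pm_commute_diag ag a1); case: (aw w) => [/eqP/commgP|] aw'.
    by left; rewrite -!conjMg aw'.
  by right; exact: anticommuteJ (anticommute_commg aw').
have b0 : alpha (phi b ^ g)%g = 0 := anti_diag_anti ag abg.
split; [exact: form|move=> w w0|]; last first.
  (* If no entry were antidiagonal, all would be diagonal and commute. *)
  apply: contrapT => /forallNP nA; apply: Anc => i j.
  have An k : beta (A k ^ g)%g = 0.
    by have := form (free_gen k); rewrite free_eval_gen => -[//|/nA].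
  by have := diag_commute (An i) (An j); rewrite /commute -!conjMg => /conjg_inj.
(* The m-fold commutator of w with b: it lies in the term m + 1, and its value in the torus is that
   of w raised to the power (-2)^m. The alternating sign of this exponent accounts for the conjugate
   in [vE]. *)
pose v := fix v m := if m is m'.+1 then [~ v m', b]%g else w.
have vq m : @central_series (free_group n) m.+1 (v m).
  by elim: m => [|m IHm] //; exact: central_series_commg.
have vE m : beta (phi (v m) ^ g)%g = 0 /\
  (alpha (phi (v m) ^ g)%g = alpha (phi w ^ g)%g ^+ (2 ^ m) \/
   (alpha (phi (v m) ^ g)%g)^* = alpha (phi w ^ g)%g ^+ (2 ^ m)).
  elim: m => [|m [IH0 IHm]]; first by split=> //; left.
  have [E0 E1] := commg_diag_anti IH0 b0.
  rewrite -conjRg -(morph_commg phiM) in E0 E1.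
  split=> //; rewrite E1 !conjE expnSr exprM expr2.
  by case: IHm => <-; [right|left].
have [_] := vE q; rewrite (Aq (vq q)) conj1g alpha1 conjE.
by case=> <-.
Qed.

End NilpotentTuples.

(** * Roots of unity of 2-power order *)

Section DyadicRoots.
Variable C : numClosedFieldType.

(** Iterated square roots of -1, indexed so that [dyadic_root q] has order 2^q. *)
Fixpoint dyadic_root (q : nat) : C :=
  if q is q'.+1 then (if q' is 0 then -1 else sqrtC (dyadic_root q')) else 1.

Lemma dyadic_rootN q : dyadic_root q.+1 ^+ (2 ^ q) = -1.
Proof. by elim: q => [|q IHq]; rewrite ?expr1// expnS exprM sqrtCK. Qed.

Arguments dyadic_root : simpl never.

(** The 2^q-th power is -1, so no proper divisor of 2^(q+1) can be the order. *)
Lemma dyadic_root_prim q : (2 ^ q.+1).-primitive_root (dyadic_root q.+1).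
Proof.
have w1 : dyadic_root q.+1 ^+ (2 ^ q.+1) = 1.
  by rewrite expnSr exprM dyadic_rootN sqrrN expr1n.
have [m mp md] := prim_order_exists (expn_gt0 2 q.+1) w1.
have /(dvdn_pfactor _ _ (isT : prime 2))[k kq mE] := md.
move: kq; rewrite leq_eqVlt => /predU1P[kq|kq]; first by move: mp; rewrite mE kq.
have : dyadic_root q.+1 ^+ (2 ^ q) = 1.
  have [d ->] : exists d, (2 ^ q = m * d)%N.
    by exists (2 ^ (q - k))%N; rewrite mE -expnD subnKC.
  by rewrite exprM (prim_expr_order mp) expr1n.
by rewrite dyadic_rootN => /eqP; rewrite eqNr oner_eq0.
Qed.

Section Powers.
Variable p : nat.
Local Notation w := (dyadic_root p.+2).
Local Notation N := (2 ^ p.+1)%N.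
Local Notation h := (2 ^ p)%N.

Definition pm_eq (x y : C) := x = y \/ x = - y.

Lemma NE : N = (h + h)%N. Proof. by rewrite expnS mul2n addnn. Qed.

Lemma h_gt0 : (0 < h)%N. Proof. by rewrite expn_gt0. Qed.

Lemma N_gt0 : (0 < N)%N. Proof. by rewrite expn_gt0. Qed.

(** Since w has order 2N and w^N = -1, exponents count modulo N up to sign. *)
Lemma root_pow y : y ^+ (2 ^ p.+2) = 1 -> exists m : 'I_N, pm_eq y (w ^+ m).
Proof.
move=> /(prim_rootP (dyadic_root_prim p.+1))[[k /= kM] ->].
have [kN|kN] := ltnP k N; first by exists (Ordinal kN); left.
have kN' : (k - N < N)%N by move: kM; rewrite (expnS 2 p.+1); lia.
exists (Ordinal kN'); right => /=.
by rewrite -[in LHS](subnKC kN) exprD dyadic_rootN mulN1r.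
Qed.

Lemma pow_inj (l m : 'I_N) : pm_eq (w ^+ l) (w ^+ m) -> l = m.
Proof.
move=> lm; have : w ^+ (2 * l) == w ^+ (2 * m).
  by rewrite !(mulnC 2) !exprM; case: lm => ->; rewrite ?sqrrN.
rewrite (eq_prim_root_expr (dyadic_root_prim p.+1)) (expnS 2 p.+1) -!muln_modr.
rewrite eqn_pmul2l// !modn_small// => /eqP lm'; exact/val_inj.
Qed.

(** The root w^h is a primitive fourth root of unity, h being N/2: the two exponents are those of 1
    and i up to sign. *)
Lemma pow_quarter (m : 'I_N) : (w ^+ m) ^+ 4 = 1 <-> m = 0%N :> nat \/ m = h :> nat.
Proof.
have E : ((w ^+ m) ^+ 4 == 1) = (h %| m)%N.
  rewrite -exprM -(prim_order_dvd (dyadic_root_prim p.+1)).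
  have -> : (2 ^ p.+2 = h * 4)%N by rewrite -(addn2 p) expnD.
  by rewrite dvdn_pmul2r.
split=> [/eqP|mh].
  rewrite E => /dvdnP[k mk]; have := ltn_ord m; rewrite mk NE.
  have := h_gt0; move: (2 ^ p)%N mk => a mk a0.
  case: k mk => [|[|k]] mk; rewrite ?mul0n ?mul1n; [by left|by right|nia].
by apply/eqP; rewrite E; case: mh => ->; rewrite ?dvdn0 ?dvdnn.
Qed.

Lemma root_norm m : (w ^+ m) * (w ^+ m)^* = 1.
Proof.
have w1 : `|w| = 1.
  apply/eqP; rewrite -(@pexpr_eq1 _ _ (2 ^ p.+2)) ?expn_gt0//.
  by rewrite -normrX (prim_expr_order (dyadic_root_prim p.+1)) normr1.
by rewrite -normCK normrX w1 !expr1n.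
Qed.

(** Negation in Z/N; the remainder is there for m = 0. *)
Definition negI (m : 'I_N) : 'I_N := Ordinal (ltn_pmod (N - m) N_gt0).

Lemma root_conj (m : 'I_N) : pm_eq (w ^+ m)^* (w ^+ negI m).
Proof.
have w0 : w ^+ m != 0 by apply: contra_eq_neq (root_norm m) => ->; rewrite mul0r eq_sym oner_eq0.
rewrite /=; have [m0|m0] := posnP m.
  by left; rewrite m0 subn0 modnn expr0 rmorph1.
right; apply: (mulfI w0); rewrite root_norm mulrN -exprD modn_small; last by lia.
by rewrite subnKC ?dyadic_rootN ?opprK//; exact: ltnW.
Qed.

End Powers.

End DyadicRoots.

(** * Tuples in generalized quaternion groups *)

Section DyadicTuples.
Variables (R : realType) (n p : nat).
Local Notation K := (cplx R).
Local Notation SU2 := (special_unitary R 2).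
Local Notation q := p.+2.
Local Notation w := (dyadic_root K p.+2).
Local Notation N := (2 ^ p.+1)%N.
Local Notation h := (2 ^ p)%N.

Definition diag_root k : set SU2 := [set x | beta x = 0 /\ alpha x ^+ (2 ^ k) = 1].

(** The generalized quaternion group of order 2^(p+3), of nilpotency class p + 2 = q; for p = 0 it
    is the quaternion group of order 8. *)
Definition quaternionic : set SU2 := [set x |
  (beta x = 0 /\ alpha x ^+ (2 ^ q) = 1) \/ (alpha x = 0 /\ beta x ^+ (2 ^ q) = 1)].

Lemma diag_root_subgroup k : is_subgroup (diag_root k).
Proof.
split; first by split; rewrite ?beta1 ?alpha1 ?expr1n.
  move=> x y [bx ax] [by_ ay]; split; rewrite abE bx by_ ?conjE.
    by rewrite mulr0 mul0r addr0.
  by rewrite mul0r subr0 exprMn ax ay mulr1.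
move=> x [bx ax]; split; rewrite abE ?bx ?oppr0//.
by rewrite -rmorphXn /= ax conjE.
Qed.

Lemma conj_root (a : K) k : a ^+ k = 1 -> (a^* ) ^+ k = 1.
Proof. by move=> ak; rewrite -rmorphXn /= ak conjE. Qed.

Lemma quaternionic_subgroup : is_subgroup quaternionic.
Proof.
have NM (a : K) : (- a) ^+ (2 ^ q) = a ^+ (2 ^ q) by rewrite expnS !exprM sqrrN.
split; first by left; rewrite ?beta1 ?alpha1 ?expr1n.
  move=> x y [] [x0 x1] [] [y0 y1]; rewrite /quaternionic /= !abE x0 y0 !conjE;
    rewrite !(mul0r, mulr0, subr0, addr0, add0r, sub0r, oppr0).
  - by left; rewrite exprMn x1 y1 mulr1.
  - by right; rewrite exprMn x1 y1 mulr1.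
  - by right; rewrite exprMn x1 (conj_root y1) mulr1.
  - by left; rewrite NM exprMn x1 (conj_root y1) mulr1.
move=> x [] [x0 x1]; rewrite /quaternionic /= !abE x0 ?oppr0 ?conjE.
  by left; rewrite (conj_root x1).
by right; rewrite NM.
Qed.

(** Commutators of this group are squares of its diagonal elements, so the bound on the order is
    halved. *)
Lemma commg_quaternionic x y : quaternionic x -> quaternionic y ->
  diag_root p.+1 [~ x, y]%g.
Proof.
have sq (a : K) : a ^+ (2 ^ q) = 1 -> (a^* * a^* ) ^+ (2 ^ p.+1) = 1.
  by move=> a1; rewrite -expr2 -exprM -expnS conj_root.
have DA (x0 y0 : SU2) : beta x0 = 0 -> alpha x0 ^+ (2 ^ q) = 1 -> alpha y0 = 0 ->
    diag_root p.+1 [~ x0, y0]%g.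
  by move=> bx ax ay; have [E0 E1] := commg_diag_anti bx ay; split; rewrite // E1 sq.
have [_ _ dV] := diag_root_subgroup p.+1.
move=> [] [x0 x1] [] [y0 y1].
- have /commgP/eqP -> := diag_commute x0 y0.
  by have [] := diag_root_subgroup p.+1.
- exact: DA.
- by rewrite -invgR; apply/dV/DA.
- rewrite commgEl conjgE /diag_root /= !abE x0 y0 !conjE.
  rewrite !(mul0r, mulr0, subr0, addr0, add0r, sub0r, oppr0, mulrN, mulNr, opprK); split=> //.
  set u := (X in X ^+ _); have -> : u = (beta x * (beta y)^* ) ^+ 2 by rewrite /u; ring.
  by rewrite -exprM -expnS exprMn x1 (conj_root y1) mulr1.
Qed.

Lemma commg_diag_root k x y : diag_root k.+1 x -> quaternionic y ->
  diag_root k [~ x, y]%g.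
Proof.
move=> [x0 x1] [] [y0 y1].
  by have /commgP/eqP -> := diag_commute x0 y0; have [] := diag_root_subgroup k.
have [E0 E1] := commg_diag_anti x0 y0; split=> //.
by rewrite E1 -expr2 -exprM -expnS conj_root.
Qed.

(** Converse to the constraints on nilpotent tuples: the normal forms do define homomorphisms from
    F_n/Gamma^(q+1). *)
Lemma quaternionic_nil (A : 'I_n -> SU2) : (forall i, quaternionic (A i)) ->
  nil_tuple q.+1 A.
Proof.
move=> AQ; have phiM := free_evalM A.
have phiQ u : quaternionic (free_eval A u).
  have [Q1 QM QV] := quaternionic_subgroup.
  rewrite /free_eval; elim: (val u) => [|[i b] v IHv] //=.
  by apply: QM => //; case: b; rewrite /eval_letter /=; [apply: QV|].
(* Every commutator halves the order: values of the term k + 2 have order dividing 2^(p+1-k), so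
   those of the term q + 1 = p + 3 are 1. *)
have step k : (k <= p.+1)%N -> @central_series (free_group n) k.+2 `<=`
    free_eval A @^-1` diag_root (p.+1 - k).
  elim: k => [|k IHk] kp; rewrite central_seriesS; apply: generated_min.
  - exact: (subgroup_preimage phiM (diag_root_subgroup _)).
  - move=> _ [x _ [y _ ->]] /=; rewrite (morph_commg phiM) subn0.
    exact: commg_quaternionic.
  - exact: (subgroup_preimage phiM (diag_root_subgroup _)).
  - move=> _ [x kx [y _ ->]] /=; rewrite (morph_commg phiM).
    apply: commg_diag_root; last exact: phiQ.
    have -> : ((p.+1 - k.+1).+1 = p.+1 - k)%N by rewrite subnSK.
    by apply: IHk => //; exact: ltnW.
move=> u /(step p.+1 (leqnn _)) /=; rewrite subnn => -[u0 u1].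
by apply: alpha_betaP; rewrite ?alpha1 ?beta1.
Qed.

End DyadicTuples.

Lemma first_index n (P : 'I_n -> Prop) : (exists i, P i) ->
  exists2 i, P i & forall j : 'I_n, (j < i)%N -> ~ P j.
Proof.
move=> [i0 Pi0]; have : exists k, [exists i : 'I_n, (i == k :> nat) && `[< P i >]].
  by exists i0; apply/existsP; exists i0; rewrite eqxx; apply/asboolP.
move=> /ex_minnP[k /existsP[i /andP[/eqP <- /asboolP Pi]] kmin]; exists i => // j ji Pj.
have := kmin j; rewrite leqNgt ji => /(_ _)/notF; apply.
by apply/existsP; exists j; rewrite eqxx; apply/asboolP.
Qed.

(** * Existence of normal forms for non-commuting tuples *)

Section NormalForms.
Variables (R : realType) (n p : nat).
Local Notation K := (cplx R).
Local Notation SU2 := (special_unitary R 2).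
Local Notation q := p.+2.
Local Notation w := (dyadic_root K p.+2).
Local Notation N := (2 ^ p.+1)%N.
Local Notation h := (2 ^ p)%N.
Implicit Types (A B : 'I_n -> SU2) (x y g : SU2).

Definition noncommuting A := ~ forall i j, commute (A i) (A j).

(** Commutativity of the images in PU(2); it separates the Klein case from the dihedral one. *)
Definition pm_commuting A := forall i j, eqpm (A i * A j)%g (A j * A i)%g.

(** The orbit relation of conjugation and sign changes together, each entry having its own sign; its
    classes of non-commuting tuples index the summands. *)
Definition pm_conj A B := exists g, forall i, eqpm (A i ^ g)%g (B i).

Lemma pm_conj_sym A B : pm_conj A B -> pm_conj B A.
Proof.
move=> [g gAB]; exists (g^-1)%g => i; apply: eqpm_sym.
by have := eqpmJ (g^-1)%g (gAB i); rewrite conjgK.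
Qed.

Lemma pm_conj_trans B A D : pm_conj A B -> pm_conj B D -> pm_conj A D.
Proof.
move=> [g gAB] [k kBD]; exists (g * k)%g => i; rewrite conjgM.
exact: eqpm_trans (eqpmJ k (gAB i)) (kBD i).
Qed.

Lemma pm_conj_commuting A B : pm_conj A B -> pm_commuting A -> pm_commuting B.
Proof.
move=> [g gAB] AC i j; have := eqpmJ g (AC i j); rewrite !conjMg => E.
apply: eqpm_trans (eqpm_trans E (eqpmM (gAB j) (gAB i))).
exact/eqpm_sym/eqpmM.
Qed.

Lemma eqpm_diag x (a : K) : beta x = 0 -> pm_eq (alpha x) a -> eqpm x (su a 0).
Proof.
move=> bx xa; have a1 : a * a^* = 1.
  by have := diag_norm bx; case: xa => ->; rewrite ?conjE ?mulrNN.
case: xa => xa; [left|right]; apply: alpha_betaP;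
  by rewrite ?alpha_m1M ?beta_m1M ?alpha_diag ?beta_diag ?oppr0.
Qed.

Lemma eqpm_anti x (a : K) : alpha x = 0 -> pm_eq (beta x) a -> eqpm x (su 0 a).
Proof.
move=> ax xa; have a1 : a * a^* = 1.
  by have := anti_norm ax; case: xa => ->; rewrite ?conjE ?mulrNN.
case: xa => xa; [left|right]; apply: alpha_betaP;
  by rewrite ?alpha_m1M ?beta_m1M ?alpha_anti ?beta_anti ?oppr0.
Qed.

(** Conjugation by the diagonal matrix of u multiplies [beta x] by the square of the conjugate of u,
    so a square root u of [beta x] turns it into 1. *)
Lemma anti_normalize x : alpha x = 0 -> exists2 d, beta d = 0 & (x ^ d)%g = SUj R.
Proof.
move=> ax; set b := beta x; have b1 : b * b^* = 1 by exact: anti_norm.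
pose u := sqrtC b; have uu : u * u = b by rewrite -expr2 sqrtCK.
have u1 : u * u^* = 1.
  rewrite -normCK -normrX expr2 uu.
  have : `|b| ^+ 2 == 1 by rewrite normCK b1.
  by rewrite sqrp_eq1 ?normr_ge0// => /eqP.
exists (su u 0); first by rewrite beta_diag.
have bd : beta (su u 0 : SU2) = 0 by rewrite beta_diag.
apply: alpha_betaP; rewrite ?conj_diag_alpha ?conj_diag_beta// ?alpha_j ?beta_j//.
rewrite alpha_diag// -/b -uu.
have -> : u * u * (u^* * u^* ) = (u * u^* ) * (u * u^* ) by ring.
by rewrite u1 mulr1.
Qed.

(** In the quaternion group of order 8 every commutator is 1 or -1. *)
Lemma quarter_pm_commute x y : quaternionic 0 x -> quaternionic 0 y ->
  eqpm (x * y)%g (y * x)%g.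
Proof.
move=> xQ yQ; have [b0 a1] := commg_quaternionic xQ yQ.
rewrite commgC; have [->|->] : eqpm [~ x, y]%g 1%g by apply: scalarP.
  by rewrite mulg1; left.
by rewrite mulg1 -m1C; right.
Qed.

(** The quaternions 1, i, j and k = i j. *)
Definition klein_letter (l : 'I_4) : SU2 :=
  nth 1%g [:: 1%g; su 'i 0; SUj R; su 0 'i] l.

(** Conjugation can permute i, j, k up to sign, so the normal form fixes their order of appearance:
    the first letter other than 1 is i, the first one outside 1 and i is j. *)
Definition klein_canonical (c : 'I_n -> 'I_4) := exists i1 i2 : 'I_n,
  [/\ forall i : 'I_n, (i < i1)%N -> c i = 0 :> nat, c i1 = 1%N :> nat,
      forall i : 'I_n, (i < i2)%N -> (c i <= 1)%N & c i2 = 2%N :> nat].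

Lemma i_norm : 'i * 'i^* = 1 :> K.
Proof. by rewrite conjCi mulrN -expr2 sqrCi opprK. Qed.

Lemma sqrN1 (a : K) : a * a = -1 -> pm_eq a 'i.
Proof.
move=> aa; have : a ^+ 2 == 'i ^+ 2 by rewrite expr2 aa sqrCi.
by rewrite eqf_sqr => /orP[] /eqP; [left|right].
Qed.

Lemma unit_pm_conj (a : K) : a * a^* = 1 -> a = a^* \/ a = - a^* ->
  pm_eq a 1 \/ pm_eq a 'i.
Proof.
move=> a1 [] E; [left|right].
  have : a ^+ 2 == 1 ^+ 2 by rewrite expr2 {2}E a1 expr1n.
  by rewrite eqf_sqr => /orP[] /eqP; [left|right].
by apply: sqrN1; rewrite {2}E mulrN a1.
Qed.

(** The entry at i1 is the first other than 1 and -1, the one at i2 the first that does not commute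
    with it. Conjugation makes the former diagonal and the latter equal to j; commutation up to sign
    then leaves only letters. *)
Lemma klein_exists A : noncommuting A -> pm_commuting A ->
  exists2 c, klein_canonical c & pm_conj A (klein_letter \o c).
Proof.
move=> Anc Apm.
have [i1 Ai1 i1min] : exists2 i, ~ eqpm (A i) 1%g & forall j : 'I_n, (j < i)%N -> ~ ~ eqpm (A j) 1%g.
  apply: first_index; apply: contrapT => /forallNP A1; apply: Anc => i j.
  have /contrapT [->|->] := A1 i; first exact/commute_sym/commute1.
  by rewrite mulg1; exact: m1C.
have [i2 Ai2 i2min] : exists2 i, ~ commute (A i1) (A i) &
    forall j : 'I_n, (j < i)%N -> ~ ~ commute (A i1) (A j).
  apply: first_index; apply: contrapT => /forallNP A1; apply: Anc => i j.
  apply: contrapT => ij; apply: Ai1.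
  exact: commute_scalar (contrapT (A1 i)) (contrapT (A1 j)) ij.
have A12 : anticommute (A i1) (A i2) by case: (Apm i1 i2) => [/Ai2|].
have [g1 bg1] := diagonalize (A i1).
have ag2 := anti_diag_anti bg1 (anticommuteJ g1 A12).
have [d bd Ad] := anti_normalize ag2.
have [y yE] : exists y : 'I_n -> SU2, forall i, y i = (A i ^ (g1 * d))%g.
  by exists (fun i => (A i ^ (g1 * d))%g).
have y1 : beta (y i1) = 0 by rewrite yE conjgM conj_diag_beta// bg1 mul0r.
have y2 : y i2 = SUj R by rewrite yE conjgM Ad.
have yC i j : eqpm (y i * y j)%g (y j * y i)%g by rewrite !yE -!conjMg; exact: eqpmJ.
have y1n : ~ eqpm (y i1) 1%g.
  by rewrite yE => /(@eqpmJ _ _ _ (g1 * d)^-1%g); rewrite conjgK conj1g => /Ai1.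
have ya1 : alpha (y i1) * alpha (y i1) = -1.
  have y12 : anticommute (y i1) (y i2) by rewrite !yE; exact: anticommuteJ.
  have E := anticommute_diag_conj y1 y12; apply: oppr_inj.
  by rewrite opprK -mulrN -E diag_norm.
(* Commuting up to sign with the diagonal entry makes an entry diagonal or antidiagonal; commuting
   up to sign with j makes its nonzero coordinate real or imaginary. *)
have yform i : exists l : 'I_4, eqpm (y i) (klein_letter l) /\
    (beta (y i) = 0 -> (l <= 1)%N).
  have := yC i i2; rewrite y2 => yj.
  have [yb|yb] := pm_commute_diag y1 y1n (yC i1 i).
    have [] := @unit_pm_conj (alpha (y i)) (diag_norm yb).
    - case: yj => /(congr1 (@beta R)); rewrite ?beta_m1M !abE yb alpha_j beta_j.
        by rewrite !(mulr1, mul0r, mul1r, addr0, add0r); left.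
      by rewrite !(mulr1, mul0r, mul1r, addr0, add0r); right.
    - move=> E; exists (@Ordinal 4 0 isT); split=> //; rewrite /klein_letter /=.
      apply: (eqpm_trans (eqpm_diag yb E)); left; apply: alpha_betaP.
        by rewrite alpha_diag ?one_norm// alpha1.
      by rewrite beta_diag ?one_norm// beta1.
    - move=> E; exists (@Ordinal 4 1 isT); split=> //; exact: (eqpm_diag yb E).
  have y0 : ~ beta (y i) = 0.
    by move=> E; have := anti_norm yb; rewrite E mul0r => /eqP; rewrite eq_sym oner_eq0.
  have [] := @unit_pm_conj (beta (y i)) (anti_norm yb).
  - case: yj => /(congr1 (@alpha R)); rewrite ?alpha_m1M !abE yb alpha_j beta_j conjE.
      rewrite !(mulr1, mul0r, mul1r, sub0r) => /oppr_inj; by left.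
    by rewrite !(mulr1, mul0r, mul1r, sub0r) opprK => E; right; rewrite -[LHS]opprK E.
  - by move=> E; exists (@Ordinal 4 2 isT); split=> //; exact: (eqpm_anti yb E).
  - by move=> E; exists (@Ordinal 4 3 isT); split=> //; exact: (eqpm_anti yb E).
have [c cP] := fin_all_exists yform.
exists c; last by exists (g1 * d)%g => i; rewrite -yE; have [] := cP i.
exists i1, i2; split.
- move=> i /i1min/contrapT/(@eqpmJ _ _ _ (g1 * d)%g); rewrite conj1g -yE => yi.
  have yb : beta (y i) = 0 by apply/(eqpm_beta0 yi); rewrite beta1.
  have [ci /(_ yb)] := cP i; rewrite leq_eqVlt ltnS leqn0 => /orP[|/eqP //].
  move=> /eqP c1; exfalso.
  move: (eqpm_trans (eqpm_sym ci) yi); rewrite /klein_letter c1 /=.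
  case=> /(congr1 (@alpha R)); rewrite ?alpha_m1M alpha_diag ?i_norm// alpha1 => /eqP.
    by apply/negP; apply: contra_eq_neq (sqrCi K) => ->; rewrite expr1n eq_sym eqNr oner_eq0.
  by apply/negP; apply: contra_eq_neq (sqrCi K) => ->; rewrite sqrrN expr1n eq_sym eqNr oner_eq0.
- have [ci /(_ y1)] := cP i1; rewrite leq_eqVlt ltnS leqn0 => /orP[/eqP //|].
  by move=> /eqP c0; exfalso; apply: y1n; move: ci; rewrite /klein_letter c0.
- move=> i /i2min/contrapT ci; have [_] := cP i; apply.
  by apply: (commute_diag y1 y1n); rewrite /commute !yE -!conjMg ci.
- have [ci _] := cP i2; move: ci; rewrite y2 /klein_letter.
  have j0 : ~ beta (SUj R) = 0 by rewrite beta_j => /eqP; rewrite oner_eq0.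
  case: (c i2) => [[|[|[|[|//]]]] ?] //= ci.
  + by exfalso; apply: j0; apply/(eqpm_beta0 ci); rewrite beta1.
  + by exfalso; apply: j0; apply/(eqpm_beta0 ci); rewrite beta_diag ?i_norm.
  + exfalso; case: ci => /(congr1 (@beta R)); rewrite ?beta_m1M beta_j beta_anti ?i_norm// => /esym/eqP.
      by apply/negP; apply: contra_eq_neq (sqrCi K) => ->; rewrite expr1n eq_sym eqNr oner_eq0.
    by apply/negP; apply: contra_eq_neq (sqrCi K) => E; rewrite -sqrrN E expr1n eq_sym eqNr oner_eq0.
Qed.

End NormalForms.

Section DihedralForms.
Variables (R : realType) (n p : nat).
Local Notation K := (cplx R).
Local Notation SU2 := (special_unitary R 2).
Local Notation q := p.+2.
Local Notation w := (dyadic_root K p.+2).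
Local Notation N := (2 ^ p.+1)%N.
Local Notation h := (2 ^ p)%N.
Implicit Types (b : bool) (m : 'I_N) (A B : 'I_n -> SU2) (x y g : SU2) (S : {set 'I_n}) (f : {ffun 'I_n -> 'I_N}).

Definition root_letter (b : bool) (m : 'I_N) : SU2 :=
  if b then su 0 (w ^+ m) else su (w ^+ m) 0.

Definition dihedral_tuple S f (i : 'I_n) : SU2 := root_letter (i \in S) (f i).

(** Excludes the exponents for which w^m is a fourth root of unity up to sign; the other rotations
    have order greater than 2 in PU(2). *)
Definition generic (m : 'I_N) := (m != 0 :> nat) && (m != h :> nat).

(* Conjugation by a diagonal matrix makes the first antidiagonal entry j; the
   remaining freedom, conjugation by j, negates f, and the second condition
   chooses between f and its negative. *)
Definition dihedral_canonical S f :=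
  (exists i0, [/\ i0 \in S, forall i : 'I_n, (i < i0)%N -> i \notin S & f i0 = 0 :> nat]) /\
  (exists i1, [/\ generic (f i1), (f i1 < h)%N &
                  forall i : 'I_n, (i < i1)%N -> ~~ generic (f i)]).

Lemma alpha_root_letter b m : alpha (root_letter b m) = if b then 0 else w ^+ m.
Proof.
by case: b; rewrite /root_letter ?alpha_anti ?alpha_diag//; exact: root_norm.
Qed.

Lemma beta_root_letter b m : beta (root_letter b m) = if b then w ^+ m else 0.
Proof.
by case: b; rewrite /root_letter ?beta_anti ?beta_diag//; exact: root_norm.
Qed.

Lemma eqpm_root_letter x b m : (if b then alpha x else beta x) = 0 ->
  pm_eq (if b then beta x else alpha x) (w ^+ m) -> eqpm x (root_letter b m).
Proof. by case: b => *; [exact: eqpm_anti|exact: eqpm_diag]. Qed.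

Lemma root_letter_j b m : eqpm (root_letter b m ^ SUj R)%g (root_letter b (negI m)).
Proof.
apply: eqpm_root_letter.
  by case: b; rewrite ?conj_j_alpha ?conj_j_beta ?alpha_root_letter ?beta_root_letter conjE.
by case: b; rewrite ?conj_j_alpha ?conj_j_beta ?alpha_root_letter ?beta_root_letter;
  exact: root_conj.
Qed.

Lemma negI_generic m : generic m -> generic (negI m).
Proof.
rewrite /generic /= => /andP[m0 mh]; rewrite modn_small; last by lia.
have := ltn_ord m; have := NE p; lia.
Qed.

Lemma negIK : involutive (@negI p).
Proof.
move=> m; apply: val_inj => /=; have [->|m0] := posnP m.
  by rewrite subn0 modnn subn0 modnn.
have mN := ltn_ord m; rewrite (@modn_small (N - m)); last by lia.
by rewrite subKn ?modn_small//; exact: ltnW.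
Qed.

Lemma negI_genericE m : generic (negI m) = generic m.
Proof. by apply/idP/idP => /negI_generic; rewrite ?negIK. Qed.

Lemma negI0 m : m = 0%N :> nat -> negI m = 0%N :> nat.
Proof. by move=> /= ->; rewrite subn0 modnn. Qed.

Lemma negI_lt m : generic m -> (negI m < h)%N = ~~ (m < h)%N.
Proof.
rewrite /generic /= => /andP[m0 mh]; rewrite modn_small; last by lia.
have := ltn_ord m; have := NE p; lia.
Qed.

Lemma dihedral_tuple_j S f :
  pm_conj (dihedral_tuple S f) (dihedral_tuple S [ffun i => negI (f i)]).
Proof. by exists (SUj R) => i; rewrite /dihedral_tuple ffunE; exact: root_letter_j. Qed.

Lemma root_letter_quarter b m : ~~ generic m -> quaternionic 0 (root_letter b m).
Proof.
move=> mg; have m4 : (w ^+ m) ^+ (2 ^ 2) = 1.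
  apply/pow_quarter; move: mg; rewrite negb_and !negbK => /orP[] /eqP ->; by [left|right].
by case: b; rewrite /quaternionic /mkset !(alpha_root_letter, beta_root_letter); [right|left].
Qed.

Lemma dihedral_exists A : nil_tuple q.+1 A -> noncommuting A -> ~ pm_commuting A ->
  exists S f, dihedral_canonical S f /\ pm_conj A (dihedral_tuple S f).
Proof.
move=> Aq Anc Apm; have phiM := free_evalM A.
have [g1 [form1 root1 [k0 k0A]]] := normalizer_form Aq Anc.
have [i0 i0A i0min] := @first_index _ (fun i => alpha (A i ^ g1)%g = 0) (ex_intro _ k0 k0A).
have [d bd Ad] := anti_normalize i0A.
pose g := (g1 * d)%g.
have form u : beta (free_eval A u ^ g)%g = 0 \/ alpha (free_eval A u ^ g)%g = 0.
  rewrite /g conjgM conj_diag_alpha// conj_diag_beta//.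
  by case: (form1 u) => ->; [left; rewrite mul0r|right].
have root u : beta (free_eval A u ^ g)%g = 0 -> alpha (free_eval A u ^ g)%g ^+ (2 ^ q) = 1.
  have [a0 a1] : alpha d * (alpha d)^* = 1 /\ (alpha d)^* != 0.
    have a1 := diag_norm bd; split=> //; apply: contra_eq_neq a1 => ->.
    by rewrite mulr0 eq_sym oner_eq0.
  rewrite /g conjgM conj_diag_alpha// conj_diag_beta// => /eqP.
  by rewrite !mulf_eq0 !(negbTE a1) !orbF => /eqP; exact: root1.
have [y yE] : exists y : 'I_n -> SU2, forall i, y i = (A i ^ g)%g.
  by exists (fun i => (A i ^ g)%g).
have y0 : y i0 = SUj R by rewrite yE /g conjgM.
have letters i : exists m : 'I_N, eqpm (y i) (root_letter (alpha (y i) == 0) m).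
  have yi := form (free_gen i); rewrite free_eval_gen -yE in yi.
  have [ya|ya] := eqVneq (alpha (y i)) 0.
    (* The bound on orders concerns diagonal values. For an antidiagonal entry it is applied to the
       quotient by the entry j, which is the value of another word. *)
    have uE : (free_eval A (free_gen i * (free_gen i0)^-1) ^ g = y i * (SUj R)^-1)%g.
      by rewrite phiM (morph_inv phiM) !free_eval_gen conjMg conjVg -!yE y0.
    have [] := @root_pow K p (beta (y i)).
      have := root (free_gen i * (free_gen i0)^-1)%g; rewrite uE !abE ya alpha_j beta_j !conjE.
      rewrite !(mul0r, mulr0, add0r, addr0, sub0r, mulrN, mulr1, opprK); exact.
    by move=> m ym; exists m; exact: eqpm_root_letter.
  have yb : beta (y i) = 0 by case: yi => // /eqP; rewrite (negbTE ya).
  have [] := @root_pow K p (alpha (y i)).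
    by have := root (free_gen i); rewrite free_eval_gen -yE; exact.
  by move=> m ym; exists m; exact: eqpm_root_letter.
have [f0 f0P] := fin_all_exists letters.
pose S : {set 'I_n} := [set i | alpha (y i) == 0]%SET.
pose f : {ffun 'I_n -> 'I_N} := [ffun i => f0 i].
have AS : pm_conj A (dihedral_tuple S f).
  exists g => i; rewrite -yE /dihedral_tuple ffunE inE; exact: f0P.
have S0 : exists i0, [/\ i0 \in S, forall i : 'I_n, (i < i0)%N -> i \notin S & f i0 = 0%N :> nat].
  exists i0; split; first by rewrite inE y0 alpha_j.
    move=> i /i0min Ai; rewrite inE; apply/eqP; rewrite yE /g conjgM conj_diag_alpha//.
  have := f0P i0; rewrite y0 alpha_j eqxx => j0.
  have -> : f i0 = Ordinal (N_gt0 p); last by [].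
  rewrite ffunE; apply: (@pow_inj K p); rewrite expr0.
  case: j0 => /(congr1 (@beta R)); rewrite ?beta_m1M beta_j beta_root_letter => E; [left|right] => //.
  by rewrite E opprK.
(* Otherwise all entries would lie in the quaternion group of order 8 and commute up to sign. *)
have [k1 k1g] : exists i, generic (f i).
  apply: contrapT => /forallNP ng; apply: Apm; apply: pm_conj_commuting (pm_conj_sym AS) _.
  have ng' i : ~~ generic (f i) by apply/negP; exact: ng.
  by move=> i j; apply: quarter_pm_commute; exact: root_letter_quarter.
have [i1 i1g i1min] := @first_index _ (fun i => generic (f i)) (ex_intro _ k1 k1g).
have [fh|fh] := boolP (f i1 < h)%N.
  exists S, f; split=> //; split; first exact: S0.
  by exists i1; split=> // i /i1min ng; apply/negP.
exists S, [ffun i => negI (f i)]; split; last exact: pm_conj_trans AS (dihedral_tuple_j _ _).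
split.
  have [i2 [iS i2min fi2]] := S0; exists i2; split=> //.
  by rewrite ffunE; exact: negI0.
exists i1; split.
- by rewrite ffunE negI_genericE.
- by rewrite ffunE negI_lt.
- by move=> i /i1min ng; rewrite ffunE negI_genericE; apply/negP.
Qed.

End DihedralForms.

(** * Uniqueness of normal forms and sign stabilizers *)

Section Stabilizers.
Variables (R : realType) (n : nat).
Local Notation K := (cplx R).
Local Notation SU2 := (special_unitary R 2).
Implicit Types (A B : 'I_n -> SU2) (x y g : SU2) (e : 'rV['Z_2]_n).

Definition pm_sign (a : 'Z_2) : SU2 := if a == 0 then 1%g else m1 R.

Lemma pm_sign_inj (a b : 'Z_2) x : (pm_sign a * x = pm_sign b * x)%g -> a = b.
Proof.
move=> /mulIg; rewrite /pm_sign; case: a b => [[|[|//]] ?] [[|[|//]] ?] //=.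
- by move=> _; exact: val_inj.
- by move/esym/m1_neq1.
- by move/m1_neq1.
- by move=> _; exact: val_inj.
Qed.

Definition sign_conj A e := exists g, forall i, (A i ^ g = pm_sign (e 0%R i) * A i)%g.

(** Agrees with [sign_stab] once the components are known to be conjugation orbits; in this form it
    is computed from the tuple alone. *)
Definition sign_group A : {set 'rV['Z_2]_n} := [set e | `[< sign_conj A e >]]%SET.

Lemma sign_groupP A e : reflect (sign_conj A e) (e \in sign_group A).
Proof. by rewrite inE; exact: asboolP. Qed.

(** Signs that agree at two non-commuting positions come from conjugators whose quotient commutes
    with both entries, hence is a scalar. So two coordinates determine e, and the group has at most
    4 elements. *)
Lemma sign_group_card_le A (i1 i2 : 'I_n) : ~ commute (A i1) (A i2) ->
  {in sign_group A &, injective (fun e : 'rV['Z_2]_n => (e 0 i1, e 0 i2))}.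
Proof.
move=> A12 e e' /sign_groupP[g gA] /sign_groupP[g' g'A] [e1 e2].
have fix_comm i : e 0 i = e' 0 i -> commute (g * g'^-1)%g (A i).
  move=> ei; apply/commute_sym/commgP; rewrite -conjg_fix conjgM gA ei -g'A conjgK//.
have gg := commute_scalar (fix_comm _ e1) (fix_comm _ e2) A12.
apply/rowP => i; apply: (@pm_sign_inj _ _ (A i)); rewrite -gA -g'A.
have -> : g = ((g * g'^-1) * g')%g by rewrite mulgVK.
by case: gg => ->; rewrite ?mulg1 ?mul1g// conjgM (_ : (A i ^ m1 R)%g = A i)//;
  apply/conjg_fixP/commgP/commute_sym/m1C.
Qed.

Lemma sign_conj_of_pm A g : (forall i, eqpm (A i ^ g)%g (A i)) ->
  exists2 e, sign_conj A e & forall i, (A i ^ g = pm_sign (e 0%R i) * A i)%g.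
Proof.
move=> gA; pose e : 'rV['Z_2]_n := \row_i (if (A i ^ g)%g == A i then 0 else 1).
have eE i : (A i ^ g = pm_sign (e 0%R i) * A i)%g.
  rewrite /e mxE; case: eqP => [-> |]; first by rewrite /pm_sign eqxx mul1g.
  by case: (gA i).
by exists e => //; exists g.
Qed.

Lemma pm_sign_commute e (i : 'I_n) x g : (x ^ g = pm_sign (e 0%R i) * x)%g ->
  commute x g -> e 0 i = 0.
Proof.
move=> E xg; apply: (@pm_sign_inj _ _ x); rewrite -E /pm_sign eqxx mul1g.
by apply/conjg_fixP/commgP.
Qed.

Lemma pm_sign_anticommute e (i : 'I_n) x g : (x ^ g = pm_sign (e 0%R i) * x)%g ->
  anticommute x g -> e 0 i = 1.
Proof.
move=> E xg; apply: (@pm_sign_inj _ _ x); rewrite -E /pm_sign /= conjgE xg.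
by rewrite mulgA -(m1C (g^-1)%g) -mulgA mulKg.
Qed.

Lemma anticommuteMl x y : anticommute x y -> anticommute x (x * y)%g.
Proof.
by rewrite /anticommute => xy; rewrite {1}xy (mulgA x (m1 R)) -(m1C x) -!mulgA.
Qed.

Lemma anticommuteMr x y : anticommute x y -> anticommute y (x * y)%g.
Proof.
by rewrite /anticommute => xy; rewrite {2}xy !mulgA m1M mul1g.
Qed.

End Stabilizers.

Section KleinUniqueness.
Variables (R : realType) (n : nat).
Local Notation K := (cplx R).
Local Notation SU2 := (special_unitary R 2).
Implicit Types (c : 'I_n -> 'I_4) (x y g : SU2).
Local Notation letter := (@klein_letter R).

Lemma klein_letter_quaternionic p l : quaternionic p (letter l).
Proof.
have i4 : ('i : K) ^+ (2 ^ p.+2) = 1.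
  by rewrite -(addn2 p) expnD mulnC exprM -[(2 ^ 2)%N]/(2 * 2)%N exprM sqrCi sqrrN !expr1n.
case: l => [[|[|[|[|//]]]] lt4]; rewrite /klein_letter /=.
- by have [] := quaternionic_subgroup R p.
- by left; rewrite beta_diag ?alpha_diag ?i_norm.
- by right; rewrite alpha_j beta_j expr1n.
- by right; rewrite beta_anti ?alpha_anti ?i_norm.
Qed.

Lemma klein_pm_commuting c : pm_commuting (letter \o c).
Proof.
by move=> i j; apply: quarter_pm_commute; exact: klein_letter_quaternionic.
Qed.

Lemma klein_letter_inj l l' : eqpm (letter l) (letter l') -> l = l'.
Proof.
(* Unchanged by a sign, with the values 1, -1, 2, -2 on the four letters. *)
pose inv x : K := alpha x ^+ 2 + 2%:R * beta x ^+ 2.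
have invE x y : eqpm x y -> inv x = inv y.
  by case=> -> //; rewrite /inv alpha_m1M beta_m1M !sqrrN.
pose k (m : 'I_4) : int := nth 0 [:: 1; -1; 2%:Z; - 2%:Z] m.
have kE m : inv (letter m) = (k m)%:~R.
  rewrite /inv /k /klein_letter; case: m => [[|[|[|[|//]]]] ?] /=.
  - by rewrite alpha1 beta1 expr1n expr0n mulr0 addr0.
  - by rewrite alpha_diag ?beta_diag ?i_norm// sqrCi expr0n mulr0 addr0.
  - by rewrite alpha_j beta_j expr1n expr0n mulr1 add0r.
  - by rewrite alpha_anti ?beta_anti ?i_norm// sqrCi expr0n mulrN1 add0r mulrNz.
move=> /invE; rewrite !kE => /intr_inj; rewrite /k => E; apply: val_inj; move: E.
by case: l l' => [[|[|[|[|//]]]] ?] [[|[|[|[|//]]]] ?].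
Qed.

Lemma klein_noncommuting_pair c : klein_canonical c ->
  exists i1 i2, [/\ c i1 = 1%N :> nat, c i2 = 2%N :> nat,
    anticommute (letter (c i1)) (letter (c i2)) & ~ commute (letter (c i1)) (letter (c i2))].
Proof.
move=> [i1 [i2 [_ c1 _ c2]]]; exists i1, i2.
have nc : ~ commute (letter (c i1)) (letter (c i2)).
  move=> E; have := commute_diag _ _ E.
  rewrite /klein_letter c1 c2 /= beta_diag ?i_norm// beta_j => /(_ erefl) b0.
  have /b0/eqP : ~ eqpm (su 'i 0 : SU2) 1%g; last by rewrite oner_eq0.
  by move=> /(@klein_letter_inj (@Ordinal 4 1 isT) (@Ordinal 4 0 isT)).
by split=> //; have [|] := klein_pm_commuting c i1 i2.
Qed.

(** Conjugation preserves which letters are trivial and which pairs of letters agree; a canonical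
    word can be read off from this pattern. *)
Lemma klein_unique c c' : klein_canonical c -> klein_canonical c' ->
  pm_conj (letter \o c) (letter \o c') -> c =1 c'.
Proof.
move=> cP cP' [g gc].
have pat i j : (c i == c j) = (c' i == c' j).
  apply/eqP/eqP => E; apply: klein_letter_inj.
    by apply: eqpm_trans (eqpm_sym (gc i)) _; rewrite /= E; exact: gc.
  have := eqpm_trans (gc i) (eqpm_trans _ (eqpm_sym (gc j))).
  rewrite /= E => /(_ (eqpm_refl _)) /(eqpmJ (g^-1)%g); rewrite !conjgK; exact.
have pat0 i : (c i == 0 :> nat) = (c' i == 0 :> nat).
  apply/eqP/eqP => E.
    have ci : c i = @Ordinal 4 0 isT by exact: val_inj.
    have := gc i; rewrite /= ci conj1g => /eqpm_sym/(@klein_letter_inj (c' i) (@Ordinal 4 0 isT)).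
    by move=> ->.
  have ci : c' i = @Ordinal 4 0 isT by exact: val_inj.
  have := eqpmJ (g^-1)%g (gc i); rewrite conjgK /= ci conj1g.
  by move=> /(@klein_letter_inj (c i) (@Ordinal 4 0 isT)) ->.
have ord4 (a b : 'I_4) : (a == b) = (a == b :> nat) by [].
move: cP cP' => [i1 [i2 [lt1 c1 lt2 c2]]] [j1 [j2 [lt1' c1' lt2' c2']]].
have E1 : i1 = j1.
  apply/val_inj; case: (ltngtP i1 j1) => // [/lt1' |/lt1] /eqP.
    by rewrite -pat0 c1.
  by rewrite pat0 c1'.
subst j1.
have E2 : i2 = j2.
  apply/val_inj; case: (ltngtP i2 j2) => // [/lt2'|/lt2].
    move=> le1; have : (c' i2 == 0 :> nat) || (c' i2 == c' i1) by rewrite ord4 c1'; lia.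
    by rewrite -pat0 -pat ord4 c2 c1.
  move=> le1; have : (c j2 == 0 :> nat) || (c j2 == c i1) by rewrite ord4 c1; lia.
  by rewrite pat0 pat ord4 c2' c1'.
subst j2.
move=> i; apply/val_inj.
have := pat0 i; have := pat i i1; have := pat i i2; rewrite !ord4 c1 c2 c1' c2'.
by case: (c i) (c' i) => [[|[|[|[|//]]]] ?] [[|[|[|[|//]]]] ?].
Qed.

(** The coordinates of e at two non-commuting positions bound the order by 4; conjugation by 1, by
    either entry and by their product realizes all four patterns there. *)
Lemma klein_sign_group c : klein_canonical c -> #|sign_group (letter \o c)| = 4.
Proof.
move=> cP; have [i1 [i2 [c1 c2 a12 n12]]] := klein_noncommuting_pair cP.
pose A : 'I_n -> SU2 := letter \o c.
have inj := @sign_group_card_le R n A i1 i2 n12.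
rewrite -(card_in_imset inj).
have -> : [set ((e : 'rV['Z_2]_n) 0 i1, e 0 i2) | e in sign_group A]%SET = [set: 'Z_2 * 'Z_2]%SET.
  apply/setP => -[a b]; rewrite inE; apply/imsetP.
  have stab g (gQ : quaternionic 0 g) : exists2 e, e \in sign_group A &
      forall i, (A i ^ g = pm_sign R (e 0%R i) * A i)%g.
    have [i|e eS eE] := @sign_conj_of_pm R n A g.
      have [E|E] := quarter_pm_commute (klein_letter_quaternionic 0 (c i)) gQ.
        by left; apply/conjg_fixP/commgP.
      by right; rewrite conjgE /A /= E mulgA -(m1C (g^-1)%g) -mulgA mulKg.
    by exists e => //; apply/sign_groupP.
  have Q1 : quaternionic 0 (1%g : SU2) by have [] := quaternionic_subgroup R 0.
  have QA i : quaternionic 0 (A i) by exact: klein_letter_quaternionic.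
  have QM : quaternionic 0 (A i1 * A i2)%g.
    by have [_ QM _] := quaternionic_subgroup R 0; exact: QM.
  case: a b => [[|[|//]] alt] [[|[|//]] blt].
  - have [e eS eE] := stab _ Q1; exists e => //.
    rewrite (pm_sign_commute (eE i1) (commute1 _)) (pm_sign_commute (eE i2) (commute1 _)).
    by congr pair; exact: val_inj.
  - have [e eS eE] := stab _ (QA i1); exists e => //.
    rewrite (pm_sign_commute (eE i1) (commute_refl _)).
    rewrite (pm_sign_anticommute (eE i2) (commute_sym_anti a12)).
    by congr pair; exact: val_inj.
  - have [e eS eE] := stab _ (QA i2); exists e => //.
    rewrite (pm_sign_anticommute (eE i1) a12) (pm_sign_commute (eE i2) (commute_refl _)).
    by congr pair; exact: val_inj.
  - have [e eS eE] := stab _ QM; exists e => //.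
    rewrite (pm_sign_anticommute (eE i1) (anticommuteMl a12)).
    rewrite (pm_sign_anticommute (eE i2) (anticommuteMr a12)).
    by congr pair; exact: val_inj.
by rewrite cardsT card_prod !card_ord.
Qed.

End KleinUniqueness.

Section DihedralUniqueness.
Variables (R : realType) (n p : nat).
Local Notation K := (cplx R).
Local Notation SU2 := (special_unitary R 2).
Local Notation q := p.+2.
Local Notation w := (dyadic_root K p.+2).
Local Notation N := (2 ^ p.+1)%N.
Local Notation h := (2 ^ p)%N.
Implicit Types (b : bool) (m : 'I_N) (x y g : SU2) (S : {set 'I_n}) (f : {ffun 'I_n -> 'I_N}).
Local Notation tuple := (@dihedral_tuple R n p).
Local Notation letter := (@root_letter R p).

Lemma root_letter_quaternionic b m : quaternionic p (letter b m).
Proof.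
have m1 : (w ^+ m) ^+ (2 ^ q) = 1.
  by rewrite -exprM mulnC exprM (prim_expr_order (dyadic_root_prim K p.+1)) expr1n.
by case: b; rewrite /quaternionic /mkset !(alpha_root_letter, beta_root_letter); [right|left].
Qed.

Lemma generic_quarter m : generic m -> (w ^+ m) ^+ 4 <> 1.
Proof. by rewrite /generic => /andP[m0 mh] /pow_quarter[] /eqP; [exact/negP|exact/negP]. Qed.

Lemma tuple_i0 S f i0 : i0 \in S -> f i0 = 0%N :> nat -> tuple S f i0 = SUj R.
Proof.
move=> iS f0; rewrite /dihedral_tuple iS; apply: alpha_betaP.
  by rewrite alpha_root_letter alpha_j.
by rewrite beta_root_letter f0 expr0 beta_j.
Qed.

Lemma anti_square x : alpha x = 0 -> (x * x = m1 R)%g.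
Proof.
move=> x0; apply: alpha_betaP; rewrite !abE x0 ?alpha_m1 ?beta_m1 ?conjE.
  by rewrite mul0r sub0r anti_norm.
by rewrite mul0r mulr0 addr0.
Qed.

Lemma normalizer_of_generic S f S' f' g : dihedral_canonical S f ->
  (forall i, eqpm (tuple S f i ^ g)%g (tuple S' f' i)) ->
  beta g = 0 \/ alpha g = 0.
Proof.
move=> [[i0 [iS _ f0]] [i1 [i1g _ _]]] gT.
(* Applied to the tuple of S and f, this is the rotation by the generic angle. *)
pose rot (A : 'I_n -> SU2) : SU2 := if i1 \in S then (A i1 * (A i0)^-1)%g else A i1.
have rot_diag : beta (rot (tuple S f)) = 0 /\ alpha (rot (tuple S f)) = w ^+ f i1.
  rewrite /rot (tuple_i0 iS f0) /dihedral_tuple; case: ifP => i1S; rewrite ?i1S.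
    rewrite !abE alpha_root_letter beta_root_letter alpha_j beta_j !conjE.
    by rewrite !(mul0r, mulr0, add0r, addr0, sub0r, mulrN, mulr1, opprK).
  by rewrite alpha_root_letter beta_root_letter.
have rot_g : eqpm (rot (tuple S f) ^ g)%g (rot (tuple S' f')).
  rewrite /rot; case: ifP => i1S; last exact: gT.
  rewrite conjMg conjVg; apply: eqpmM; first exact: gT.
  exact/eqpmV/gT.
have rot_Q : quaternionic p (rot (tuple S' f')).
  have [_ QM QV] := quaternionic_subgroup R p.
  rewrite /rot; case: ifP => i1S; last exact: root_letter_quaternionic.
  by apply: QM; last apply: QV; exact: root_letter_quaternionic.
move: (rot (tuple S f)) (rot (tuple S' f')) rot_diag rot_g rot_Q => x y [xb xa] xy yQ.
have x4 := generic_quarter i1g.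
(* An antidiagonal y would have square -1, hence so would x, and [alpha x] would be a fourth root of
   unity. *)
have yb : beta y = 0.
  case: yQ => [[]//|[ya _]]; exfalso; apply: x4; rewrite -xa.
  have x2 : (x * x = m1 R)%g.
    apply: (@conjg_inj _ g); rewrite conjMg m1J.
    by apply: anti_square; apply/(eqpm_alpha0 xy).
  have := congr1 (@alpha R) x2; rewrite abE xb mul0r subr0 alpha_m1 => E.
  by rewrite (exprM _ 2 2) !expr2 E mulrNN mulr1.
(* The vanishing off-diagonal entry is a product of the two coordinates of g, one of them
   conjugated, and of the difference of [alpha x] and its conjugate; genericity makes this last
   factor nonzero. *)
have := (eqpm_beta0 xy).2 yb; rewrite conjgE !abE xb !conjE.
rewrite !(mul0r, addr0, subr0, sub0r) => E.
have /eqP : (alpha g)^* * beta g * (alpha x - (alpha x)^* ) = 0 by rewrite -[RHS]E; ring.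
rewrite !mulf_eq0 => /orP[/orP[|]/eqP|].
- by move=> a0; right; rewrite -[alpha g]conjCK a0 conjE.
- by left.
- rewrite subr_eq0 => /eqP xx; exfalso; apply: x4; rewrite -xa (exprM _ 2 2) !expr2.
  by rewrite {2 4}xx (diag_norm xb) mulr1.
Qed.

Lemma canonical_i0_unique S f i0 i0' :
  i0 \in S -> (forall i : 'I_n, (i < i0)%N -> i \notin S) ->
  i0' \in S -> (forall i : 'I_n, (i < i0')%N -> i \notin S) -> i0 = i0'.
Proof.
move=> iS i0min iS' i0min'; apply/val_inj; case: (ltngtP i0 i0') => //.
  by move=> /i0min'; rewrite iS.
by move=> /i0min; rewrite iS'.
Qed.

Lemma pm_eq_trans (a b c : K) : pm_eq a b -> pm_eq b c -> pm_eq a c.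
Proof. by case=> -> [] ->; rewrite ?opprK; [left|right|right|left]. Qed.

Lemma pm_eq_sym (a b : K) : pm_eq a b -> pm_eq b a.
Proof. by case=> ->; rewrite ?opprK; [left|right; rewrite opprK]. Qed.

Lemma eqpm_alpha x y : eqpm x y -> pm_eq (alpha x) (alpha y).
Proof. by case=> ->; [left|right; rewrite alpha_m1M]. Qed.

Lemma eqpm_beta x y : eqpm x y -> pm_eq (beta x) (beta y).
Proof. by case=> ->; [left|right; rewrite beta_m1M]. Qed.

Lemma pm_eqMl (a b c : K) : pm_eq a 1 -> pm_eq (b * a) c -> pm_eq b c.
Proof.
case=> ->; first by rewrite mulr1.
rewrite mulrN1 => -[E|/oppr_inj E]; last by left.
by right; rewrite -E opprK.
Qed.

Lemma anti_conj x g : alpha g = 0 -> alpha (x ^ g)%g = (alpha x)^* /\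
  beta (x ^ g)%g = (beta x)^* * (beta g * beta g).
Proof.
move=> ag; rewrite conjgE !abE ag !conjE; split; last by ring.
by rewrite -[RHS]mul1r -(anti_norm ag); ring.
Qed.

(** A diagonal g fixes the diagonal entries and multiplies the antidiagonal ones by a constant,
    which is 1 or -1 because both tuples have the entry j at i0. An antidiagonal g would negate f,
    against the choice of the first generic exponent below h in both tuples. *)
Lemma dihedral_conj S f S' f' g :
  dihedral_canonical S f -> dihedral_canonical S' f' ->
  (forall i, eqpm (tuple S f i ^ g)%g (tuple S' f' i)) ->
  [/\ S = S', f = f' & beta g = 0].
Proof.
move=> cP cP' gT; have gN := normalizer_of_generic cP gT.
have w0 m : w ^+ m != 0 by apply: unit_neq0; exact: root_norm.
have SE : S = S'.
  apply/setP => i; have := eqpm_alpha0 (gT i).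
  rewrite /dihedral_tuple alpha_root_letter.
  have -> : (alpha (letter (i \in S) (f i) ^ g)%g = 0) <-> (i \in S).
    case: gN => g0.
      rewrite conj_diag_alpha// alpha_root_letter; case: (i \in S) => //.
      by split=> // /eqP; rewrite (negbTE (w0 _)).
    have [-> _] := anti_conj (letter (i \in S) (f i)) g0.
    rewrite alpha_root_letter; case: (i \in S); first by rewrite conjE.
    by split=> // /eqP; rewrite conjC_eq0 (negbTE (w0 _)).
  case: (i \in S'); case: (i \in S) => // -[E1 E2].
    by have := E2 erefl.
  by have /eqP := E1 isT; rewrite (negbTE (w0 _)).
subst S'.
have [[i0 [iS i0min f0]] [i1 [i1g i1h i1min]]] := cP.
have [[i0' [iS' i0min' f0']] [i1' [i1g' i1h' i1min']]] := cP'.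
have ii0 := canonical_i0_unique f iS i0min iS' i0min'; subst i0'.
have gj := gT i0; rewrite (tuple_i0 iS f0) (tuple_i0 iS f0') in gj.
case: gN => g0.
  split=> //; apply/ffunP => i; apply: (@pow_inj K p).
  have := gT i; rewrite /dihedral_tuple => gi.
  have aa : pm_eq ((alpha g)^* * (alpha g)^* ) 1.
    by have := eqpm_beta gj; rewrite conj_diag_beta// beta_j mul1r.
  case: (i \in S) gi => gi.
    have := eqpm_beta gi; rewrite conj_diag_beta// !beta_root_letter.
    exact: pm_eqMl.
  by have := eqpm_alpha gi; rewrite conj_diag_alpha// !alpha_root_letter.
exfalso.
have bb : pm_eq (beta g * beta g) 1.
  by have := eqpm_beta gj; have [_ ->] := anti_conj (SUj R) g0; rewrite beta_j conjE mul1r.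
have fN i : negI (f i) = f' i.
  apply: (@pow_inj K p); apply: (pm_eq_trans (pm_eq_sym (root_conj K (f i)))).
  have gi := gT i; rewrite /dihedral_tuple in gi.
  have [Ea Eb] := anti_conj (letter (i \in S) (f i)) g0.
  case: (i \in S) gi Ea Eb => gi Ea Eb.
    have := eqpm_beta gi; rewrite Eb !beta_root_letter; exact: pm_eqMl.
  by have := eqpm_alpha gi; rewrite Ea !alpha_root_letter.
have ii1 : i1 = i1'.
  apply/val_inj; case: (ltngtP i1 i1') => //.
    by move=> /i1min'; rewrite -fN negI_genericE i1g.
  by move=> /i1min; rewrite -negI_genericE fN i1g'.
by subst i1'; move: i1h'; rewrite -fN negI_lt// i1h.
Qed.

Lemma dihedral_unique S f S' f' :
  dihedral_canonical S f -> dihedral_canonical S' f' ->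
  pm_conj (tuple S f) (tuple S' f') -> S = S' /\ f = f'.
Proof. by move=> cP cP' [g gT]; have [] := dihedral_conj cP cP' gT. Qed.

(** Commuting up to sign with j would make a generic w^m real or imaginary. This keeps the two
    families disjoint. *)
Lemma dihedral_not_pm_commuting S f : dihedral_canonical S f -> ~ pm_commuting (tuple S f).
Proof.
move=> [[i0 [iS _ f0]] [i1 [i1g _ _]]] /(_ i1 i0).
rewrite (tuple_i0 iS f0) /dihedral_tuple => E; apply: (generic_quarter i1g).
have pmE : pm_eq (w ^+ f i1) (w ^+ f i1)^*.
  case: (i1 \in S) E => E.
    have := eqpm_alpha E; rewrite !abE alpha_root_letter beta_root_letter alpha_j beta_j !conjE.
    by rewrite !(mul0r, mulr0, mul1r, mulr1, sub0r) => -[] /oppr_inj; [left|right].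
  have := eqpm_beta E; rewrite !abE alpha_root_letter beta_root_letter alpha_j beta_j !conjE.
  by rewrite !(mul0r, mulr0, mul1r, mulr1, add0r, addr0).
have ww : pm_eq (w ^+ f i1 * w ^+ f i1) 1.
  by case: pmE => E1; [left|right]; rewrite {2}E1 ?mulrN root_norm.
by rewrite (exprM _ 2 2) !expr2; case: ww => ->; rewrite ?mulrNN mulr1.
Qed.

(** Conjugators are diagonal, so they fix the entries outside S and give those in S a common sign;
    the nontrivial sign is realized by i. *)
Lemma dihedral_sign_group S f : dihedral_canonical S f -> #|sign_group (tuple S f)| = 2.
Proof.
move=> cP; have [[i0 [iS i0min f0]] [i1 [i1g _ _]]] := cP.
pose eS : 'rV['Z_2]_n := \row_i (if i \in S then 1 else 0).
have -> : sign_group (tuple S f) = [set 0%R; eS]%SET.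
  apply/setP => e; rewrite !inE; apply/asboolP/orP.
    move=> [g gT].
    have gpm i : eqpm (tuple S f i ^ g)%g (tuple S f i).
      by rewrite gT /pm_sign; case: eqP => _; [left; rewrite mul1g|right].
    have [_ _ g0] := dihedral_conj cP cP gpm.
    have en i : i \notin S -> e 0 i = 0.
      move=> iS'; apply: (pm_sign_commute (gT i)); apply: diag_commute => //.
      by rewrite /dihedral_tuple beta_root_letter (negbTE iS').
    have aa : pm_eq ((alpha g)^* * (alpha g)^* ) 1.
      by have := eqpm_beta (gpm i0); rewrite (tuple_i0 iS f0) conj_diag_beta// beta_j mul1r.
    have eI i : i \in S -> pm_sign R (e 0 i) =
        if (alpha g)^* * (alpha g)^* == 1 then 1%g else m1 R.
      move=> iS'; apply: (@mulIg _ (tuple S f i)); rewrite -gT.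
      have ai : alpha (tuple S f i) = 0 by rewrite /dihedral_tuple iS' alpha_root_letter.
      apply: alpha_betaP; rewrite ?conj_diag_alpha ?conj_diag_beta//.
        by case: ifP => _; rewrite ?mul1g ?alpha_m1M ?ai ?oppr0.
      case: eqP => [->|a1]; first by rewrite mul1g mulr1.
      by case: aa => // ->; rewrite beta_m1M mulrN1.
    move: eI; case: ifP => _ eI; [left|right]; apply/eqP/rowP => i; rewrite mxE.
      have [iS'|/en //] := boolP (i \in S).
      by have := eI i iS'; rewrite /pm_sign; case: eqP => // _ /m1_neq1.
    case: ifPn => [iS'|/en //].
    have := eI i iS'; rewrite /pm_sign; case: eqP => [_ /esym/m1_neq1 //|].
    by case: (e 0 i) => [[|[|//]] lt2] ne _; [case: ne|]; exact: val_inj.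
  case=> /eqP ->.
    by exists 1%g => i; rewrite conjg1 mxE /pm_sign eqxx mul1g.
  exists (su 'i 0) => i; rewrite mxE /dihedral_tuple.
  have b0 : beta (su 'i 0 : SU2) = 0 by rewrite beta_diag ?i_norm.
  have a0 : (alpha (su 'i 0 : SU2))^* * (alpha (su 'i 0 : SU2))^* = -1.
    by rewrite alpha_diag ?i_norm// conjCi mulrNN -expr2 sqrCi.
  have -> : pm_sign R (if i \in S then 1 else 0) = if i \in S then m1 R else 1%g.
    by case: (i \in S).
  apply: alpha_betaP; rewrite ?conj_diag_alpha ?conj_diag_beta// ?a0;
    case: (i \in S); rewrite ?mul1g ?alpha_m1M ?beta_m1M
      ?alpha_root_letter ?beta_root_letter ?mulrN1 ?oppr0 ?mul0r//.
rewrite cards2; suff -> : (0 != eS) by [].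
apply/eqP => /rowP/(_ i0); rewrite !mxE iS => /eqP.
by [].
Qed.

End DihedralUniqueness.

(** * Counting normal forms *)

Section KleinCount.
Local Open Scope nat_scope.

Local Notation o k := (@Ordinal 4 k isT).

Definition all_words n : seq (seq 'I_4) := [seq val t | t <- enum {: n.-tuple 'I_4}].

(* What may follow the first letter 1 of a canonical word. *)
Fixpoint klein_tails n : seq (seq 'I_4) :=
  if n is n'.+1 then
    [seq o 0 :: u | u <- klein_tails n'] ++ [seq o 1 :: u | u <- klein_tails n'] ++
    [seq o 2 :: u | u <- all_words n']
  else [::].

Fixpoint klein_words n : seq (seq 'I_4) :=
  if n is n'.+1 then
    [seq o 0 :: u | u <- klein_words n'] ++ [seq o 1 :: u | u <- klein_tails n']
  else [::].

Lemma mem_all_words n u : (u \in all_words n) = (size u == n).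
Proof.
apply/mapP/eqP => [[t _ ->]|un]; first exact: size_tuple.
by exists (Tuple (introT eqP un)); rewrite ?mem_enum.
Qed.

Lemma size_all_words n : size (all_words n) = 4 ^ n.
Proof. by rewrite size_map -cardE card_tuple card_ord. Qed.

Lemma uniq_all_words n : uniq (all_words n).
Proof. by rewrite map_inj_uniq ?enum_uniq//; exact: val_inj. Qed.

Lemma mem_cons_map (a b : 'I_4) u (s : seq (seq 'I_4)) :
  (a :: u \in [seq b :: v | v <- s]) = (a == b) && (u \in s).
Proof.
apply/mapP/andP => [[v vs [-> ->]]|[/eqP -> us]]; first by rewrite eqxx.
by exists u.
Qed.

Lemma nil_cons_map (b : 'I_4) (s : seq (seq 'I_4)) : ([::] \in [seq b :: v | v <- s]) = false.
Proof. by apply/mapP => -[]. Qed.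

Lemma mem_klein_tails n u : reflect
  (size u = n /\ exists i2, [/\ i2 < n, forall i, i < i2 -> nth (o 0) u i <= 1
                             & nth (o 0) u i2 = 2 :> nat])
  (u \in klein_tails n).
Proof.
elim: n u => [|n IHn] u /=; first by apply: (iffP idP) => // -[_ [i2 []]].
rewrite !mem_cat; case: u => [|a u]; first by rewrite !nil_cons_map; constructor => -[].
rewrite !mem_cons_map mem_all_words; apply: (iffP or3P).
  case=> /andP[/eqP -> H]; last first.
    by split; [rewrite /= (eqP H)|exists 0].
  - have [un [i2 [i2n lt2 e2]]] := IHn _ H.
    by split; [rewrite /= un|exists i2.+1; split=> // -[|i] //; exact: lt2].
  - have [un [i2 [i2n lt2 e2]]] := IHn _ H.
    by split; [rewrite /= un|exists i2.+1; split=> // -[|i] //; exact: lt2].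
move=> [[un] [[|i2] [i2n lt2 e2]]].
  by constructor 3; rewrite un eqxx andbT; apply/eqP/val_inj.
have ut : u \in klein_tails n.
  by apply/IHn; split=> //; exists i2; split=> // i ii; exact: (lt2 i.+1).
have := lt2 0 isT; rewrite /= ut !andbT leq_eqVlt ltnS leqn0 => /orP[] /eqP a0.
  by constructor 2; apply/eqP/val_inj.
by constructor 1; apply/eqP/val_inj.
Qed.

Lemma mem_klein_words n u : reflect
  (size u = n /\ exists i1 i2, [/\ i1 < n, i2 < n, forall i, i < i1 -> nth (o 0) u i = 0 :> nat,
     nth (o 0) u i1 = 1 :> nat &
     (forall i, i < i2 -> nth (o 0) u i <= 1) /\ nth (o 0) u i2 = 2 :> nat])
  (u \in klein_words n).
Proof.
elim: n u => [|n IHn] u /=; first by apply: (iffP idP) => // -[_ [i1 [i2 []]]].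
rewrite !mem_cat; case: u => [|a u]; first by rewrite !nil_cons_map; constructor => -[].
rewrite !mem_cons_map; apply: (iffP orP).
  case=> /andP[/eqP -> H].
    have [un [i1 [i2 [i1n i2n lt1 e1 [lt2 e2]]]]] := IHn _ H.
    split; first by rewrite /= un.
    exists i1.+1, i2.+1; split=> //; first by move=> [|i] //; exact: lt1.
    by split=> // -[|i] //; exact: lt2.
  have [un [i2 [i2n lt2 e2]]] := mem_klein_tails _ _ H.
  split; first by rewrite /= un.
  by exists 0, i2.+1; split=> //; split=> // -[|i] //; exact: lt2.
move=> [[un] [i1 [[|i2] [i1n i2n lt1 e1 [lt2 e2]]]]].
  by case: i1 i1n lt1 e1 => [|i1] _ lt1; rewrite ?e2// => _; have := lt1 0 isT; rewrite e2.
case: i1 i1n lt1 e1 => [|i1] i1n lt1 e1.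
  right; apply/andP; split; first exact/eqP/val_inj.
  by apply/mem_klein_tails; split=> //; exists i2; split=> // i ii; exact: (lt2 i.+1).
left; apply/andP; split; first by apply/eqP/val_inj; exact: (lt1 0).
apply/IHn; split=> //; exists i1, i2; split=> //; first by move=> i ii; exact: (lt1 i.+1).
by split=> // i ii; exact: (lt2 i.+1).
Qed.

Lemma cons_map_disjoint (a b : 'I_4) (s t : seq (seq 'I_4)) : a != b ->
  ~~ has (mem [seq a :: u | u <- s]) [seq b :: u | u <- t].
Proof.
move=> ab; apply/hasPn => _ /mapP[u _ ->]; rewrite inE mem_cons_map.
by rewrite eq_sym (negbTE ab).
Qed.

Lemma uniq_cons_map (a : 'I_4) (s : seq (seq 'I_4)) : uniq [seq a :: u | u <- s] = uniq s.
Proof. by rewrite map_inj_uniq// => u v []. Qed.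

Lemma uniq_klein_tails n : uniq (klein_tails n).
Proof.
elim: n => //= n IHn; rewrite !cat_uniq !uniq_cons_map IHn uniq_all_words.
by rewrite has_cat negb_or !cons_map_disjoint.
Qed.

Lemma uniq_klein_words n : uniq (klein_words n).
Proof.
elim: n => //= n IHn; rewrite !cat_uniq !uniq_cons_map IHn uniq_klein_tails.
by rewrite cons_map_disjoint.
Qed.

(** Of the 4^n - 2^n words with some letter 2 or 3, exchanging these letters shows that half have 2
    as the first such letter. *)
Lemma size_klein_tails n : 2 * size (klein_tails n) + 2 ^ n = 4 ^ n.
Proof.
elim: n => //= n IHn; rewrite !size_cat 3!size_map size_all_words !expnS.
lia.
Qed.

(** Removing the trivial word and the 3 (2^n - 1) words with a single kind of nontrivial letter
    leaves 4^n - 3 * 2^n + 2 words, on which the six permutations of the nontrivial letters act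
    freely. *)
Lemma size_klein_wordsE n : 6 * size (klein_words n) + 3 * 2 ^ n = 4 ^ n + 2.
Proof.
elim: n => //= n IHn; rewrite !size_cat !size_map !expnS.
have := size_klein_tails n; lia.
Qed.

(** The quadratic expression 4^n - 3 * 2^n + 2 in 2^n factors as 2 (2^n - 1)(2^(n-1) - 1). *)
Lemma size_klein_words n : size (klein_words n) = num_klein n.
Proof.
case: n => [|n]; first by rewrite /num_klein.
rewrite /num_klein subSS subn0; have := size_klein_wordsE n.+1.
have -> : 4 ^ n.+1 = 2 ^ n.+1 * 2 ^ n.+1 by rewrite -expnMn.
rewrite !expnS; have := expn_gt0 2 n; move: (2 ^ n) => a /= a0 E.
have -> : (2 * a - 1) * (a - 1) = size (klein_words n.+1) * 3.
  case: a a0 E => // a _; rewrite /= => E; nia.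
by rewrite mulnK.
Qed.

End KleinCount.

Section KleinIndex.
Variable n : nat.

Definition klein_word (k : 'I_(num_klein n)) : seq 'I_4 := nth [::] (klein_words n) k.

Definition klein_config (k : 'I_(num_klein n)) (i : 'I_n) : 'I_4 := nth ord0 (klein_word k) i.

Lemma klein_word_mem k : klein_word k \in klein_words n.
Proof. by apply: mem_nth; rewrite size_klein_words. Qed.

Lemma ord0_4 : ord0 = @Ordinal 4 0 isT. Proof. exact: val_inj. Qed.

Lemma klein_config_canonical k : klein_canonical (klein_config k).
Proof.
have [_ [i1 [i2 [i1n i2n lt1 e1 [lt2 e2]]]]] := mem_klein_words _ _ (klein_word_mem k).
exists (Ordinal i1n), (Ordinal i2n); rewrite /klein_config ord0_4; split=> //.
  by move=> i; exact: lt1.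
by move=> i; exact: lt2.
Qed.

Lemma klein_config_inj k k' : klein_config k =1 klein_config k' -> k = k'.
Proof.
move=> kk; have [sk _] := mem_klein_words _ _ (klein_word_mem k).
have [sk' _] := mem_klein_words _ _ (klein_word_mem k').
have : klein_word k = klein_word k'.
  apply: (@eq_from_nth _ ord0) => [|i]; first by rewrite sk sk'.
  by rewrite sk => ik; exact: (kk (Ordinal ik)).
move/eqP; rewrite nth_uniq ?uniq_klein_words ?size_klein_words// => /eqP; exact: val_inj.
Qed.

Lemma klein_config_onto c : klein_canonical c -> exists k, c =1 klein_config k.
Proof.
move=> [i1 [i2 [lt1 e1 lt2 e2]]]; pose u := [seq c i | i <- enum 'I_n].
have un : size u = n by rewrite size_map size_enum_ord.
have nu (i : 'I_n) : nth ord0 u i = c i.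
  by rewrite (nth_map i) ?size_enum_ord// nth_ord_enum.
have uK : u \in klein_words n.
  apply/mem_klein_words; split=> //; exists i1, i2; rewrite -ord0_4 !nu; split=> //.
    by move=> i ii; rewrite (nu (Ordinal (ltn_trans ii (ltn_ord i1)))) lt1.
  split=> // i ii; rewrite (nu (Ordinal (ltn_trans ii (ltn_ord i2)))); exact: lt2.
have ik : (index u (klein_words n) < num_klein n)%N.
  by rewrite -size_klein_words index_mem.
exists (Ordinal ik) => i; rewrite /klein_config /klein_word /= nth_index//.
Qed.

End KleinIndex.

(** * The number of dihedral normal forms *)

Section DihedralCount.
Variables (n p : nat).
Local Notation N := (2 ^ p.+1)%N.
Local Notation h := (2 ^ p)%N.
Implicit Types (S : {set 'I_n}) (f : {ffun 'I_n -> 'I_N}).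

Definition dihedral_set : {set {set 'I_n} * {ffun 'I_n -> 'I_N}} :=
  [set Sf | `[< dihedral_canonical Sf.1 Sf.2 >]]%SET.

Definition zeroN : 'I_N := Ordinal (N_gt0 p).

Lemma hN_lt : (h < N)%N. Proof. by rewrite NE -[ltnLHS]addn0 ltn_add2l h_gt0. Qed.

Lemma card_nongeneric : #|[pred m : 'I_N | ~~ generic m]| = 2.
Proof.
have -> : #|[pred m : 'I_N | ~~ generic m]| = #|[set zeroN; Ordinal hN_lt]%SET|.
  by apply: eq_card => m; rewrite !inE /generic negb_and !negbK.
by rewrite cards2 -val_eqE /= eq_sym -lt0n h_gt0.
Qed.

(** Such functions are supported away from i0, with [zeroN] as value off the support, so
    [card_pffun_on] counts them. *)
Lemma card_ffun_at (i0 : 'I_n) (P : pred 'I_N) : P zeroN ->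
  #|[set f : {ffun 'I_n -> 'I_N} | (f i0 == zeroN) && [forall i, P (f i)]]%SET| = (#|P| ^ n.-1)%N.
Proof.
move=> P0; have -> : n.-1 = #|predC1 i0| by rewrite cardC1 card_ord.
rewrite -(card_pffun_on zeroN); apply: eq_card => f; rewrite inE.
apply/andP/pffun_onP => [[/eqP f0 /forallP fP]|[sf fP]].
  split; last by move=> m /fintype.imageP[i _ ->]; exact: fP.
  by apply/fintype.subsetP => i; rewrite !inE; apply: contra => /eqP ->; rewrite f0.
have f0 : f i0 = zeroN.
  by apply/eqP; apply: contraT => fi; have := fintype.subsetP sf i0 fi; rewrite !inE eqxx.
split; first by rewrite f0.
apply/forallP => i; have [->|ii] := eqVneq i i0; first by rewrite f0.
by apply: fP; apply/fintype.imageP; exists i.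
Qed.

(** Boolean form of the second condition of [dihedral_canonical], with [Q] in place of the bound by
    h so that both signs of the exponent can be compared. *)
Definition has_first_generic (Q : pred 'I_N) f :=
  [exists i1, [&& generic (f i1), Q (f i1) & [forall i : 'I_n, (i < i1)%N ==> ~~ generic (f i)]]].

Lemma first_generic_unique f (i j : 'I_n) : generic (f i) -> generic (f j) ->
  [forall k : 'I_n, (k < i)%N ==> ~~ generic (f k)] ->
  [forall k : 'I_n, (k < j)%N ==> ~~ generic (f k)] -> i = j.
Proof.
move=> gi gj /forallP ilt /forallP jlt; apply/val_inj; case: (ltngtP i j) => // ij.
  by have := jlt i; rewrite ij gi.
by have := ilt j; rewrite ij gj.
Qed.

(** Among the N^(n-1) functions vanishing at i0, those without generic value number 2^(n-1);
    negation exchanges the two halves of the rest, according to whether the first generic value is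
    below h. *)
Lemma card_first_generic (i0 : 'I_n) :
  (2 * #|[set f : {ffun 'I_n -> 'I_N} | (f i0 == zeroN) && has_first_generic (fun m => m < h)%N f]%SET|
   + 2 ^ n.-1 = N ^ n.-1)%N.
Proof.
set Q := [set f | _]%SET.
pose Q' := [set f : {ffun 'I_n -> 'I_N} | (f i0 == zeroN) &&
  has_first_generic (fun m => ~~ (m < h)%N) f]%SET.
pose Z := [set f : {ffun 'I_n -> 'I_N} | (f i0 == zeroN) && [forall i, ~~ generic (f i)]]%SET.
have zN : ~~ generic zeroN by [].
have ZE : #|Z| = (2 ^ n.-1)%N.
  by rewrite /Z (@card_ffun_at i0 [pred m | ~~ generic m])// card_nongeneric.
have TE : #|[set f : {ffun 'I_n -> 'I_N} | f i0 == zeroN]%SET| = (N ^ n.-1)%N.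
  rewrite -[in RHS](card_ord N) -(@card_ffun_at i0 predT)//.
  by apply: eq_card => f; rewrite !inE; case: (f i0 == zeroN) => //=; apply/esym/forallP.
pose neg f : {ffun 'I_n -> 'I_N} := [ffun i => negI (f i)].
have negK : involutive neg by move=> f; apply/ffunP => i; rewrite !ffunE negIK.
have QE : #|Q'| = #|Q|.
  rewrite -(card_imset _ (inv_inj negK)); apply: eq_card => f.
  rewrite -{1}(negK f) (mem_imset _ _ (inv_inj negK)) !inE.
  have -> : (neg f i0 == zeroN) = (f i0 == zeroN).
    apply/eqP/eqP => E.
      by rewrite -(negIK (f i0)); move: E; rewrite ffunE => ->; apply: val_inj; exact: negI0.
    by rewrite ffunE E; apply: val_inj; exact: negI0.
  congr (_ && _); apply/existsP/existsP => -[i1 /and3P[g1 h1 /forallP lt1]]; exists i1;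
    apply/and3P; split.
  - by move: g1; rewrite ffunE negI_genericE.
  - by move: g1 h1; rewrite ffunE negI_genericE => g1; rewrite negI_lt// negbK.
  - by apply/forallP => i; have := lt1 i; rewrite ffunE negI_genericE.
  - by rewrite ffunE negI_genericE.
  - by rewrite ffunE negI_lt// h1.
  - by apply/forallP => i; rewrite ffunE negI_genericE.
rewrite -TE -ZE mul2n -addnn -{1}QE.
have dQ : (Q' :&: Q = finset.set0)%SET.
  apply/setP => f; rewrite !inE; apply/negP => /andP[/andP[_ /existsP[i /and3P[gi hi li]]]].
  move=> /andP[_ /existsP[j /and3P[gj hj lj]]].
  by move: hi; rewrite (first_generic_unique gi gj li lj) hj.
have dZ : ((Q' :|: Q) :&: Z = finset.set0)%SET.
  apply/setP => f; rewrite !inE; apply/negP => /andP[+ /andP[_ /forallP nf]].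
  by case/orP=> /andP[_ /existsP[i /and3P[gi _ _]]]; have := nf i; rewrite gi.
rewrite -cardsUI dQ cards0 addn0 -cardsUI dZ cards0 addn0.
apply: eq_card => f; rewrite !inE; case: (f i0 == zeroN) => //=.
apply/idP; case: (boolP [exists i, generic (f i)]) => [/existsP[i gi]|]; last first.
  by rewrite negb_exists => ->; rewrite orbT.
have [i1 g1 lt1] := @first_index n (fun i => generic (f i)) (ex_intro _ i gi).
have first : [forall k : 'I_n, (k < i1)%N ==> ~~ generic (f k)].
  by apply/forallP => k; apply/implyP => /lt1/negP.
by apply/orP; left; apply/orP; have [fh|fh] := boolP (f i1 < h)%N; [right|left];
  apply/existsP; exists i1; rewrite g1 fh first.
Qed.

(** Every nonempty S admits the same number of exponent functions: with N = 2^(p+1), half of N^(n-1)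
    - 2^(n-1) is (2^(p(n-1)) - 1) 2^(n-2). *)
Lemma card_dihedral_set : #|dihedral_set| = num_dihedral n p.+2.
Proof.
have split : #|dihedral_set| = (\sum_(S : {set 'I_n})
    #|[set f : {ffun 'I_n -> 'I_N} | `[< dihedral_canonical S f >]]%SET|)%N.
  rewrite -sum1_card (eq_bigl (fun Sf => predT Sf.1 && `[< dihedral_canonical Sf.1 Sf.2 >])).
    by rewrite -(pair_big_dep predT (fun S f => `[< dihedral_canonical S f >]) (fun _ _ => 1%N)) /=;
      apply: eq_bigr => S _; rewrite -sum1_card; apply: eq_bigl => f; rewrite inE.
  by move=> Sf; rewrite inE.
pose r := (2 ^ (p * (n - 1)) - 1)%N.
have term S : #|[set f : {ffun 'I_n -> 'I_N} | `[< dihedral_canonical S f >]]%SET| =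
    if S == finset.set0 then 0%N else (r * 2 ^ (n - 2))%N.
  case: (finset.set_0Vmem S) => [->|[k0 k0S]].
    rewrite eqxx; apply: eq_card0 => f; rewrite inE; apply/negP => /asboolP[[i0 [+ _ _]] _].
    by rewrite inE.
  have -> : (S == finset.set0) = false by apply/negP => /eqP E; rewrite E inE in k0S.
  have [i0 i0S i0min] := @first_index n (fun i => i \in S) (ex_intro _ k0 k0S).
  have -> : [set f : {ffun 'I_n -> 'I_N} | `[< dihedral_canonical S f >]]%SET =
    [set f : {ffun 'I_n -> 'I_N} | (f i0 == zeroN) && has_first_generic (fun m => m < h)%N f]%SET.
    apply/setP => f; rewrite !inE; apply/asboolP/andP.
      move=> [[j0 [jS jmin fj]] [i1 [g1 h1 lt1]]].
      have -> : i0 = j0.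
        by apply: (canonical_i0_unique f i0S _ jS jmin) => i /i0min ni; apply/negP.
      split; first exact/eqP/val_inj.
      by apply/existsP; exists i1; rewrite g1 h1; apply/forallP => i; apply/implyP/lt1.
    move=> [/eqP f0 /existsP[i1 /and3P[g1 h1 /forallP lt1]]]; split.
      by exists i0; split=> //; [move=> i /i0min ni; apply/negP|rewrite f0].
    by exists i1; split=> // i ii; have := lt1 i; rewrite ii.
  have n0 : (0 < n)%N by exact: leq_ltn_trans (ltn_ord i0).
  have := card_first_generic i0; rewrite /r; move: #|_| => c.
  (* For n = 1 the exponent n - 2 is truncated to 0, and the product vanishes through its factor 2^0
     - 1. *)
  clear -n0; case: n n0 => [|[|m]] // _.
    by rewrite /= subnn muln0 !expn0 subnn mul0n; lia.
  rewrite -expnM (mulSn p) expnD /= !subSS !subn0 (expnS 2 m).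
  have := expn_gt0 2 (p * m.+1); move: (2 ^ (p * m.+1))%N (2 ^ m)%N => a b /= a0 E.
  nia.
rewrite split (bigD1 finset.set0)//= term eqxx add0n.
rewrite (eq_bigr (fun=> (r * 2 ^ (n - 2))%N)) => [|S S0]; last by rewrite term (negbTE S0).
have card_sets : #|{: {set 'I_n}}| = (2 ^ n)%N.
  rewrite -cardsT -[in RHS](card_ord n) -cardsT -card_powerset.
  by apply: eq_card => S; rewrite !inE finset.subsetT.
rewrite sum_nat_const cardC1 card_sets /num_dihedral /r mulnA -subn1 !subSS subn0.
by [].
Qed.

End DihedralCount.

(** * Components *)

Definition hom_of (Gamma : groupType) (G : groupTopologicalType) (f : Gamma -> G)
    (fM : {morph f : x y / (x * y)%g}) : hom_space Gamma G :=
  @to_subset {ptws Gamma -> G}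
    [set f : {ptws Gamma -> G} | {morph f : x y / (x * y)%g}] f fM.

Section Components.
Variables (R : realType) (n k : nat).
Local Notation K := (cplx R).
Local Notation SU2 := (special_unitary R 2).
Local Notation tuples := ({ptws 'I_n -> SU2}).
Implicit Types (A B : tuples) (e : 'rV['Z_2]_n) (h : SU2).

Lemma HomSU2P A : HomSU2 k A <-> nil_tuple k A.
Proof.
split=> [[f fA]|An].
  have -> : A = (\val f : _ -> SU2) \o @nilpotent_gen n k by apply/funext => i; exact: fA.
  by apply: nil_morph_tuple; exact: (set_mem (valP f)).
by exists (hom_of (nil_evalM An)) => i; rewrite /= nil_eval_gen.
Qed.

(** The inverse matches [conj_tuple], where h sends x to h x h^-1, whereas [x ^ g] is g^-1 x g. *)
Definition orbit_map A h : tuples := fun i => (A i ^ (h^-1))%g.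

Definition orbit A : set tuples := range (orbit_map A).

Lemma orbit_map_continuous A : continuous (orbit_map A).
Proof.
apply: continuous_ptws => i; rewrite /orbit_map /=.
have -> : (fun h => (A i ^ h^-1)%g) = (fun h => (h^-1^-1 * (A i * h^-1))%g) by [].
have invC : continuous (fun h : SU2 => (h^-1)%g).
  by apply: SU2_inv_continuous => h; exact: cvg_id.
apply: SU2_mul_continuous; first exact: SU2_inv_continuous.
by apply: SU2_mul_continuous => //; exact: cst_continuous.
Qed.

Lemma orbit_closed A : closed (orbit A).
Proof.
apply: compact_closed; first exact/hausdorff_ptws/SU2_hausdorff.
by apply: compact_range; [exact: SU2_compact|exact: orbit_map_continuous].
Qed.

Lemma orbit_connected A : connected (orbit A).
Proof. by apply: connected_range; [exact: SU2_connected|exact: orbit_map_continuous]. Qed.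

Lemma orbit_refl A : orbit A A.
Proof. by exists 1%g => //; apply/funext => i; rewrite /orbit_map invg1 conjg1. Qed.

Lemma orbit_sym A B : orbit A B -> orbit B A.
Proof.
move=> [h _ <-]; exists (h^-1)%g => //; apply/funext => i.
by rewrite /orbit_map -conjgM mulgV conjg1.
Qed.

Lemma orbit_trans B A D : orbit A B -> orbit B D -> orbit A D.
Proof.
move=> [h _ <-] [l _ <-]; exists (l * h)%g => //; apply/funext => i.
by rewrite /orbit_map -conjgM invgM.
Qed.

Lemma orbit_nil A B : orbit A B -> nil_tuple k A -> nil_tuple k B.
Proof. by move=> [h _ <-]; exact: nil_tuple_conj. Qed.

Lemma orbit_noncommuting A B : orbit A B -> noncommuting A -> noncommuting B.
Proof.
move=> [h _ <-] An cA; apply: An => i j; have := cA i j.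
by rewrite /orbit_map /commute -!conjMg => /conjg_inj.
Qed.

Lemma sign_tupleE e A i : sign_tuple e A i = (pm_sign R (e 0%R i) * A i)%g.
Proof.
apply: val_inj; rewrite /= /sign_of /pm_sign; case: (e 0 i) => [[|[|//]] ?] /=.
  by rewrite expr0 scale1r mul1mx.
rewrite expr1; have -> : \val (m1 R) = (-1)%:M :> 'M[K]_2.
  by rewrite special_quat alpha_m1 beta_m1 /quat scalar_mx22 !conjE oppr0.
by rewrite mul_scalar_mx.
Qed.

Lemma pm_sign_central (a : 'Z_2) h : commute (pm_sign R a) h.
Proof. by rewrite /pm_sign; case: ifP => _; [exact/commute_sym/commute1|exact: m1C]. Qed.

Lemma pm_sign_conj (a : 'Z_2) x h : ((pm_sign R a * x) ^ h = pm_sign R a * x ^ h)%g.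
Proof.
rewrite conjMg; congr (_ * _)%g; apply/conjg_fixP/commgP; exact: pm_sign_central.
Qed.

Lemma sign_orbit_map e A h : sign_tuple e (orbit_map A h) = orbit_map (sign_tuple e A) h.
Proof. by apply/funext => i; rewrite sign_tupleE /orbit_map sign_tupleE pm_sign_conj. Qed.

Lemma sign_orbit e A : sign_tuple e @` orbit A = orbit (sign_tuple e A).
Proof.
apply/seteqP; split=> [_ [_ [h _ <-] <-]|_ [h _ <-]].
  by exists h => //; rewrite sign_orbit_map.
by exists (orbit_map A h); [exists h|rewrite sign_orbit_map].
Qed.

Lemma sign_conj_orbit e A : sign_conj A e <-> orbit A (sign_tuple e A).
Proof.
split=> [[g gA]|[h _ hA]].
  by exists (g^-1)%g => //; apply/funext => i; rewrite /orbit_map invgK gA sign_tupleE.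
by exists (h^-1)%g => i; rewrite -sign_tupleE -hA.
Qed.

Lemma pm_conjP A B : pm_conj A B <-> exists e, orbit (sign_tuple e A) B.
Proof.
split=> [[g gAB]|[e [h _ <-]]]; last first.
  exists (h^-1)%g => i; rewrite /orbit_map sign_tupleE pm_sign_conj; apply: eqpm_sym.
  by rewrite /pm_sign; case: ifP => _; [left; rewrite mul1g|right].
pose e : 'rV['Z_2]_n := \row_i (if B i == (A i ^ g)%g then 0 else 1).
exists e; exists (g^-1)%g => //; apply/funext => i.
rewrite /orbit_map invgK sign_tupleE pm_sign_conj /e mxE.
case: eqP => [->|AB]; first by rewrite /pm_sign eqxx mul1g.
by case: (eqpm_sym (gAB i)).
Qed.

Lemma commuting_closed : closed [set A : tuples | forall i j, commute (A i) (A j)].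
Proof.
have -> : [set A : tuples | forall i j, commute (A i) (A j)] =
    \bigcap_(ij in [set: 'I_n * 'I_n]) [set A | (A ij.1 * A ij.2)%g = (A ij.2 * A ij.1)%g].
  by apply/seteqP; split=> [A cA ij _|A cA i j]; [exact: cA|exact: (cA (i, j) I)].
apply: closed_bigI => -[i j] _.
have pC l : continuous (fun A : tuples => A l) by exact: (@proj_continuous _ (fun=> SU2) l).
by apply: closed_eq_continuous; [exact: SU2_hausdorff|exact: SU2_mul_continuous|exact: SU2_mul_continuous].
Qed.

Variables (I : finType) (T : I -> tuples).
Hypothesis T_exhaustive : forall A, nil_tuple k A -> noncommuting A ->
  exists i, pm_conj A (T i).

(** The set U consists of the commuting tuples and of the other orbits of representatives. It is
    closed because commuting is a closed condition and there are finitely many such orbits, so it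
    separates the orbit of A from the rest of the space. *)
Lemma componentE A : nil_tuple k A -> noncommuting A -> component k A = orbit A.
Proof.
move=> Ak An; pose rep (p : 'rV['Z_2]_n * I) := sign_tuple p.1 (T p.2).
pose U : set tuples := [set B | forall i j, commute (B i) (B j)] `|`
  \bigcup_(p in [set p | ~ orbit A (rep p)]) orbit (rep p).
have cU : closed U.
  apply: closedU; first exact: commuting_closed.
  by apply: closed_bigcup => [|p _]; [exact: finite_finset|exact: orbit_closed].
have OU B : orbit A B -> U B -> False.
  move=> AB [BC|[p pA pB]]; first exact: (orbit_noncommuting AB An).
  by apply: pA; exact: orbit_trans AB (orbit_sym pB).
have sub : HomSU2 k `<=` orbit A `|` U.
  move=> B /HomSU2P Bk; have [AB|AB] := pselect (orbit A B); [by left|right].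
  have [BC|BC] := pselect (forall i j, commute (B i) (B j)); first by left.
  have [i /pm_conj_sym/pm_conjP[e eB]] := T_exhaustive Bk BC.
  right; exists (e, i) => // AT; apply: AB; exact: orbit_trans AT eB.
have AH : HomSU2 k A by exact/HomSU2P.
apply/seteqP; split; last first.
  apply: connected_component_max; [exact: orbit_refl| |exact: orbit_connected].
  by move=> B AB; apply/HomSU2P; exact: orbit_nil AB Ak.
have sep : separated (orbit A) U.
  split; rewrite -(closure_id _).1 //; do ?exact: orbit_closed.
    by apply/seteqP; split=> // B [] /OU/[apply].
  by apply/seteqP; split=> // B [] /OU/[apply].
have [//|CU] := connected_subset sep (subset_trans (@connected_component_sub _ _ _) sub)
  (@component_connected _ (HomSU2 k) A).
exfalso; apply: (OU A (orbit_refl A)); apply: CU.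
exact: connected_component_refl.
Qed.

Lemma nonabelian_componentP A : nil_tuple k A -> noncommuting A -> nonabelian_component k A.
Proof.
move=> Ak An; split; first exact/HomSU2P.
rewrite componentE// => B AB BC; apply: (orbit_noncommuting AB An) => i j.
by apply: BC; apply: generated_sub; [exists i|exists j].
Qed.

Lemma sign_stabE A : nil_tuple k A -> noncommuting A -> sign_stab k A = sign_group A.
Proof.
move=> Ak An; apply/setP => e; apply/sign_stabP/sign_groupP.
  rewrite /preserves componentE// sign_orbit => E.
  by apply/sign_conj_orbit; rewrite -E; exact: orbit_refl.
move=> /sign_conj_orbit AeA; rewrite /preserves componentE// sign_orbit.
apply/seteqP; split=> B; first exact: orbit_trans.
exact/orbit_trans/orbit_sym.
Qed.

End Components.

(** The order alone then determines a group of sign changes up to isomorphism. *)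
Lemma rV_abelem (n : nat) (H : {group 'rV['Z_2]_n}) : (2.-abelem H)%g.
Proof.
apply/abelemP => //; split.
  by apply/centsP => x _ y _; exact: (@addrC 'rV['Z_2]_n).
move=> x _; apply/(@rowP 'Z_2 n) => i; rewrite expgS expg1 !mxE.
by case: ((x : 'rV['Z_2]_n) ord0 i) => [[|[|//]] ?]; exact: val_inj.
Qed.

Lemma isog_rV2 n (H : {group 'rV['Z_2]_n}) : #|H| = 4 -> (H \isog [set: 'rV['Z_2]_2]%SET)%g.
Proof.
move=> H4; rewrite (isog_abelem_card _ (rV_abelem H)) (rV_abelem [set: 'rV['Z_2]_2]%G).
by rewrite H4 cardsT card_mx card_ord.
Qed.

Lemma isog_Z2 n (H : {group 'rV['Z_2]_n}) : #|H| = 2 -> (H \isog [set: 'Z_2]%SET)%g.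
Proof.
move=> H2; rewrite (isog_abelem_card _ (rV_abelem H)) H2 cardsT card_ord eqxx andbT.
apply/abelemP => //; split; first by apply/centsP => x _ y _; exact: (@addrC 'Z_2).
by move=> [[|[|//]] ?] _; exact: val_inj.
Qed.

(** * Tuples of U(2) and the homeomorphism *)

Section UnitaryTuples.
Variables (R : realType) (n : nat).
Local Notation K := (cplx R).
Local Notation SU2 := (special_unitary R 2).
Local Notation U2 := (unitary R 2).
Local Notation S1 := (circle R).
Local Notation tuples := ({ptws 'I_n -> SU2}).
Implicit Types (A B : tuples) (e : 'rV['Z_2]_n) (x y h : SU2) (z : {ptws 'I_n -> S1}).

Lemma circleP (a : S1) : `|\val a| = 1. Proof. exact: (set_mem (valP a)). Qed.

Lemma scalar_unitary_subproof (a : S1) : ((\val a)%:M : 'M[K]_2) \is unitarymx.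
Proof.
apply/unitarymxP; rewrite tr_scalar_mx map_scalar_mx -scalar_mxM /= -normCK.
by rewrite circleP expr1n.
Qed.

Definition uscal (a : S1) : U2 :=
  @to_subset _ (@unitary_set R 2) _ (scalar_unitary_subproof a).

Definition uinc (x : SU2) : U2 :=
  @to_subset _ (@unitary_set R 2) _ (special_unitaryP x).1.

Lemma uscal_central a (B : U2) : commute (uscal a) B.
Proof. by apply: val_inj; rewrite /= scalar_mxC. Qed.

Lemma uincM : {morph uinc : x y / (x * y)%g}.
Proof. by move=> x y; apply: val_inj. Qed.

Lemma uinc_inj : injective uinc.
Proof. by move=> x y /(congr1 val) /= xy; apply: val_inj. Qed.

(** The chosen representative of the class differs from h by 1 or -1, which is central. *)
Lemma conj_tuple_qclass A h : conj_tuple A (qclass (pm_one R) h) = orbit_map A h.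
Proof.
rewrite /conj_tuple; set l := generic_quotient.repr _; apply/funext => i; rewrite /orbit_map.
have : qclass (pm_one R) l = qclass (pm_one R) h by rewrite /l qclass_repr.
move=> /qclass_eq /= lh; have lhC x : commute (l^-1 * h)%g x.
  apply: val_inj; case: lh => E; rewrite [LHS]/= [RHS]/= [invmx _ *m _]E.
    by rewrite mul1mx mulmx1.
  by rewrite mulNmx mulmxN mul1mx mulmx1.
have -> : h = (l * (l^-1 * h))%g by rewrite mulVKg.
rewrite invgM conjgM; have -> : (A i ^ (l^-1 * h)^-1 = A i)%g.
  by apply/conjg_fixP/commgP/commuteV/commute_sym.
by rewrite conjgE invgK mulgA.
Qed.

Lemma conj_tuple_orbit A g : orbit A (conj_tuple A g).
Proof. by rewrite -(qclass_repr (g : quotient_group _)) conj_tuple_qclass; eexists. Qed.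

Lemma conj_tuple_continuous A : continuous (conj_tuple A).
Proof.
apply/quotient_continuous; have -> : conj_tuple A \o \pi_(PU2 R)%qT = orbit_map A.
  by apply/funext => h; exact: conj_tuple_qclass.
exact: orbit_map_continuous.
Qed.

(** Scalars times a conjugate of A; on the non-abelian summands it induces the images of the
    generators. *)
Definition twist A (p : {ptws 'I_n -> S1} * PU2 R) : {ptws 'I_n -> U2} :=
  fun i => (uscal (p.1 i) * uinc (conj_tuple A p.2 i))%g.

Lemma twist_continuous A : continuous (twist A).
Proof.
apply: continuous_ptws => i; apply: unitary_mul_continuous; apply: unitary_continuous.
  apply: continuous_mx => j l.
  have zC : continuous (fun p : {ptws 'I_n -> S1} * PU2 R => \val (p.1 i) : K).
    move=> p; apply: (@continuous_comp _ _ _ (fun p : {ptws 'I_n -> S1} * PU2 R => p.1 i)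
      (fun a : S1 => \val a : K)); last exact: subtype_val_continuous.
    apply: (@continuous_comp _ _ _ fst (fun z : {ptws 'I_n -> S1} => z i)); first exact: cvg_fst.
    exact: (@proj_continuous _ (fun=> S1) i).
  have -> : (fun p : {ptws 'I_n -> S1} * PU2 R => (\val (uscal (p.1 i)) : 'M[K]_2) j l) =
      if j == l then (fun p => \val (p.1 i)) else (fun=> 0).
    by case: (boolP (j == l)) => jl; apply/funext => p;
      rewrite mxE ?jl ?(negbTE jl) ?mulr1n ?mulr0n.
  by case: ifP => _; [exact: zC|exact: cst_continuous].
move=> p; apply: (@continuous_comp _ _ _ (fun p : {ptws 'I_n -> S1} * PU2 R => conj_tuple A p.2 i)
  (fun x : SU2 => \val x : 'M[K]_2)); last exact: subtype_val_continuous.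
apply: (@continuous_comp _ _ _ snd (fun g => conj_tuple A g i)); first exact: cvg_snd.
by apply: ptws_continuous; exact: conj_tuple_continuous.
Qed.

Lemma twist_nil k A p : (2 <= k)%N -> nil_tuple k A -> nil_tuple k (twist A p).
Proof.
move=> k2 Ak; apply: nil_tuple_twist => //; first by move=> i B; exact: uscal_central.
have := orbit_nil (conj_tuple_orbit A p.2) Ak.
by move/(nil_tuple_comp _ _ uincM uinc_inj).
Qed.

Lemma twist_commute A p : (forall i j, commute (twist A p i) (twist A p j)) ->
  forall i j, commute (A i) (A j).
Proof.
move=> tC; apply: contrapT => /(orbit_noncommuting (conj_tuple_orbit A p.2)); apply=> i j.
apply: uinc_inj; rewrite [LHS]uincM [RHS]uincM; have := tC i j; rewrite /twist /commute.
set a := uscal _; set b := uscal _; set u := uinc _; set v := uinc _ => E.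
have aC (D : U2) : commute a D by exact: uscal_central.
have bC (D : U2) : commute b D by exact: uscal_central.
have L : (a * u * (b * v) = a * b * (u * v))%g.
  by rewrite mulgA -(mulgA a u b) -(bC u) !mulgA.
have L' : (b * v * (a * u) = a * b * (v * u))%g.
  by rewrite mulgA -(mulgA b v a) -(aC v) !mulgA (aC b).
apply: (@mulgI _ (a * b)%g).  exact: (etrans (esym L) (etrans E L')).
Qed.

Lemma sign_circleE e z i : uscal (sign_circle e z i) = (uinc (pm_sign R (e 0%R i)) * uscal (z i))%g.
Proof.
apply: val_inj; rewrite /= /pm_sign /sign_of.
have E : \val (m1 R) = - 1%:M :> 'M[K]_2.
  rewrite special_quat alpha_m1 beta_m1 /quat scalar_mx22 !conjE oppr0.
  by apply/matrixP => a b; rewrite !mxE; case: ifP => _; case: ifP; rewrite ?oppr0.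
case: (e 0 i) => [[|[|//]] ?] /=; first by rewrite expr0 mul1r mul1mx.
by rewrite E mulNmx mul1mx expr1 mulN1r raddfN.
Qed.

(** The sign occurs once in the scalar and once in the SU(2) factor, and its square is 1. *)
Lemma twist_sign A B p p' e : p'.1 = sign_circle e p.1 ->
  conj_tuple B p'.2 = sign_tuple e (conj_tuple A p.2) -> twist A p = twist B p'.
Proof.
move=> E1 E2; apply/funext => i; rewrite /twist E1 E2 sign_circleE sign_tupleE uincM.
set s := uinc (pm_sign _ _).
have ss : (s * s = 1)%g.
  rewrite -uincM /pm_sign; have -> : ((if e 0%R i == 0 then 1 else m1 R) *
    (if e 0%R i == 0 then 1 else m1 R) = 1 :> SU2)%g.
    by case: ifP => _; rewrite ?mulg1 ?m1M.
  exact: (morph_one uincM).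
by rewrite -(uscal_central _ s) -!mulgA (mulgA s) ss mul1g.
Qed.

(** The SU(2) factors have determinant 1, so corresponding scalars have equal squares and differ by
    a sign, which the other factors compensate. Two tuples are allowed because injectivity is also
    needed across summands. *)
Lemma twist_eq A B p p' : twist A p = twist B p' -> exists e,
  p'.1 = sign_circle e p.1 /\ conj_tuple B p'.2 = sign_tuple e (conj_tuple A p.2).
Proof.
move=> E; pose e : 'rV['Z_2]_n := \row_i (if p'.1 i == p.1 i then 0 else 1).
have Ei i : (\val (p.1 i) : K) *: (\val (conj_tuple A p.2 i) : 'M[K]_2) =
    (\val (p'.1 i) : K) *: (\val (conj_tuple B p'.2 i) : 'M[K]_2).
  have /(congr1 val) := congr1 (fun T : {ptws 'I_n -> U2} => T i) E.
  by rewrite /= !mul_scalar_mx.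
have zz i : \val (p'.1 i) = \val (p.1 i) :> K \/ \val (p'.1 i) = - \val (p.1 i) :> K.
  have := congr1 determinant (Ei i); rewrite !detZ.
  have [_ ->] := special_unitaryP (conj_tuple A p.2 i).
  have [_ ->] := special_unitaryP (conj_tuple B p'.2 i).
  by rewrite !mulr1 => /esym/eqP; rewrite eqf_sqr => /orP[] /eqP; [left|right].
have z0 i : \val (p.1 i) != 0 :> K by rewrite -normr_eq0 circleP oner_eq0.
have sE i : sign_of R e i = if p'.1 i == p.1 i then 1 else -1.
  by rewrite /sign_of /e mxE; case: ifP => _; rewrite ?expr0 ?expr1.
have zs i : \val (p'.1 i) = sign_of R e i * \val (p.1 i).
  rewrite sE; case: eqP => [->|ne]; first by rewrite mul1r.
  case: (zz i) => [zE|->]; last by rewrite mulN1r.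
  by exfalso; apply: ne; exact: val_inj.
exists e; split; apply/funext => i; apply: val_inj; first exact: zs.
rewrite /=; apply: (scalerI (z0 i)).
have s1 : sign_of R e i * sign_of R e i = 1.
  by rewrite sE; case: ifP => _; rewrite ?mulr1 ?mulrNN ?mulr1.
by rewrite scalerA mulrC -scalerA (Ei i) zs !scalerA mulrA s1 mul1r.
Qed.

Lemma twist_pm_conj A B p p' : twist A p = twist B p' -> pm_conj A B.
Proof.
move=> /twist_eq[e [_ E]]; apply/pm_conjP; exists e.
apply: orbit_trans (orbit_sym (conj_tuple_orbit B p'.2)); rewrite E -sign_orbit.
by exists (conj_tuple A p.2) => //; exact: conj_tuple_orbit.
Qed.

(** The scalar is a square root of the determinant, of modulus 1 since the determinant is. *)
Lemma unitary_decomposition (B : U2) : exists a x, B = (uscal a * uinc x)%g.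
Proof.
pose d : K := \det (\val B : 'M[K]_2).
have d1 : `|d| = 1.
  have /unitarymxP/(congr1 determinant) := unitaryP B.
  rewrite det_mulmx det_map_mx det_tr det1 -/d -normCK => /eqP.
  by rewrite sqrp_eq1 ?normr_ge0// => /eqP.
have a1 : `|sqrtC d| = 1.
  apply/eqP; rewrite -(@sqrp_eq1 _ `|sqrtC d|) ?normr_ge0// -normrX sqrtCK d1//.
pose a : S1 := @to_subset _ (@circle_set R) (sqrtC d) a1.
have a0 : sqrtC d != 0 by rewrite -normr_eq0 a1 oner_eq0.
have aV : `|(sqrtC d)^-1| = 1 by rewrite normfV a1 invr1.
pose b : S1 := @to_subset _ (@circle_set R) ((sqrtC d)^-1) aV.
pose x0 : U2 := (uscal b * B)%g.
have x0E : \val x0 = (sqrtC d)^-1 *: \val B by rewrite /= mul_scalar_mx.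
have x0d : \val x0 \is unitarymx /\ \det (\val x0 : 'M[K]_2) = 1.
  split; first exact: unitaryP.
  by rewrite x0E detZ -/d exprVn sqrtCK mulVf// -normr_eq0 d1 oner_eq0.
exists a, (@to_subset _ (@special_unitary_set R 2) _ x0d); apply: val_inj => /=.
by rewrite !mul_scalar_mx scalerA divff// scale1r.
Qed.

(** Quantifying over A' lets the representative of the class replace A; the signs relating the two
    are absorbed into the circle coordinates. *)
Lemma twist_onto k (B : {ptws 'I_n -> U2}) : (2 <= k)%N -> nil_tuple k B ->
  ~ (forall i j, commute (B i) (B j)) ->
  exists A, [/\ nil_tuple k A, noncommuting A &
    forall A', pm_conj A A' -> exists p, twist A' p = B].
Proof.
move=> k2 Bk BC; have [a /fin_all_exists[A BE]] := fin_all_exists (fun i => unitary_decomposition (B i)).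
have aV i : `|(\val (a i) : K)^-1| = 1 by rewrite normfV circleP invr1.
pose b i : S1 := @to_subset _ (@circle_set R) _ (aV i).
have ba i : (uscal (b i) * uscal (a i) = 1)%g.
  apply: val_inj; rewrite /= -scalar_mxM mulVf// -normr_eq0 circleP oner_eq0//.
have AE i : uinc (A i) = (uscal (b i) * B i)%g by rewrite BE mulgA ba mul1g.
exists A; split.
- apply/(nil_tuple_comp _ _ uincM uinc_inj).
  have -> : uinc \o A = (fun i => uscal (b i) * B i)%g by apply/funext => i; exact: AE.
  by apply: nil_tuple_twist => // i D; exact: uscal_central.
- move=> cA; apply: BC => i j; rewrite !BE; apply: commuteM.
    exact/commute_sym/uscal_central.
  apply/commute_sym/commuteM; first exact/commute_sym/uscal_central.
  by rewrite /commute -!uincM; congr uinc; exact: cA.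
- move=> A' /pm_conj_sym/pm_conjP[e [h _ hA]].
  exists (sign_circle e a, qclass (pm_one R) h).
  have p0 : twist A' (sign_circle e a, qclass (pm_one R) h) =
      fun i => (uscal (sign_circle e a i) * uinc (orbit_map A' h i))%g.
    by apply/funext => i; rewrite /twist /= conj_tuple_qclass.
  rewrite p0; apply/funext => i; rewrite BE -hA -sign_orbit_map sign_tupleE sign_circleE uincM.
  by rewrite -(uscal_central _ (uinc (pm_sign R _))) -!mulgA.
Qed.

End UnitaryTuples.

(** The topology of the homomorphism space tests every element of the group, not only the
    generators, so continuity is needed for each word. *)
Lemma eval_continuous (R : realType) (n : nat) (X : topologicalType)
    (B : X -> {ptws 'I_n -> unitary R 2}) (u : free_group n) :
  continuous B -> continuous (fun x => free_eval (B x) u).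
Proof.
move=> Bc; rewrite /free_eval; elim: (val u) => [|[i b] v IHv].
  exact: cst_continuous.
have Bi : continuous (fun x => B x i) by exact: ptws_continuous.
apply: unitary_mul_continuous; last exact: IHv.
by case: b; [exact: unitary_inv_continuous|exact: Bi].
Qed.

Lemma hom_space_hausdorff (Gamma : groupType) (R : realType) m :
  hausdorff_space (hom_space Gamma (unitary R m)).
Proof. exact/hausdorff_subtype/hausdorff_ptws/unitary_hausdorff. Qed.

(** Being a homomorphism is a closed condition in a product of compact spaces. *)
Lemma hom_space_compact (Gamma : groupType) (R : realType) m :
  compact [set: hom_space Gamma (unitary R m)].
Proof.
apply: compact_subtype.
have cT : compact [set: {ptws Gamma -> unitary R m}].
  have := @tychonoff Gamma (fun=> unitary R m) (fun=> setT) (fun=> @unitary_compact R m).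
  by congr compact; apply/seteqP; split.
apply: (subclosed_compact _ cT) => //.
have -> : [set f : {ptws Gamma -> unitary R m} | {morph f : x y / (x * y)%g}] =
    \bigcap_(xy in [set: Gamma * Gamma])
      [set f : {ptws Gamma -> unitary R m} | f (xy.1 * xy.2)%g = (f xy.1 * f xy.2)%g].
  by apply/seteqP; split=> [f fM xy _|f fM x y]; [exact: fM|exact: (fM (x, y) I)].
apply: closed_bigI => -[x y] _.
have pC w : continuous (fun f : {ptws Gamma -> unitary R m} => f w).
  exact: (@proj_continuous _ (fun=> unitary R m) w).
by apply: closed_eq_continuous; [exact: unitary_hausdorff|exact: pC|exact: unitary_mul_continuous].
Qed.

Lemma compact_quotient (T : topologicalType) (Q : quotType T) :
  compact [set: T] -> compact [set: quotient_topology Q].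
Proof.
move=> cT; have -> : [set: quotient_topology Q] = range (\pi_(quotient_topology Q)%qT : T -> _).
  by apply/seteqP; split=> // c _; exists (generic_quotient.repr c); rewrite ?reprK.
by apply: compact_range => //; exact: pi_continuous.
Qed.

Lemma balanced_compact (R : realType) n (H : {group 'rV['Z_2]_n})
    (A : {ptws 'I_n -> special_unitary R 2}) : compact [set: balanced_product H A].
Proof.
apply: compact_quotient; rewrite -setXTT; apply: compact_setX.
  have := @tychonoff 'I_n (fun=> circle R) (fun=> setT) (fun=> @circle_compact R).
  by congr compact; apply/seteqP; split.
by apply: compact_quotient; exact: SU2_compact.
Qed.

(** * The decomposition for given families of representatives *)

Section Homeomorphism.
Variables (R : realType) (n k a b : nat).
Local Notation SU2 := (special_unitary R 2).
Local Notation U2 := (unitary R 2).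
Local Notation tuples := ({ptws 'I_n -> SU2}).
Variables (x : 'I_a -> tuples) (y : 'I_b -> tuples).
Hypothesis k2 : (2 <= k)%N.
Hypothesis xP : forall i, nil_tuple k (x i) /\ noncommuting (x i).
Hypothesis yP : forall j, nil_tuple k (y j) /\ noncommuting (y j).
Hypothesis x_inj : forall i i', pm_conj (x i) (x i') -> i = i'.
Hypothesis y_inj : forall j j', pm_conj (y j) (y j') -> j = j'.
Hypothesis xy_disjoint : forall i j, ~ pm_conj (x i) (y j).
Hypothesis xy_onto : forall A : tuples, nil_tuple k A -> noncommuting A ->
  (exists i, pm_conj A (x i)) \/ (exists j, pm_conj A (y j)).

Let T (s : 'I_a + 'I_b) : tuples := match s with inl i => x i | inr j => y j end.

Let T_exhaustive (A : tuples) : nil_tuple k A -> noncommuting A -> exists s, pm_conj A (T s).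
Proof.
by move=> Ak An; case: (xy_onto Ak An) => -[i Ai]; [exists (inl i)|exists (inr i)].
Qed.

Lemma family_sign_stabE (A : tuples) : nil_tuple k A -> noncommuting A ->
  sign_stab k A = sign_group A.
Proof. exact: (sign_stabE T_exhaustive). Qed.

Lemma family_component (A : tuples) : nil_tuple k A -> noncommuting A ->
  nonabelian_component k A.
Proof. exact: (nonabelian_componentP T_exhaustive). Qed.

(** Read at a chosen representative; [twist_sign] makes the value constant on the orbits of the
    diagonal action. *)
Definition balanced_twist (A : tuples) (c : balanced_product (sign_stab_group k A) A) :
  {ptws 'I_n -> U2} := twist A (generic_quotient.repr c).

Lemma balanced_twist_pi (A : tuples) p :
  balanced_twist (\pi_(balanced_product (sign_stab_group k A) A)%qT p) = twist A p.
Proof.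
rewrite /balanced_twist; set r := generic_quotient.repr _.
have /eqmodP/asboolP[e _ [E1 E2]] : (r = p %[mod {eq_quot balanced_equiv (sign_stab_group k A) A}])%qT.
  by rewrite reprK.
exact: twist_sign E1 E2.
Qed.

Lemma balanced_twist_continuous (A : tuples) : continuous (@balanced_twist A).
Proof.
apply/quotient_continuous.
have -> : @balanced_twist A \o \pi_(balanced_product (sign_stab_group k A) A)%qT = twist A.
  by apply/funext => p; exact: balanced_twist_pi.
exact: twist_continuous.
Qed.

(** Both conjugates lie in the orbit of A, so the sign change relating them preserves this orbit and
    belongs to the group by which the product is divided. *)
Lemma balanced_twist_inj (A : tuples) : nil_tuple k A -> noncommuting A ->
  injective (@balanced_twist A).
Proof.
move=> Ak An c c'; rewrite -[c]reprK -[c']reprK !balanced_twist_pi => /twist_eq[e [E1 E2]].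
apply/eqmodP/asboolP; exists e => //; rewrite -[_ \in _]/(e \in sign_stab k A) family_sign_stabE//.
apply/sign_groupP/sign_conj_orbit.
set g := (generic_quotient.repr c).2 in E2; set g' := (generic_quotient.repr c').2 in E2.
apply: orbit_trans (conj_tuple_orbit A g') _; rewrite E2.
apply: orbit_sym; rewrite -sign_orbit; exists (conj_tuple A g) => //; exact: conj_tuple_orbit.
Qed.

Let RHS : topologicalType :=
  (hom_space (Zpow n) U2 +
   {i : 'I_a & balanced_product (sign_stab_group k (x i)) (x i)} +
   {j : 'I_b & balanced_product (sign_stab_group k (y j)) (y j)})%type.

(** The images of the generators; [total] extends them to the quotient group. *)
Let base (r : RHS) : {ptws 'I_n -> U2} :=
  match r with
  | inl (inl f) => fun i => \val f (Zpow_gen i)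
  | inl (inr c) => balanced_twist (projT2 c)
  | inr c => balanced_twist (projT2 c)
  end.

Let base_continuous : continuous base.
Proof.
apply: sum_continuous; last first.
  by apply: (@sigT_continuous _ _ _ (fun j => @balanced_twist (y j))) => j; exact: balanced_twist_continuous.
apply: sum_continuous; last first.
  by apply: (@sigT_continuous _ _ _ (fun i => @balanced_twist (x i))) => i; exact: balanced_twist_continuous.
apply: continuous_ptws => i f.
apply: (@continuous_comp _ _ _ (fun f : hom_space (Zpow n) U2 => \val f : {ptws Zpow n -> U2})
  (fun h => h (Zpow_gen i))); first exact: subtype_val_continuous.
exact: (@proj_continuous _ (fun=> U2) (Zpow_gen i)).
Qed.

Let Zpow_morph (f : hom_space (Zpow n) U2) : {morph (\val f : Zpow n -> U2) : u v / (u * v)%g}.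
Proof. exact: (set_mem (valP f)). Qed.

Let base_Zpow_commute (f : hom_space (Zpow n) U2) i j :
  commute (\val f (Zpow_gen i) : U2) (\val f (Zpow_gen j)).
Proof. by rewrite /commute -!Zpow_morph Zpow_commute. Qed.

Let base_nil r : nil_tuple k (base r).
Proof.
case: r => [[f|[i c]]|[j c]]; first by apply: comm_nil_tuple => // i j; exact: base_Zpow_commute.
  by apply: twist_nil => //; have [] := xP i.
by apply: twist_nil => //; have [] := yP j.
Qed.

Let base_noncommuting (A : tuples) p : noncommuting A ->
  ~ (forall i j, commute (twist A p i) (twist A p j)).
Proof. by move=> An tC; apply: An; exact: twist_commute tC. Qed.

(** Commutativity separates the first summand from the others, and the classes of [pm_conj] separate
    these from each other. *)
Let base_inj : injective base.
Proof.
move=> [[f|[i c]]|[j c]] [[f'|[i' c']]|[j' c']] /= E.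
- congr (inl (inl _)); apply: val_inj; apply/funext.
  by apply: Zpow_morph_inj; [exact: Zpow_morph|exact: Zpow_morph|].
- have [_ An] := xP i'; exfalso.
  apply: (base_noncommuting (p := generic_quotient.repr c') An) => l m.
  by rewrite -[twist _ _]E; exact: base_Zpow_commute.
- have [_ An] := yP j'; exfalso.
  apply: (base_noncommuting (p := generic_quotient.repr c') An) => l m.
  by rewrite -[twist _ _]E; exact: base_Zpow_commute.
- have [_ An] := xP i; exfalso.
  apply: (base_noncommuting (p := generic_quotient.repr c) An) => l m.
  by rewrite [twist _ _]E; exact: base_Zpow_commute.
- have ii := x_inj (twist_pm_conj E); subst i'.
  have [Ak An] := xP i.
  by congr (inl (inr (existT _ _ _))); exact: balanced_twist_inj E.
- by have := xy_disjoint (twist_pm_conj E).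
- have [_ An] := yP j; exfalso.
  apply: (base_noncommuting (p := generic_quotient.repr c) An) => l m.
  by rewrite [twist _ _]E; exact: base_Zpow_commute.
- by have := xy_disjoint (pm_conj_sym (twist_pm_conj E)).
- have jj := y_inj (twist_pm_conj E); subst j'.
  have [Ak An] := yP j.
  by congr (inr (existT _ _ _)); exact: balanced_twist_inj E.
Qed.

Let base_onto (B : {ptws 'I_n -> U2}) : nil_tuple k B -> exists r, base r = B.
Proof.
move=> Bk; have [BC|BC] := pselect (forall i j, commute (B i) (B j)).
  exists (inl (inl (hom_of (Zpow_evalM BC)))); apply/funext => i /=.
  exact: Zpow_eval_gen.
have [A [Ak An AT]] := twist_onto k2 Bk BC.
case: (xy_onto Ak An) => -[i /AT[p pB]].
  exists (inl (inr (existT _ i (\pi_(balanced_product (sign_stab_group k (x i)) (x i))%qT p)))).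
  by rewrite -pB /=; exact: balanced_twist_pi.
exists (inr (existT _ i (\pi_(balanced_product (sign_stab_group k (y i)) (y i))%qT p))).
by rewrite -pB /=; exact: balanced_twist_pi.
Qed.

Let total (r : RHS) : hom_space (nilpotent_free n k) U2 := hom_of (nil_evalM (@base_nil r)).

Let total_continuous : continuous total.
Proof.
apply: continuous_subtype; apply: continuous_ptws => u.
by apply: eval_continuous; exact: base_continuous.
Qed.

Let total_gen r i : \val (total r) (nilpotent_gen k i) = base r i.
Proof. exact: nil_eval_gen (@base_nil r). Qed.

Let total_bij : bijective total.
Proof.
have inj : injective total.
  by move=> r r' E; apply: base_inj; apply/funext => i; rewrite -!total_gen E.
have onto f : exists r, total r = f.
  have fM : {morph (\val f : nilpotent_free n k -> U2) : u v / (u * v)%g}.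
    exact: (set_mem (valP f)).
  have [r rE] := base_onto (nil_morph_tuple fM); exists r.
  apply: val_inj; apply/funext; apply: nil_morph_inj => //; first exact: (nil_evalM (@base_nil r)).
  by apply/funext => i; rewrite -[LHS]/(\val (total r) (nilpotent_gen k i)) total_gen rE.
have [g gK] := choice onto.
by exists g => // r; apply: inj; rewrite gK.
Qed.

Lemma hom_space_decomposition :
  homeomorphic (hom_space (nilpotent_free n k) U2)
    (hom_space (Zpow n) U2 +
     {i : 'I_a & balanced_product (sign_stab_group k (x i)) (x i)} +
     {j : 'I_b & balanced_product (sign_stab_group k (y j)) (y j)})%type.
Proof.
apply: (compact_hausdorff_homeo (f := total)).
- apply: compact_sum; last by apply: sigT_compact => [|j]; [exact: finite_finset|exact: balanced_compact].
  apply: compact_sum; last by apply: sigT_compact => [|j]; [exact: finite_finset|exact: balanced_compact].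
  exact: hom_space_compact.
- exact: hom_space_hausdorff.
- exact: total_continuous.
- exact: total_bij.
Qed.

End Homeomorphism.

Close Scope ring_scope.
Close Scope classical_set_scope.

Theorem corollary4 (R : realType) (q n : nat) (hq : (2 <= q)%N) (hn : (1 <= n)%N) :
  exists (x : 'I_(num_klein n) -> {ptws 'I_n -> special_unitary R 2})
         (y : 'I_(num_dihedral n q) -> {ptws 'I_n -> special_unitary R 2}),
    [/\ forall i, nonabelian_component q.+1 (x i) /\
          (sign_stab q.+1 (x i) \isog [set: 'rV['Z_2]_2])%g,
        forall j, nonabelian_component q.+1 (y j) /\
          (sign_stab q.+1 (y j) \isog [set: 'Z_2])%g
      & homeomorphic
          (hom_space (nilpotent_free n q.+1) (unitary R 2))
          (hom_space (Zpow n) (unitary R 2) +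
           {i : 'I_(num_klein n) &
             balanced_product (sign_stab_group q.+1 (x i)) (x i)} +
           {j : 'I_(num_dihedral n q) &
             balanced_product (sign_stab_group q.+1 (y j)) (y j)})%type].
Proof.
(* From here on q = p + 2, and the quotient is by the term p + 3. *)
case: q hq => [|[|p]] // _.
pose x (i : 'I_(num_klein n)) : {ptws 'I_n -> special_unitary R 2} :=
  klein_letter R \o klein_config i.
pose config (j : 'I_(num_dihedral n p.+2)) := enum_val (cast_ord (esym (card_dihedral_set n p)) j).
have configP j : dihedral_canonical (config j).1 (config j).2.
  by have := enum_valP (cast_ord (esym (card_dihedral_set n p)) j); rewrite inE => /asboolP.
pose y (j : 'I_(num_dihedral n p.+2)) : {ptws 'I_n -> special_unitary R 2} :=
  dihedral_tuple R (config j).1 (config j).2.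
have xP i : nil_tuple p.+3 (x i) /\ noncommuting (x i).
  split; first by apply: quaternionic_nil => l; exact: klein_letter_quaternionic.
  move=> xC; have [i1 [i2 [_ _ _]]] := klein_noncommuting_pair R (klein_config_canonical i).
  by apply; exact: xC.
have y_npm j : ~ pm_commuting (y j) by exact: dihedral_not_pm_commuting.
have yP j : nil_tuple p.+3 (y j) /\ noncommuting (y j).
  split; first by apply: quaternionic_nil => l; exact: root_letter_quaternionic.
  by move=> yC; apply: (y_npm j) => l m; left; exact: yC.
have x_inj i i' : pm_conj (x i) (x i') -> i = i'.
  move=> ii; apply: klein_config_inj.
  exact: klein_unique (klein_config_canonical i) (klein_config_canonical i') ii.
have y_inj j j' : pm_conj (y j) (y j') -> j = j'.
  move=> /(dihedral_unique (configP j) (configP j'))[E1 E2].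
  have /enum_val_inj/cast_ord_inj : config j = config j'; last by [].
  by move: E1 E2; case: (config j) (config j') => [? ?] [? ?] /= -> ->.
have xy_disjoint i j : ~ pm_conj (x i) (y j).
  move=> ij; apply: (y_npm j); apply: pm_conj_commuting ij _; exact: klein_pm_commuting.
have xy_onto (A : {ptws 'I_n -> special_unitary R 2}) : nil_tuple p.+3 A -> noncommuting A ->
    (exists i, pm_conj A (x i)) \/ (exists j, pm_conj A (y j)).
  move=> Ak An; have [Apm|Apm] := pselect (pm_commuting A); [left|right].
    have [c cP Ac] := klein_exists An Apm.
    have [i iE] := klein_config_onto cP; exists i.
    by have <- : klein_letter R \o c = x i by apply/funext => l; rewrite /x /= iE.
  have [S [f [cP Af]]] := dihedral_exists Ak An Apm.
  have Sf : (S, f) \in dihedral_set n p by rewrite inE; apply/asboolP.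
  exists (cast_ord (card_dihedral_set n p) (enum_rank_in Sf (S, f))).
  by rewrite /y /config cast_ordK enum_rankK_in.
exists x, y; split.
- move=> i; have [xk xn] := xP i; split; first exact: (family_component xy_onto).
  apply: (@isog_rV2 _ (sign_stab_group p.+3 (x i))).
  by rewrite /= (family_sign_stabE xy_onto)// klein_sign_group//; exact: klein_config_canonical.
- move=> j; have [yk yn] := yP j; split; first exact: (family_component xy_onto).
  apply: (@isog_Z2 _ (sign_stab_group p.+3 (y j))).
  by rewrite /= (family_sign_stabE xy_onto)// dihedral_sign_group.
- exact: hom_space_decomposition.
Qed.
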